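(* Let $n\ge16$ be a multiple of $4$, let $c_a,c_b,c_e>0$ and $0<c_l\le c_L$. Let $x^*\in\mathcal C^n$ and let $f\in\mathcal{BL}[c_l,c_L,c_e]$ be geometric, i.e. $f(x,y)=g(d(x,y))$ for all $x,y\in\mathcal C$ for some $g:[0,\pi]\to[0,1]$. Let $F=[f(x^*_i,x^*_j)]_{i,j}$, with eigenvalues $\lambda^*_0\ge\dots\ge\lambda^*_{n-1}$, and suppose the observed random symmetric matrix $A$ satisfies $A_{ii}=0$ and $A_{ij}=F_{ij}+E_{ij}$ for $i<j$, where the centered independent variables $(E_{ij})_{i<j}$ satisfy the subGaussian(1) condition. Assume that $$d_\infty(x^*,\Pi_n)\le c_a\sqrt{\frac{\log n}{n}},$$ and that the spectral gaps $\Delta_1=\lambda^*_0-\lambda^*_1$ and $\Delta_2=\lambda^*_2-\lambda^*_3$ satisfy $\Delta_1\wedge\Delta_2\ge c_bn$. Then there exists a constant $C_{lLeab}>0$ depending only on $c_e,c_l,c_L,c_a,c_b$ such that, with probability at least $1-9/n^2$, the output $\hat x$ of the spectral Localize-and-Refine procedure applied to $A$ satisfies $$\min_{Q\in\mathcal O}d_\infty(\hat x,Qx^* )\le C_{lLeab}\sqrt{\frac{\log n}{n}}.$$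
   Context: Geometry. $\mathcal C$ is the unit circle in $\mathbb R^2$, identified with unit complex numbers; $x\in\mathcal C$ has argument $\underline x\in[0,2\pi)$; $d(x,y)=|\underline x-\underline y|\wedge(2\pi-|\underline x-\underline y|)$. For tuples $x,y$ of points of $\mathcal C$ indexed by the same set, $d_\infty(x,y)=\max_i d(x_i,y_i)$. For $k\ge1$: $\mathcal C_k=\{e^{\iota 2\pi j/k}:0\le j\le k-1\}$, and $\Pi_k$ is the set of $k$-tuples $(e^{\iota2\pi\sigma(j)/k})_{1\le j\le k}$, $\sigma$ a permutation of $\{1,\dots,k\}$. $d_\infty(x,\Pi_k)=\min_{y\in\Pi_k}d_\infty(x,y)$. $\mathcal O$ is the orthogonal group of $\mathbb R^2$, and $Qx=(Qx_1,\dots,Qx_n)$. $\mathcal{BL}[c_l,c_L,c_e]$ is the set of symmetric functions $f:\mathcal C\times\mathcal C\to[0,1]$ such that for all $x,y,y'\in\mathcal C$, with $\varepsilon_n=c_e\sqrt{\log(n)/n}$: $|f(x,y)-f(x,y')|\le c_Ld(y,y')+\varepsilon_n$; and $f(x,y')-f(x,y)\ge c_l(d(x,y)-d(x,y'))-\varepsilon_n$ whenever $d(x,y)\ge d(x,y')$. SubGaussian(1) condition: for every $B\in\mathbb R^{n\times n}$ and $t\ge0$, $\mathbb P\big[\sum_{i<j}B_{ij}E_{ij}>t\sqrt{\sum_{i<j}B_{ij}^2}\big]\le e^{-t^2/2}$. Vanilla Spectral Algorithm (VSA): for a symmetric matrix $M\in\mathbb R^{N\times N}$ with eigenvalues $\hat\lambda_0\ge\dots\ge\hat\lambda_{N-1}$,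 take orthonormal eigenvectors $\hat u,\hat v$ associated with $\hat\lambda_1,\hat\lambda_2$ and output $\big(\sqrt{N/2}\,(\hat u_i,\hat v_i)^T\big)_{1\le i\le N}\in\mathbb R^{2\times N}$. Spectral Localization (input $S=\{i_1<\dots<i_{n_0}\}$ and $A_{SS}=[A_{ij}]_{i,j\in S}$): compute $(\hat x^{\mathrm{VSA}}_{i_\ell})_{1\le\ell\le n_0}=\mathrm{VSA}(A_{SS})$; set $z_\ell=\hat x^{\mathrm{VSA}}_{i_\ell}/\|\hat x^{\mathrm{VSA}}_{i_\ell}\|_2$ (an arbitrary point of $\mathcal C$ if the denominator is zero); pick any permutation $\sigma$ of $\{1,\dots,n_0\}$ such that $z_{\sigma(1)},\dots,z_{\sigma(n_0)}$ are in trigonometric order (consecutive when walking once around the circle in the trigonometric direction); output $\tilde x^{(1)}_S\in\Pi_{n_0}$ defined by $\tilde x^{(1)}_{i_{\sigma(\ell)}}=e^{\iota2\pi(\hat k+\ell)/n_0}$, where $\hat k\in\arg\min_{k\in\{1,\dots,n_0\}}\sum_{\ell=1}^{n_0}\|e^{\iota2\pi(k+\ell)/n_0}-z_{\sigma(\ell)}\|_1$, $\|\cdot\|_1$ being the $\ell^1$ norm in $\mathbb R^2$. Spectral Localize-and-Refine procedure. Let $n_0=n/4$; $\bar S$ is the complement of $S$ in $\{1,\dots,n\}$; $\langle\cdot,\cdot\rangle$ is the Euclidean scalar product; $D(z,x_S)=[d(z,x_j)]_{j\in S}$. Ties in argmins are broken arbitrarily (measurably). (A) Draw $S\subset\{1,\dots,n\}$,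 $|S|=n_0$, uniformly at random (independently of $A$). Let $\tilde x^{(1)}_S$ be the Spectral Localization output for $(S,A_{SS})$, and for $i\in\bar S$ let $\hat x^{(2)}_i\in\arg\min_{z\in\mathcal C_{n_0}}\langle A_{i,S},D(z,\tilde x^{(1)}_S)\rangle$. (B) Draw $S'\subset\bar S$, $|S'|=n_0$, uniformly at random. Let $\tilde x^{(1')}_{S'}$ be the Spectral Localization output for $(S',A_{S'S'})$, and for $i\in\bar S'$ let $\hat x^{(2')}_i\in\arg\min_{z\in\mathcal C_{n_0}}\langle A_{i,S'},D(z,\tilde x^{(1')}_{S'})\rangle$. (C) Compute $\hat Q\in\arg\min_{Q\in\mathcal O}d_\infty(\hat x^{(2)}_{\bar S\cap\bar S'},Q\hat x^{(2')}_{\bar S\cap\bar S'})$. Output $\hat x$ with $\hat x_j=\hat x^{(2)}_j$ for $j\in\bar S$ and $\hat x_j=\hat Q\hat x^{(2')}_j$ for $j\in S$. *)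

(* Defs.v *)
From HB Require Import structures.
From mathcomp Require Import all_boot all_order all_algebra all_fingroup.
From mathcomp Require Import all_classical all_reals all_analysis.

Set Implicit Arguments.
Unset Strict Implicit.
Unset Printing Implicit Defensive.

Import Order.TTheory GRing.Theory Num.Theory.
Import numFieldNormedType.Exports.

Local Open Scope classical_set_scope.
Local Open Scope ring_scope.

Section Geometry.
Context {R : realType}.

Definition norm1_R2 (w : 'cV[R]_2) : R := \sum_(k < 2) `|w k 0|.

Definition norm2_R2 (w : 'cV[R]_2) : R := Num.sqrt (\sum_(k < 2) w k 0 ^+ 2).

Definition circle : set 'cV[R]_2 := [set x | norm2_R2 x = 1].

Definition cis (t : R) : 'cV[R]_2 :=
  \col_(k < 2) (if k == 0 then cos t else sin t).

(* On the circle the set below is a singleton. *)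
Definition arg (x : 'cV[R]_2) : R :=
  get [set t : R | 0 <= t < 2 * pi /\ x = cis t].

Definition dcirc (x y : 'cV[R]_2) : R :=
  Num.min `|arg x - arg y| (2 * pi - `|arg x - arg y|).

(* Restricted to the coordinates in D; the default value 0 is harmless since
   dcirc is nonnegative on the circle. *)
Definition dinf_on (I : finType) (D : {set I}) (x y : I -> 'cV[R]_2) : R :=
  \big[Num.max/0]_(i in D) dcirc (x i) (y i).

Definition dinf (I : finType) (x y : I -> 'cV[R]_2) : R :=
  dinf_on [set: I]%SET x y.

Definition Cgrid (k : nat) : set 'cV[R]_2 :=
  [set x | exists j : 'I_k, x = cis (2 * pi * j%:R / k%:R)].

(* Elements of 'I_k stand for 1, ..., k, whence the successor. *)
Definition PiGrid (k : nat) : set ('I_k -> 'cV[R]_2) :=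
  [set x | exists s : 'S_k,
    forall j, x j = cis (2 * pi * (s j).+1%:R / k%:R)].

Definition orthogonal2 : set 'M[R]_2 := [set Q | Q^T *m Q = 1%:M].

Definition orth_act (I : Type) (Q : 'M[R]_2) (x : I -> 'cV[R]_2) : I -> 'cV[R]_2 :=
  fun i => Q *m x i.

(* Both infima below are attained: PiGrid is finite and orthogonal2 compact. *)
Definition dist_PiGrid (k : nat) (x : 'I_k -> 'cV[R]_2) : R :=
  inf [set dinf x y | y in @PiGrid k].

Definition dist_orth (I : finType) (x y : I -> 'cV[R]_2) : R :=
  inf [set dinf x (orth_act Q y) | Q in orthogonal2].

End Geometry.

Section Model.
Context {R : realType}.

Definition rate (n : nat) : R := Num.sqrt (ln n%:R / n%:R).

Definition biLipschitz (n : nat) (cl cL ce : R)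
    (f : 'cV[R]_2 -> 'cV[R]_2 -> R) : Prop :=
  [/\ forall x y, circle x -> circle y -> 0 <= f x y <= 1,
      forall x y, circle x -> circle y -> f x y = f y x,
      forall x y y', circle x -> circle y -> circle y' ->
        `|f x y - f x y'| <= cL * dcirc y y' + ce * rate n
    & forall x y y', circle x -> circle y -> circle y' ->
        dcirc x y' <= dcirc x y ->
        cl * (dcirc x y - dcirc x y') - ce * rate n <= f x y' - f x y].

Definition geometric_fun (f : 'cV[R]_2 -> 'cV[R]_2 -> R) : Prop :=
  exists g : R -> R,
    (forall t, 0 <= t <= pi -> 0 <= g t <= 1) /\
    (forall x y, circle x -> circle y -> f x y = g (dcirc x y)).

Definition signal_mx (n : nat) (f : 'cV[R]_2 -> 'cV[R]_2 -> R)
    (x : 'I_n -> 'cV[R]_2) : 'M[R]_n := \matrix_(i, j) f (x i) (x j).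

(* Eigenvalues listed with multiplicity in nonincreasing order: lam`_k is the
   eigenvalue of index k, starting from 0. *)
Definition sorted_eigenvalues (N : nat) (M : 'M[R]_N) (lam : seq R) : Prop :=
  sorted >=%R lam /\ char_poly M = \prod_(a <- lam) ('X - a%:P).

(* The product sigma-algebra on matrices. *)
Definition mx_measurable (m n : nat) : set (set 'M[R]_(m, n)) :=
  <<s [set D | exists i j (B : set R),
         measurable B /\ D = [set M : 'M[R]_(m, n) | B (M i j)]] >>.

Section Probability.
Context {d : measure_display} {T : measurableType d} (P : probability T R).

Definition mutually_independent (I : finType) (D : {set I}) (X : I -> T -> R) :=
  forall (J : {set I}) (B : I -> set R), J \subset D ->
    (forall i, measurable (B i)) ->
    (P [set w | forall i, i \in J -> B i (X i w)] =
     \prod_(i in J) P [set w | B i (X i w)])%E.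

Definition subgaussian1 (n : nat) (E : 'I_n * 'I_n -> T -> R) :=
  forall (B : 'M[R]_n) (t : R), 0 <= t ->
    (P [set w | (t * Num.sqrt
                       (\sum_(i < n) \sum_(j < n | (i < j)%N) B i j ^+ 2)
                 < \sum_(i < n) \sum_(j < n | (i < j)%N) B i j * E (i, j) w)%R]
     <= (expR (- (t ^+ 2 / 2)))%:E)%E.

(* Only the entries E (i, j) with i < j are constrained. *)
Definition noise (n : nat) (E : 'I_n * 'I_n -> T -> R) : Prop :=
  let upper := [set p : 'I_n * 'I_n | (p.1 < p.2)%N]%SET in
  [/\ forall p, p \in upper -> measurable_fun setT (E p),
      forall p, p \in upper -> ('E_P[E p] = 0)%E,
      mutually_independent upper E
    & subgaussian1 E].

Definition observation (n : nat) (F : 'M[R]_n) (E : 'I_n * 'I_n -> T -> R)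
    (A : T -> 'M[R]_n) : Prop :=
  forall w,
    [/\ (A w)^T = A w, forall i, A w i i = 0
      & forall i j : 'I_n, (i < j)%N -> A w i j = F i j + E (i, j) w].

(* S is uniform among the n0-subsets and independent of A; conditionally on
   (A, S), S' is uniform among the n0-subsets of the complement of S. *)
Definition uniform_sampling (n n0 : nat) (A : T -> 'M[R]_n)
    (S S' : T -> {set 'I_n}) : Prop :=
  [/\ forall w, [/\ #|S w| = n0, #|S' w| = n0 & S' w \subset ~: S w],
      forall s : {set 'I_n},
        measurable [set w | S w = s] /\ measurable [set w | S' w = s],
      forall B (s : {set 'I_n}), mx_measurable B -> #|s| = n0 ->
        (P [set w | B (A w) /\ S w = s] =
         P [set w | B (A w)] * ('C(n, n0)%:R^-1)%:E)%E
    & forall B (s s' : {set 'I_n}), mx_measurable B ->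
        #|s| = n0 -> #|s'| = n0 ->
        s' \subset ~: s ->
        (P [set w | [/\ B (A w), S w = s & S' w = s']] =
         P [set w | B (A w) /\ S w = s] * ('C(n - n0, n0)%:R^-1)%:E)%E].

End Probability.
End Model.

Section Procedure.
Context {R : realType}.

(* Column i of X is the output attached to index i. *)
Definition VSA (N : nat) (M : 'M[R]_N) (X : 'M[R]_(2, N)) : Prop :=
  exists (lam : seq R) (u v : 'cV[R]_N),
    [/\ sorted_eigenvalues M lam,
        M *m u = lam`_1 *: u /\ M *m v = lam`_2 *: v,
        [/\ u^T *m u = 1%:M, v^T *m v = 1%:M & u^T *m v = 0]
      & X = \matrix_(k < 2, i < N)
              (Num.sqrt (N%:R / 2) * (if k == 0 then u i 0 else v i 0))].

(* theta lifts the sequence z to angles that increase along at most one turn;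
   thus the notion is invariant under cyclic shifts, also when points coincide. *)
Definition trig_order (N : nat) (z : 'I_N -> 'cV[R]_2) : Prop :=
  exists theta : 'I_N -> R,
    (forall l, z l = cis (theta l)) /\
    (forall l l' : 'I_N, (l <= l')%N ->
       theta l <= theta l' <= theta l + 2 * pi).

(* k and l in 'I_N stand for 1, ..., N, whence the successors. *)
Definition grid_point (N : nat) (k l : 'I_N) : 'cV[R]_2 :=
  cis (2 * pi * (k.+1 + l.+1)%:R / N%:R).

Definition align_cost (N : nat) (z : 'I_N -> 'cV[R]_2) (s : 'S_N) (k : 'I_N) : R :=
  \sum_(l < N) norm1_R2 (grid_point k l - z (s l)).

Definition submx_of (n : nat) (S : {set 'I_n}) (A : 'M[R]_n) : 'M[R]_#|S| :=
  mxsub enum_val enum_val A.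

(* xt is a possible output for the input (S, M).  As enum_val : 'I_#|S| -> 'I_n
   is increasing, enum_val l is the index i_l of S = {i_1 < ... < i_n0}.  The
   values of xt outside S are irrelevant. *)
Definition spectral_localization (n : nat) (S : {set 'I_n}) (M : 'M[R]_#|S|)
    (xt : 'I_n -> 'cV[R]_2) : Prop :=
  exists (X : 'M[R]_(2, #|S|)) (z : 'I_#|S| -> 'cV[R]_2)
         (s : 'S_#|S|) (k : 'I_#|S|),
    [/\ VSA M X,
        forall l, circle (z l) /\
          (norm2_R2 (col l X) != 0 -> z l = (norm2_R2 (col l X))^-1 *: col l X),
        trig_order (z \o s),
        forall k', align_cost z s k <= align_cost z s k'
      & forall l, xt (enum_val (s l)) = grid_point k l].

(* An implementation of Spectral Localization on the n0-subsets: its choices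
   are a measurable function of its input. *)
Definition spectral_localizer (n n0 : nat)
    (SL : forall S : {set 'I_n}, 'M[R]_#|S| -> 'I_n -> 'cV[R]_2) : Prop :=
  forall S : {set 'I_n}, #|S| = n0 ->
    (forall M : 'M[R]_#|S|, M^T = M -> spectral_localization M (SL S M)) /\
    (forall i (k : 'I_2) (B : set R), i \in S -> measurable B ->
       mx_measurable [set M : 'M[R]_#|S| | B (SL S M i k 0)]).

Definition refine_cost (n : nat) (A : 'M[R]_n) (S : {set 'I_n})
    (xt : 'I_n -> 'cV[R]_2) (i : 'I_n) (z : 'cV[R]_2) : R :=
  \sum_(j in S) A i j * dcirc z (xt j).

Definition refinement (n n0 : nat) (A : 'M[R]_n) (S : {set 'I_n})
    (xt x2 : 'I_n -> 'cV[R]_2) : Prop :=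
  forall i, i \notin S ->
    Cgrid n0 (x2 i) /\
    forall z, Cgrid n0 z -> refine_cost A S xt i (x2 i) <= refine_cost A S xt i z.

(* xhat is a possible output, given the samples S and S' and the
   Spectral Localization outputs xt on S and xt' on S'. *)
Definition localize_and_refine (n n0 : nat) (A : 'M[R]_n) (S S' : {set 'I_n})
    (xt xt' xhat : 'I_n -> 'cV[R]_2) : Prop :=
  exists (x2 x2' : 'I_n -> 'cV[R]_2) (Q : 'M[R]_2),
    [/\ refinement n0 A S xt x2,
        refinement n0 A S' xt' x2',
        orthogonal2 Q /\
          (forall Q', orthogonal2 Q' ->
             dinf_on (~: S :&: ~: S') x2 (orth_act Q x2')
             <= dinf_on (~: S :&: ~: S') x2 (orth_act Q' x2')),
        forall j, j \notin S -> xhat j = x2 j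
      & forall j, j \in S -> xhat j = Q *m x2' j].

End Procedure.

(* Main.v *)
Require Import Defs.
From HB Require Import structures.
From mathcomp Require Import all_boot all_order all_algebra all_fingroup.
From mathcomp Require Import all_classical all_reals all_analysis.
From mathcomp Require Import ring lra zify.

Set Implicit Arguments.
Unset Strict Implicit.
Unset Printing Implicit Defensive.

Import Order.TTheory GRing.Theory Num.Theory.
Import numFieldNormedType.Exports.

Local Open Scope classical_set_scope.
Local Open Scope ring_scope.

(* On the grid of angles 2 pi j / n the signal of a geometric f is, up to O(rate), a
   circulant matrix, diagonalised by 1, cos, sin, and higher frequencies.  Since f
   decreases in the distance (up to the rate), no frequency has a larger eigenvalue than the
   first, up to O(n rate); hence the two spectral gaps single out the plane of (cos, sin).
   A uniform sample S of n/4 indices is evenly spread, so its rescaled ranks form again a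
   grid of angles and A_SS is a circulant matrix up to an error of operator norm
   O(n rate).  Its second and third eigenvectors are then close to the plane of (cos, sin),
   and normalising them recovers the angles up to an orthogonal map with an average error
   O(rate); sorting and matching with the grid preserves this.

   For the refinement, reflecting the grid across the bisector of two candidates y and z
   bounds the excess cost of the wrong one from below by a multiple of N d(y, z)^2.  The
   noise contributes at most a multiple of N rate d(y, z), by independence of the row i
   outside S and the block A_SS and a union bound.  The overlap of the two halves contains
   two almost orthogonal directions, so the aligning map is determined up to O(rate). *)

(** * Geometry of the circle *)

(** The gaps are assumed for F, but the algorithm diagonalises blocks of size N = n / 4, and
    sampling on a coarser grid mixes several frequencies of the finer one. So the two spectra are
    not compared frequency by frequency. A vector on the coarse grid is extended to the fine one by
    repeating each entry four times. This multiplies its squared norm by 4 and, up to an error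
    governed by the rate, its quadratic form by 16; it also preserves orthogonality to frequencies 0
    and 1. The form on the coarse grid thus inherits the gaps.

    Localization is controlled only on average over the sample. This suffices because the refinement
    cost is itself a sum over the sample, and it is the refinement that yields a bound for each
    index separately.

    Five events of probability at most n^-2 are excluded: a large noise matrix and, for each of the
    two samples, an uneven spread and a large noise along some row. The estimates need a small rate;
    for a large rate the claim is trivial, since distances are at most pi. *)

Section CircleGeometry.
Context {R : realType}.
Implicit Types (x y z w : 'cV[R]_2) (a b t : R) (Q : 'M[R]_2).

Definition dot2 x y : R := x 0 0 * y 0 0 + x 1 0 * y 1 0.

Lemma sum2E (V : nmodType) (F : 'I_2 -> V) : \sum_(k < 2) F k = F 0 + F 1.
Proof.
by rewrite big_ord_recl big_ord1; congr (_ + F _); apply: val_inj.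
Qed.

Lemma vec2P x y : x 0 0 = y 0 0 -> x 1 0 = y 1 0 -> x = y.
Proof.
move=> h0 h1; apply/matrixP => i j; rewrite ord1.
case: i => [[|[|//]]] Hi.
- by have -> : Ordinal Hi = 0 by apply: val_inj.
- by have -> : Ordinal Hi = 1 by apply: val_inj.
Qed.

Lemma cisE0 t : cis t 0 0 = cos t. Proof. by rewrite mxE. Qed.
Lemma cisE1 t : cis t 1 0 = sin t. Proof. by rewrite mxE. Qed.

Lemma norm2_R2E x : norm2_R2 x = Num.sqrt (dot2 x x).
Proof. by rewrite /norm2_R2 sum2E !expr2. Qed.

Lemma dot2_ge0 x : 0 <= dot2 x x.
Proof. by rewrite /dot2 -!expr2 addr_ge0 ?sqr_ge0. Qed.

Lemma norm2_R2_sqr x : norm2_R2 x ^+ 2 = dot2 x x.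
Proof. by rewrite norm2_R2E sqr_sqrtr ?dot2_ge0. Qed.

Lemma norm2_R2_ge0 x : 0 <= norm2_R2 x.
Proof. exact: sqrtr_ge0. Qed.

Lemma circle_dot2 x : circle x <-> dot2 x x = 1.
Proof.
rewrite /circle /= -norm2_R2_sqr; split => [->|h]; first by rewrite expr1n.
by apply/eqP; rewrite -(@eqrXn2 _ 2) ?norm2_R2_ge0// h expr1n.
Qed.

Lemma dot2C x y : dot2 x y = dot2 y x.
Proof. by rewrite /dot2 mulrC [x 1 0 * _]mulrC. Qed.

Lemma dot2_cis a b : dot2 (cis a) (cis b) = cos (a - b).
Proof. by rewrite /dot2 !cisE0 !cisE1 cosB. Qed.

Lemma circle_cis t : circle (cis t).
Proof. by apply/circle_dot2; rewrite dot2_cis subrr cos0. Qed.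

Lemma cis_periodic t : cis (t + 2 * pi) = cis t.
Proof.
by apply: vec2P; rewrite ?cisE0 ?cisE1 mulr_natl ?cosD2pi ?sinD2pi.
Qed.

Lemma circle_cisP x : circle x -> exists t, 0 <= t < 2 * pi /\ x = cis t.
Proof.
move=> /circle_dot2 hx; rewrite /dot2 in hx.
have p0 := pi_gt0 R.
have hb : -1 <= x 0 0 <= 1.
  by have h1 := sqr_ge0 (x 1 0); apply/andP; split; nra.
have hc : cos (acos (x 0 0)) = x 0 0 by rewrite acosK // in_itv.
have hs : sin (acos (x 0 0)) ^+ 2 = x 1 0 ^+ 2.
  by rewrite sin2cos2 hc; nra.
have hp : 0 <= acos (x 0 0) <= pi by rewrite acos_ge0 // acos_lepi.
have hs0 : 0 <= sin (acos (x 0 0)) by rewrite sin_ge0_pi.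
have [y0|y0] := leP 0 (x 1 0).
  exists (acos (x 0 0)); split; first by lra.
  apply: vec2P; rewrite ?cisE0 ?cisE1 ?hc //.
  by apply/eqP; rewrite -(@eqrXn2 _ 2) // hs.
have hs1 : sin (acos (x 0 0)) = - x 1 0.
  by apply/eqP; rewrite -(@eqrXn2 _ 2) // ?hs ?sqrrN // oppr_ge0 ltW.
have hne : acos (x 0 0) != 0.
  by apply/eqP => h; move: hs1; rewrite h sin0; lra.
exists (2 * pi - acos (x 0 0)); split.
  have : 0 < acos (x 0 0) by rewrite lt_neqAle eq_sym hne; lra.
  lra.
apply: vec2P; rewrite ?cisE0 ?cisE1 addrC mulr_natl.
- by rewrite cosD2pi cosN hc.
- by rewrite sinD2pi sinN hs1 opprK.
Qed.

Lemma argP x : circle x -> 0 <= arg x < 2 * pi /\ x = cis (arg x).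
Proof.
move=> /circle_cisP[t ht].
exact: (@getPex _ [set t : R | 0 <= t < 2 * pi /\ x = cis t] (ex_intro _ t ht)).
Qed.

Lemma dcirc_bounds x y : circle x -> circle y -> 0 <= dcirc x y <= pi.
Proof.
move=> /argP[hx _] /argP[hy _]; rewrite /dcirc.
have hn : 0 <= `|arg x - arg y| by [].
have hn2 : `|arg x - arg y| <= 2 * pi by rewrite ler_norml; lra.
by rewrite /Order.min; case: ltP => h; lra.
Qed.

Lemma cos_dcirc x y : circle x -> circle y -> cos (dcirc x y) = dot2 x y.
Proof.
move=> /argP[_ hx] /argP[_ hy]; rewrite [in RHS]hx [in RHS]hy dot2_cis.
rewrite /dcirc /Order.min; case: ifP => _; first by rewrite cos_norm.
by rewrite addrC mulr_natl cosD2pi cosN cos_norm.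
Qed.

Lemma dcircE x y : circle x -> circle y -> dcirc x y = acos (dot2 x y).
Proof.
by move=> hx hy; rewrite -cos_dcirc// cosK// in_itv dcirc_bounds.
Qed.

Lemma dcirc_ge0 x y : circle x -> circle y -> 0 <= dcirc x y.
Proof. by move=> hx hy; case/andP: (dcirc_bounds hx hy). Qed.

Lemma dcirc_le_pi x y : circle x -> circle y -> dcirc x y <= pi.
Proof. by move=> hx hy; case/andP: (dcirc_bounds hx hy). Qed.

Lemma dcircC x y : circle x -> circle y -> dcirc x y = dcirc y x.
Proof. by move=> hx hy; rewrite !dcircE// dot2C. Qed.

Lemma acos_cos_le t : acos (cos t) <= `|t|.
Proof.
have [h|h] := leP `|t| pi.
  by rewrite -cos_norm cosK// in_itv /= normr_ge0 h.
by apply: ltW; apply: le_lt_trans h; rewrite acos_lepi// cos_geN1 cos_le1.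
Qed.

Lemma dcirc_cis_le a b : dcirc (cis a) (cis b) <= `|a - b|.
Proof. by rewrite dcircE; [rewrite dot2_cis acos_cos_le|exact: circle_cis..]. Qed.

(** Equality of cosines leaves the sine determined up to sign, so one of [b + d] and [b - d] is an
    angle of x. With such lifts the triangle inequality on the circle reduces to the one on the
    line. *)
Lemma dcirc_lift x b : circle x -> exists2 a, x = cis a & dcirc x (cis b) = `|a - b|.
Proof.
move=> hx; have cb := circle_cis b.
have [t [_ xt]] := circle_cisP hx.
set d := dcirc x (cis b).
have d0 : 0 <= d := dcirc_ge0 hx cb.
have hc : cos d = cos (t - b) by rewrite /d cos_dcirc// xt dot2_cis.
have : sin d ^+ 2 = sin (t - b) ^+ 2 by rewrite !sin2cos2 hc.
move/eqP; rewrite eqf_sqr => /orP[]/eqP hs.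
- exists (b + d); last by rewrite addrC addKr ger0_norm.
  rewrite xt; apply: vec2P; rewrite ?cisE0 ?cisE1 ?cosD ?sinD hc hs.
  + by rewrite -cosD; congr cos; ring.
  + by rewrite -sinD; congr sin; ring.
- exists (b - d); last by rewrite addrC addKr normrN ger0_norm.
  rewrite xt; apply: vec2P; rewrite ?cisE0 ?cisE1 ?cosB ?sinB hc hs.
  + by rewrite mulrN -cosD; congr cos; ring.
  + by rewrite mulrN opprK -sinD; congr sin; ring.
Qed.

Lemma dcirc_triangle x y z : circle x -> circle y -> circle z ->
  dcirc x z <= dcirc x y + dcirc y z.
Proof.
move=> hx hy hz; have [c [_ zc]] := circle_cisP hz; rewrite zc.
have [b yb ->] := dcirc_lift c hy; rewrite yb.
have [a xa ->] := dcirc_lift b hx; rewrite xa.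
apply: le_trans (dcirc_cis_le _ _) _.
by apply: le_trans (ler_normD _ _); rewrite addrA subrK.
Qed.

Lemma dcirc_lip x y z : circle x -> circle y -> circle z ->
  `|dcirc x z - dcirc y z| <= dcirc x y.
Proof.
move=> hx hy hz; rewrite ler_norml; apply/andP; split.
  by have := dcirc_triangle hy hx hz; rewrite (dcircC hy hx); lra.
by have := dcirc_triangle hx hy hz; lra.
Qed.

Lemma mulmx2E Q x i : (Q *m x) i 0 = Q i 0 * x 0 0 + Q i 1 * x 1 0.
Proof. by rewrite mxE sum2E. Qed.

Lemma orthogonal2P Q : orthogonal2 Q ->
  [/\ Q 0 0 ^+ 2 + Q 1 0 ^+ 2 = 1, Q 0 1 ^+ 2 + Q 1 1 ^+ 2 = 1
    & Q 0 0 * Q 0 1 + Q 1 0 * Q 1 1 = 0].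
Proof.
rewrite /orthogonal2 /= => /matrixP h; split.
- by have := h 0 0; rewrite !mxE sum2E !mxE !expr2.
- by have := h 1 1; rewrite !mxE sum2E !mxE !expr2.
- by have := h 0 1; rewrite !mxE sum2E !mxE.
Qed.

Lemma orthogonal2I Q :
  Q 0 0 ^+ 2 + Q 1 0 ^+ 2 = 1 -> Q 0 1 ^+ 2 + Q 1 1 ^+ 2 = 1 ->
  Q 0 0 * Q 0 1 + Q 1 0 * Q 1 1 = 0 -> orthogonal2 Q.
Proof.
move=> h1 h2 h3; rewrite /orthogonal2 /=; apply/matrixP => i j.
have D (k : 'I_2) : k = 0 \/ k = 1.
  by case: k => [[|[|//]]] Hk; [left|right]; apply: val_inj.
rewrite !mxE sum2E !mxE.
by case: (D i) => ->; case: (D j) => -> /=; rewrite ?mulr1n ?mulr0n; lra.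
Qed.

Lemma dot2_orth Q x y : orthogonal2 Q -> dot2 (Q *m x) (Q *m y) = dot2 x y.
Proof.
case/orthogonal2P => h1 h2 h3; rewrite /dot2 !mulmx2E.
have -> : (Q 0 0 * x 0 0 + Q 0 1 * x 1 0) * (Q 0 0 * y 0 0 + Q 0 1 * y 1 0) +
  (Q 1 0 * x 0 0 + Q 1 1 * x 1 0) * (Q 1 0 * y 0 0 + Q 1 1 * y 1 0) =
  (Q 0 0 ^+ 2 + Q 1 0 ^+ 2) * (x 0 0 * y 0 0) +
  (Q 0 1 ^+ 2 + Q 1 1 ^+ 2) * (x 1 0 * y 1 0) +
  (Q 0 0 * Q 0 1 + Q 1 0 * Q 1 1) * (x 0 0 * y 1 0 + x 1 0 * y 0 0) by ring.
by rewrite h1 h2 h3 !mul1r mul0r addr0.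
Qed.

Lemma circle_orth Q x : orthogonal2 Q -> circle x -> circle (Q *m x).
Proof. by move=> hQ /circle_dot2 hx; apply/circle_dot2; rewrite dot2_orth. Qed.

Lemma dcirc_orth Q x y : orthogonal2 Q -> circle x -> circle y ->
  dcirc (Q *m x) (Q *m y) = dcirc x y.
Proof.
by move=> hQ hx hy; rewrite !dcircE ?dot2_orth//; apply: circle_orth.
Qed.

Lemma orthogonal2_1 : orthogonal2 (1%:M : 'M[R]_2).
Proof. by rewrite /orthogonal2 /= trmx1 mulmx1. Qed.

Lemma orthogonal2_mul Q Q' : orthogonal2 Q -> orthogonal2 Q' -> orthogonal2 (Q *m Q').
Proof.
rewrite /orthogonal2 /= => h h'.
by rewrite trmx_mul mulmxA -(mulmxA Q'^T) h mulmx1.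
Qed.

Lemma orthogonal2_tr Q : orthogonal2 Q -> orthogonal2 Q^T.
Proof. by rewrite /orthogonal2 /= => h; rewrite trmxK; apply: mulmx1C. Qed.

(** Jordan's inequality. The mean value theorem on both sides of [t] and the decrease of cos compare
    the two slopes, which replaces an appeal to concavity. *)
Lemma sin_concave_ge t : 0 <= t <= pi / 2 -> t * 2 <= sin t * pi.
Proof.
move=> /andP[t0 t1]; have p0 := pi_gt0 R.
have [->|tn0] := eqVneq t 0; first by rewrite sin0; lra.
have [->|tn1] := eqVneq t (pi / 2); first by rewrite sin_pihalf; lra.
have {}t0 : 0 < t by rewrite lt_neqAle eq_sym tn0.
have {}t1 : t < pi / 2 by rewrite lt_neqAle tn1.
have D u v : {in `]u, v[, forall s, is_derive s (1:R) (@sin R) (cos s)}.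
  by move=> s _; exact: is_derive_sin.
have C u v : {within `[u, v], continuous (@sin R)}.
  by apply: continuous_subspaceT => s; exact: continuous_sin.
have [c1 hc1 e1] := MVT t0 (D _ _) (C _ _).
have [c2 hc2 e2] := MVT t1 (D _ _) (C _ _).
rewrite in_itv /= in hc1; rewrite in_itv /= in hc2.
rewrite sin0 !subr0 in e1; rewrite sin_pihalf in e2.
have hcc : cos c2 < cos c1 by rewrite ltr_cos ?in_itv /=; lra.
have h : cos c2 * (pi / 2 - t) <= cos c1 * (pi / 2 - t).
  by rewrite ler_wpM2r; lra.
have h2 : 2 <= cos c1 * pi by lra.
by have := ler_wpM2l (ltW t0) h2; rewrite e1; lra.
Qed.

Lemma sin_le t : 0 <= t -> sin t <= t.
Proof.
move=> t0; have [->|tn0] := eqVneq t 0; first by rewrite sin0.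
have {}t0 : 0 < t by rewrite lt_neqAle eq_sym tn0.
have D u v : {in `]u, v[, forall s, is_derive s (1:R) (@sin R) (cos s)}.
  by move=> s _; exact: is_derive_sin.
have C u v : {within `[u, v], continuous (@sin R)}.
  by apply: continuous_subspaceT => s; exact: continuous_sin.
have [c1 hc1 e1] := MVT t0 (D _ _) (C _ _).
rewrite sin0 !subr0 in e1; rewrite e1.
by have := cos_le1 c1; nra.
Qed.

Lemma dist2_dot2 x y : circle x -> circle y -> dot2 (x - y) (x - y) = 2 - 2 * dot2 x y.
Proof.
move=> /circle_dot2 hx /circle_dot2 hy.
have -> : dot2 (x - y) (x - y) = dot2 x x + dot2 y y - 2 * dot2 x y.
  by rewrite /dot2 !mxE; ring.
by rewrite hx hy.
Qed.

Lemma dist2_sin x y : circle x -> circle y ->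
  norm2_R2 (x - y) = 2 * sin (dcirc x y / 2).
Proof.
move=> hx hy; have hd := dcirc_bounds hx hy.
have hs : 0 <= sin (dcirc x y / 2) by apply: sin_ge0_pi; lra.
apply/eqP; rewrite -(@eqrXn2 _ 2) ?norm2_R2_ge0 // ?mulr_ge0 //.
rewrite norm2_R2_sqr dist2_dot2// -cos_dcirc//.
have -> : dcirc x y = (dcirc x y / 2) *+ 2 by rewrite mulr2n; lra.
rewrite cos_mulr2n cos2sin2; apply/eqP.
rewrite [in RHS]mulr2n -[in RHS]mulr2n.
set d := dcirc x y.
have -> : (d / 2) *+ 2 / 2 = d / 2 by rewrite mulr2n; lra.
by rewrite mulr2n; ring.
Qed.

Lemma chord_le_dcirc x y : circle x -> circle y -> norm2_R2 (x - y) <= dcirc x y.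
Proof.
move=> hx hy; have hd := dcirc_bounds hx hy; rewrite dist2_sin//.
by have := @sin_le (dcirc x y / 2); lra.
Qed.

Lemma dcirc_le_chord x y : circle x -> circle y ->
  2 * dcirc x y <= pi * norm2_R2 (x - y).
Proof.
move=> hx hy; have hd := dcirc_bounds hx hy; rewrite dist2_sin//.
by have := @sin_concave_ge (dcirc x y / 2); lra.
Qed.

Lemma norm2_le_norm1 x : norm2_R2 x <= norm1_R2 x.
Proof.
rewrite /norm1_R2 sum2E -ler_sqr ?nnegrE ?norm2_R2_ge0 ?addr_ge0 //.
rewrite norm2_R2_sqr /dot2 sqrrD -!expr2 !real_normK ?num_real//.
by rewrite addrAC lerDl mulrn_wge0 // mulr_ge0.
Qed.

Lemma norm1_le_norm2 x : norm1_R2 x <= 2 * norm2_R2 x.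
Proof.
have H (k : 'I_2) : `|x k 0| <= norm2_R2 x.
  rewrite norm2_R2E -sqrtr_sqr ler_wsqrtr // /dot2.
  have h0 := sqr_ge0 (x 0 0); have h1 := sqr_ge0 (x 1 0).
  case: k => [[|[|//]]] Hk.
  - by have -> : Ordinal Hk = 0 by [apply: val_inj]; nra.
  - by have -> : Ordinal Hk = 1 by [apply: val_inj]; nra.
by rewrite /norm1_R2 sum2E; have := H 0; have := H 1; lra.
Qed.

End CircleGeometry.

(** * Circulant matrices on a grid *)

Section GridSums.
Context {R : realType}.
Implicit Types (phi gam : R -> R) (K a k : nat) (s t : R).

Definition ang K j : R := 2 * pi * j%:R / K%:R.

Lemma angD K a b : ang K (a + b) = ang K a + ang K b.
Proof. by rewrite /ang natrD mulrDr mulrDl. Qed.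

Lemma angM K k j : ang K (k * j) = k%:R * ang K j.
Proof. by rewrite /ang natrM; ring. Qed.

Lemma ang0 K : ang K 0 = 0.
Proof. by rewrite /ang mulr0 mul0r. Qed.

Lemma angKK K : (0 < K)%N -> ang K K = 2 * pi.
Proof. by move=> K0; rewrite /ang mulfK // pnatr_eq0 -lt0n. Qed.

Lemma ang_ge0 K j : 0 <= ang K j.
Proof. by rewrite /ang divr_ge0 // !mulr_ge0 // pi_ge0. Qed.

Lemma ler_ang K i j : (i <= j)%N -> ang K i <= ang K j.
Proof. by move=> h; rewrite -(subnKC h) angD lerDl ang_ge0. Qed.

Lemma ang_lt_2pi K (j : 'I_K) : ang K j < 2 * pi.
Proof.
have K0 : (0 < K)%N by apply: leq_ltn_trans (ltn_ord j).
rewrite -(angKK K0) /ang ltr_pM2r ?invr_gt0 ?ltr0n// ltr_pM2l ?ltr_nat ?ltn_ord//.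
by rewrite mulr_gt0 // pi_gt0.
Qed.

Lemma periodic2pi_nat phi k t : (forall t, phi (t + 2 * pi) = phi t) ->
  phi (t + k%:R * (2 * pi)) = phi t.
Proof.
move=> hp; elim: k => [|k IH]; first by rewrite mul0r addr0.
by rewrite -addn1 natrD mulrDl mul1r addrA hp IH.
Qed.

Lemma sum_shift phi K a : (forall t, phi (t + 2 * pi) = phi t) ->
  \sum_(j < K) phi (ang K a + ang K j) = \sum_(j < K) phi (ang K j).
Proof.
move=> hp; case: K => [|K]; first by rewrite !big_ord0.
elim: a => [|a IH]; first by apply: eq_bigr => j _; rewrite ang0 add0r.
rewrite -{}IH big_ord_recr big_ord_recl /= addrC; congr (_ + _).
  have -> : ang K.+1 a.+1 = ang K.+1 a + ang K.+1 1 by rewrite -angD addn1.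
  by rewrite ang0 addr0 -addrA -angD add1n angKK // hp.
apply: eq_bigr => j _; rewrite -!angD; congr (phi (ang _ _)).
by rewrite addSnnS.
Qed.

Lemma sum_reflect phi K a : (forall t, phi (t + 2 * pi) = phi t) ->
  \sum_(j < K) phi (ang K a - ang K j) = \sum_(j < K) phi (ang K j).
Proof.
(* Reversal sends j to K - 1 - j; the shift by [a.+1] instead of [a] compensates for the missing
   unit. *)
move=> hp; rewrite -(sum_shift K a.+1 hp) (reindex_inj rev_ord_inj) /=.
apply: eq_bigr => j _; rewrite -[LHS]hp; congr phi.
have hK : (0 < K)%N by apply: leq_ltn_trans (ltn_ord j).
have : ang K (rev_ord j) + ang K j.+1 = 2 * pi by rewrite -angD subnK // angKK.
have E b : ang K b.+1 = ang K b + ang K 1 by rewrite -angD addn1.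
by rewrite (E a) (E j); lra.
Qed.

Lemma periodic_cosM k s t : cos (k%:R * (t + 2 * pi) - s) = cos (k%:R * t - s).
Proof.
rewrite mulrDr addrAC.
apply: (@periodic2pi_nat cos k).
by move=> u; rewrite mulr_natl cosD2pi.
Qed.

Lemma cos_lt1 t : 0 < t < 2 * pi -> cos t < 1.
Proof.
move=> /andP[h0 h1]; have -> : t = (t / 2) *+ 2 by rewrite mulr2n; lra.
have : 0 < sin (t / 2) by apply: sin_gt0_pi; lra.
by rewrite cos_mulr2n cos2sin2 mulr2n; nra.
Qed.

Lemma sum_grid_sin K k : \sum_(j < K) sin (k%:R * ang K j) = 0.
Proof.
have := @sum_reflect (fun t => cos (k%:R * t - pi / 2)) K 0 (periodic_cosM k _).
under eq_bigr do rewrite ang0 sub0r mulrN cosBpihalf sinN.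
under [in RHS]eq_bigr do rewrite cosBpihalf.
by rewrite sumrN => h; lra.
Qed.

(** Shifting the grid by one step multiplies the sum by the cosine of k steps, because the sine sum
    vanishes. This factor is less than 1, so the sum is zero. *)
Lemma sum_grid_cos K k : (0 < k < K)%N -> \sum_(j < K) cos (k%:R * ang K j) = 0.
Proof.
move=> /andP[k0 kK].
have hp u : cos (k%:R * (u + 2 * pi)) = cos (k%:R * u :> R).
  by have := periodic_cosM k 0 u; rewrite !subr0.
have := @sum_shift (fun t => cos (k%:R * t)) K 1 hp.
under eq_bigr do rewrite mulrDr cosD.
rewrite sumrB -!mulr_sumr sum_grid_sin mulr0 subr0.
have : cos (k%:R * ang K 1) < 1.
  apply: cos_lt1; rewrite -angM muln1 (ang_lt_2pi (Ordinal kK)) andbT.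
  rewrite /ang divr_gt0 ?ltr0n ?mulr_gt0 ?pi_gt0 ?ltr0n //.
  exact: leq_ltn_trans kK.
set S := \sum_(_ < _) _; set c := cos _ => hc /eqP.
rewrite -subr_eq0 -{2}[S]mul1r -mulrBl mulf_eq0 => /orP[]/eqP //.
by move=> h; exfalso; lra.
Qed.

Lemma sum_freq_cos n (i j : 'I_n) :
  \sum_(k < n) cos (k%:R * (ang n i - ang n j)) = n%:R * (i == j)%:R.
Proof.
have H (i' j' : 'I_n) : (j' < i')%N ->
    \sum_(k < n) cos (k%:R * (ang n i' - ang n j')) = 0.
  move=> h; have hb : (0 < i' - j' < n)%N.
    by rewrite subn_gt0 h /= (leq_ltn_trans (leq_subr _ _)).
  transitivity (\sum_(k < n) cos ((i' - j')%:R * ang n k)); last exact: sum_grid_cos.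
  apply: eq_bigr => k _; congr cos.
  have {1}-> : nat_of_ord i' = (i' - j' + j')%N by rewrite subnK // ltnW.
  by rewrite angD addrK -!angM mulnC.
case: (ltngtP i j) => h.
- have -> : (i == j) = false by apply/eqP => e; rewrite e ltnn in h.
  rewrite mulr0; apply: etrans (H _ _ h); apply: eq_bigr => k _.
  by rewrite -cosN -mulrN opprB.
- have -> : (i == j) = false by apply/eqP => e; rewrite e ltnn in h.
  by rewrite mulr0; exact: H.
- have -> : i = j by apply: val_inj.
  rewrite eqxx mulr1; under eq_bigr do rewrite subrr mulr0 cos0.
  by rewrite sumr_const card_ord.
Qed.

Lemma sum_grid_dot2 K (v : 'cV[R]_2) : (2 < K)%N ->
  \sum_(j < K) dot2 v (cis (ang K j)) ^+ 2 = K%:R / 2 * dot2 v v.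
Proof.
move=> K2.
have hc := @sum_grid_cos K 2 (_ : (0 < 2 < K)%N).
have hs := sum_grid_sin K 2.
transitivity (\sum_(j < K) (dot2 v v / 2 +
    ((v 0 0 ^+ 2 - v 1 0 ^+ 2) / 2 * cos (2 * ang K j)
    + v 0 0 * v 1 0 * sin (2 * ang K j)))).
  apply: eq_bigr => j _; rewrite /dot2 cisE0 cisE1.
  have h := cos2Dsin2 (ang K j).
  rewrite !mulr_natl cos_mulr2n sin_mulr2n.
  move: h; set c := cos _; set s := sin _ => h.
  rewrite !sqrrD !exprMn.
  have -> : s ^+ 2 = 1 - c ^+ 2 by lra.
  by rewrite !mulr2n; field.
rewrite big_split big_split /= -!mulr_sumr hc// hs !mulr0 !addr0.
by rewrite sumr_const card_ord -[in LHS]mulr_natl; field.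
Qed.

Section Circulant.
Context (gam : R -> R).
Context (gam_per : forall t, gam (t + 2 * pi) = gam t).
Context (gam_even : forall t, gam (- t) = gam t).

(** The eigenvalue at frequency k of the circulant matrix of [gam] on K points, which is real
    because [gam] is even. *)
Definition eigmu K k : R := \sum_(j < K) gam (ang K j) * cos (k%:R * ang K j).

Lemma sum_gam_sin K k : \sum_(j < K) gam (ang K j) * sin (k%:R * ang K j) = 0.
Proof.
have := @sum_reflect (fun t => gam t * cos (k%:R * t - pi / 2)) K 0.
move=> /(_ (fun t => _)) h; have {}h := h _.
suff : \sum_(j < K) gam (ang K j) * sin (k%:R * ang K j) =
   - \sum_(j < K) gam (ang K j) * sin (k%:R * ang K j) by move=> ?; lra.
transitivity (\sum_(j < K) gam (ang K j) * cos (k%:R * ang K j - pi / 2)).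
  by apply: eq_bigr => j _; rewrite cosBpihalf.
rewrite -h; last by move=> t; rewrite gam_per periodic_cosM.
rewrite -sumrN; apply: eq_bigr => j _.
by rewrite ang0 sub0r gam_even mulrN cosBpihalf sinN mulrN.
Qed.

(** Substituting i - j for j leaves a cosine and a sine moment of [gam], and the latter vanishes by
    parity. The phase [s] treats the cosine and the sine eigenvectors at once. *)
Lemma circulant_eigen K k (i : nat) s :
  \sum_(j < K) gam (ang K i - ang K j) * cos (k%:R * ang K j - s) =
  eigmu K k * cos (k%:R * ang K i - s).
Proof.
pose phi t := gam t * cos (k%:R * t - (k%:R * ang K i - s)).
have hp t : phi (t + 2 * pi) = phi t by rewrite /phi gam_per periodic_cosM.
transitivity (\sum_(j < K) phi (ang K i - ang K j)).
  apply: eq_bigr => j _; rewrite /phi; congr (_ * _).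
  by rewrite -cosN; congr cos; ring.
rewrite sum_reflect // /phi /eigmu.
under eq_bigr do rewrite cosB mulrDr [X in X + _]mulrA [X in _ + X]mulrA.
by rewrite big_split -!big_distrl /= sum_gam_sin mul0r addr0.
Qed.

Definition quad K (y : 'I_K -> R) : R :=
  \sum_(i < K) \sum_(j < K) y i * y j * gam (ang K i - ang K j).

(** The squared modulus of the Fourier coefficient of [y] at frequency k, written without complex
    numbers. *)
Definition power K k (y : 'I_K -> R) : R :=
  (\sum_(j < K) y j * cos (k%:R * ang K j)) ^+ 2 +
  (\sum_(j < K) y j * sin (k%:R * ang K j)) ^+ 2.

Lemma powerE K k (y : 'I_K -> R) :
  power k y = \sum_(i < K) \sum_(j < K)
     y i * y j * cos (k%:R * (ang K i - ang K j)).
Proof.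
rewrite /power !expr2 !big_distrl -big_split; apply: eq_bigr => i _ /=.
rewrite !big_distrr -big_split; apply: eq_bigr => j _ /=.
by rewrite mulrBr cosB; ring.
Qed.

Lemma power_ge0 K k (y : 'I_K -> R) : 0 <= power k y.
Proof. by rewrite addr_ge0 ?sqr_ge0. Qed.

Lemma quad_Fourier K (y : 'I_K -> R) :
  K%:R * quad y = \sum_(k < K) eigmu K k * power k y.
Proof.
transitivity (\sum_(k < K) \sum_(i < K) \sum_(j < K)
    y i * y j * (\sum_(l < K) gam (ang K i - ang K l) *
      cos (k%:R * (ang K l - ang K j)))); last first.
  apply: eq_bigr => k _; rewrite powerE mulr_sumr; apply: eq_bigr => i _.
  rewrite mulr_sumr; apply: eq_bigr => j _; rewrite mulrCA; congr (_ * _).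
  by rewrite mulrBr -circulant_eigen; apply: eq_bigr => l _; rewrite mulrBr.
rewrite /quad mulr_sumr exchange_big; apply: eq_bigr => i _ /=.
rewrite mulr_sumr exchange_big; apply: eq_bigr => j _ /=.
rewrite -mulr_sumr mulrCA; congr (_ * _).
rewrite exchange_big /=; under eq_bigr do rewrite -mulr_sumr sum_freq_cos.
rewrite (bigD1 j) //= big1 ?addr0 ?eqxx ?mulr1 1?mulrC //.
by move=> l /negPf ->; rewrite !mulr0.
Qed.

Lemma Parseval K (y : 'I_K -> R) :
  K%:R * \sum_(j < K) y j ^+ 2 = \sum_(k < K) power k y.
Proof.
under [RHS]eq_bigr do rewrite powerE.
rewrite [RHS]exchange_big mulr_sumr; apply: eq_bigr => i _ /=.
rewrite exchange_big /=; under eq_bigr do rewrite -mulr_sumr sum_freq_cos.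
rewrite (bigD1 i) //= big1 ?addr0 ?eqxx ?mulr1 1?mulrC //.
by move=> l; rewrite eq_sym => /negPf ->; rewrite !mulr0.
Qed.

(** The disjunction lets a linear constraint on [y] discard the frequencies with a large
    eigenvalue. *)
Lemma quad_le K (y : 'I_K -> R) (m : R) :
  (forall k : 'I_K, power k y = 0 \/ eigmu K k <= m) ->
  quad y <= m * \sum_(j < K) y j ^+ 2.
Proof.
case: K y => [|K] y h; first by rewrite /quad !big_ord0 mulr0.
rewrite -(@ler_pM2l _ K.+1%:R) ?ltr0n // mulrCA quad_Fourier Parseval.
rewrite mulr_sumr; apply: ler_sum => k _.
case: (h k) => [->|hk]; first by rewrite !mulr0.
by rewrite ler_wpM2r // power_ge0.
Qed.

End Circulant.

Lemma sum_blocks (V : nmodType) N q (F : nat -> nat -> V) :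
  \sum_(i < N * q) F (i %/ q)%N (i %% q)%N = \sum_(j < N) \sum_(r < q) F j r.
Proof.
elim: N => [|N IH]; first by rewrite !big_ord0.
rewrite big_ord_recr /= -IH.
rewrite -(big_mkord xpredT (fun i => F (i %/ q)%N (i %% q)%N)).
rewrite -(big_mkord xpredT (fun i => F (i %/ q)%N (i %% q)%N)).
have -> : (N.+1 * q = N * q + q)%N by rewrite mulSn addnC.
rewrite (@big_cat_nat _ _ _ (N * q)) //= ?leq_addr //; congr (_ + _).
rewrite -{1}[(N * q)%N]add0n big_addn addKn big_mkord.
apply: eq_bigr => r _.
have q0 : (0 < q)%N by apply: leq_ltn_trans (ltn_ord r).
by rewrite addnC divnMDl // modnMDl divn_small ?modn_small ?addn0.
Qed.

End GridSums.

(** * Extremality of the first frequency for the Dirichlet kernel *)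

Section DirichletKernel.
Context {R : realType}.
Implicit Types (y : R) (l k h : nat).

(** The Dirichlet kernel in the half angle, equal to sin ((2 l + 1) y) / sin y when sin y is
    nonzero. Below, [x] is half the step of a grid of 2 h points and frequency k corresponds to
    [y = k x]. *)
Definition dirichlet l y : R := 1 + \sum_(1 <= j < l.+1) 2 * cos (2 * j%:R * y).

Lemma dirichletS l y :
  dirichlet l.+1 y = dirichlet l y + 2 * cos (2 * l.+1%:R * y).
Proof. by rewrite /dirichlet big_nat_recr //= addrA. Qed.

Lemma dirichlet0 y : dirichlet 0 y = 1.
Proof. by rewrite /dirichlet big_geq // addr0. Qed.

Lemma sin_dirichlet l y : sin y * dirichlet l y = sin ((2 * l + 1)%:R * y).
Proof.
elim: l => [|l IH]; first by rewrite dirichlet0 mulr1 muln0 add0n mul1r.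
rewrite dirichletS mulrDr IH.
have -> : (2 * l + 1)%:R * y = 2 * l.+1%:R * y - y.
  by rewrite natrD natrM -(natr1 l); ring.
have -> : (2 * l.+1 + 1)%:R * y = 2 * l.+1%:R * y + y.
  by rewrite natrD natrM -(natr1 l); ring.
by rewrite sinB sinD; ring.
Qed.

Context (h k : nat) (x : R).
Context (k1 : (0 < k <= h)%N) (hx : h%:R * x = pi / 2).

Let h0 : (0 < h)%N. Proof. by case/andP: k1 => a b; apply: leq_trans b. Qed.

Let x0 : 0 < x.
Proof.
have : 0 < h%:R * x by rewrite hx divr_gt0 ?pi_gt0.
by rewrite pmulr_rgt0 // ltr0n.
Qed.

Let kx : 0 < k%:R * x <= pi / 2.
Proof.
case/andP: k1 => a b; rewrite mulr_gt0 ?ltr0n //= -hx.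
by rewrite ler_pM2r // ler_nat.
Qed.

(** The numerator sin ((2 l + 1) x) is at least (2 / pi) (2 l + 1) x by Jordan's inequality, the
    denominator is at most x, and pi <= 4. *)
Lemma dirichlet_lower l : (2 * l + 1 <= h)%N -> (2 * l + 1)%:R <= 2 * dirichlet l x.
Proof.
move=> lh; have p0 := pi_gt0 R; have p4 := pihalf_lt2 R.
set L := (2 * l + 1)%N.
have L1 : (1 : R) <= L%:R by rewrite ler1n /L addn1.
have Lx : 0 <= L%:R * x <= pi / 2.
  apply/andP; split; first by apply: mulr_ge0 => //; exact: ltW.
  by rewrite -hx ler_wpM2r ?ler_nat //; exact: ltW.
have s1 := sin_concave_ge Lx.
have s2 := sin_le (ltW x0).
have e := sin_dirichlet l x; rewrite -/L in e.
have sx : 0 < sin x.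
  apply: sin_gt0_pi; rewrite x0 /=.
  by have := ler_peMl (ltW x0) L1; lra.
rewrite -(ler_pM2l sx) mulrCA e.
have h1 : sin x * L%:R <= x * L%:R by rewrite ler_wpM2r //; lra.
have h2 : x * L%:R * 4 <= sin (L%:R * x) * pi * 2 by lra.
have h3 : 0 <= sin (L%:R * x) by apply: sin_ge0_pi; lra.
have : sin (L%:R * x) * pi <= sin (L%:R * x) * 4 by rewrite ler_wpM2l //; lra.
lra.
Qed.

(** If l k > h, the kernel at k x is at most 1 / sin (k x) <= h / k < l, which is below the kernel
    at x. If l k <= h, all angles 2 j k x stay in [0, pi], where cos decreases: this gives the upper
    bound term by term. There (2 l + 1) k x <= pi + k x as well, so the kernel is at least -1, while
    it is at least 1 at x. *)
Lemma dirichlet_abs_le l : (2 * l + 1 <= h)%N ->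
  `|dirichlet l (k%:R * x)| <= dirichlet l x.
Proof.
move=> lh; have p0 := pi_gt0 R; have lo := dirichlet_lower lh.
have kx' := kx.
have skx : 0 < sin (k%:R * x) by apply: sin_gt0_pi; lra.
have e := sin_dirichlet l (k%:R * x).
have [T|T] := leqP (l * k) h; last first.
  have s1 : k%:R * x * 2 <= sin (k%:R * x) * pi by apply: sin_concave_ge; lra.
  have hb : `|dirichlet l (k%:R * x)| * sin (k%:R * x) <= 1.
    by rewrite -[X in _ * X]gtr0_norm // -normrM mulrC e sin_max.
  have hlk : h%:R < l%:R * k%:R :> R by rewrite -natrM ltr_nat.
  have h0' : (0 : R) < h%:R by rewrite ltr0n.
  have s2 : k%:R <= sin (k%:R * x) * h%:R.
    rewrite -(ler_pM2r p0); have := ler_wpM2r (ltW h0') s1.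
    suff -> : k%:R * x * 2 * h%:R = k%:R * pi by lra.
    by transitivity (k%:R * 2 * (h%:R * x)); [ring|rewrite hx; field].
  have hd : `|dirichlet l (k%:R * x)| * k%:R <= h%:R.
    apply: le_trans (_ : `|dirichlet l (k%:R * x)| * (sin (k%:R * x) * h%:R) <= _).
      by rewrite ler_wpM2l.
    by rewrite mulrA ler_piMl // ltW.
  have k0 : (0 : R) < k%:R by case/andP: k1 => ? _; rewrite ltr0n.
  have : `|dirichlet l (k%:R * x)| < l%:R.
    by rewrite -(ltr_pM2r k0); apply: le_lt_trans hd hlk.
  move: lo; rewrite natrD natrM; lra.
rewrite ler_norml; apply/andP; split; last first.
  rewrite /dirichlet lerD2l; apply: ler_sum_nat => j /andP[j0 jl].
  rewrite ler_pM2l //.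
  have jk : 2 * j%:R * (k%:R * x) <= pi.
    have : (j * k)%:R <= h%:R :> R.
      by rewrite ler_nat; apply: leq_trans T; rewrite leq_mul2r -ltnS jl orbT.
    rewrite natrM => h1; have := ler_wpM2r (ltW x0) h1; rewrite hx; lra.
  have jx : 0 <= 2 * j%:R * x by rewrite !mulr_ge0 // ltW.
  have jxk : 2 * j%:R * x <= 2 * j%:R * (k%:R * x).
    rewrite ler_wpM2l ?mulr_ge0 // ler_peMl ?ler1n ?(ltW x0) //.
    by case/andP: k1.
  rewrite leNgt ltr_cos ?in_itv /= -?leNgt //; lra.
suff : -1 <= dirichlet l (k%:R * x).
  have : 1 <= dirichlet l x.
    case: l lh lo {e T} => [|l] lh lo; first by rewrite dirichlet0.
    have : (3 : R) <= (2 * l.+1 + 1)%:R by rewrite ler_nat; lia.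
    lra.
  lra.
rewrite -(ler_pM2l skx) e mulrN1.
set u := _ * (_ * x).
have hu : 0 <= u <= pi + k%:R * x.
  rewrite /u; apply/andP; split; first by rewrite mulr_ge0 //; lra.
  have h1 : (l * k)%:R <= h%:R :> R by rewrite ler_nat.
  have := ler_wpM2r (ltW x0) h1; rewrite hx natrM natrD natrM; lra.
have [up|up] := leP u pi.
  have : 0 <= sin u by apply: sin_ge0_pi; lra.
  lra.
have -> : u = (u - pi) + pi by ring.
rewrite sinDpi lerN2 leNgt ltr_sin ?in_itv /= -?leNgt; lra.
Qed.

(** As 2 h x = pi, replacing 2 l + 1 by 2 h - (2 l + 1) changes the numerator at most by a sign, and
    for k = 1 by none. This exchanges l with h - 1 - l and reduces to 2 l + 1 <= h. *)
Lemma dirichlet_le l : (l < h)%N -> dirichlet l (k%:R * x) <= dirichlet l x.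
Proof.
move=> lh; have p0 := pi_gt0 R; have kx' := kx.
have [L|L] := leqP (2 * l + 1) h.
  exact: le_trans (ler_norm _) (dirichlet_abs_le L).
pose l' := (h.-1 - l)%N.
have el : (2 * l + 1 = 2 * h - (2 * l' + 1))%N by rewrite /l'; lia.
have hl' : (2 * l' + 1 <= h)%N by rewrite /l'; lia.
have skx : 0 < sin (k%:R * x) by apply: sin_gt0_pi; lra.
have sx : 0 < sin x.
  have : (1 : R) <= k%:R by rewrite ler1n; case/andP: k1.
  by move=> hk; have := ler_peMl (ltW x0) hk => ?; apply: sin_gt0_pi; have := x0; lra.
have E (i : nat) : (2 * l + 1)%:R * (i%:R * x) = - ((2 * l' + 1)%:R * (i%:R * x)) + i%:R * pi.
  have -> : (2 * l + 1)%:R = 2 * h%:R - (2 * l' + 1)%:R :> R.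
    by rewrite el natrB ?natrM //; lia.
  by have := hx; nra.
have hS i y : `|sin (y + i%:R * pi)| = `|sin y| :> R.
  elim: i => [|i IH]; first by rewrite mul0r addr0.
  by rewrite -addn1 natrD mulrDl mul1r addrA sinDpi normrN.
apply: le_trans (ler_norm _) _.
have -> : `|dirichlet l (k%:R * x)| = `|dirichlet l' (k%:R * x)|.
  apply: (@mulfI _ (sin (k%:R * x))); first by rewrite gt_eqF.
  rewrite -[X in X * _ = _](gtr0_norm skx) -[X in _ = X * _](gtr0_norm skx).
  rewrite -!normrM !sin_dirichlet E hS.
  by rewrite sinN normrN.
have -> : dirichlet l x = dirichlet l' x.
  apply: (@mulfI _ (sin x)); first by rewrite gt_eqF.
  rewrite !sin_dirichlet; have := E 1%N; rewrite !mul1r => ->.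
  by rewrite sinDpi sinN opprK.
exact: dirichlet_abs_le.
Qed.

End DirichletKernel.

(** * The largest nonconstant Fourier eigenvalue of a nearly decreasing profile *)

Section TopFrequency.
Context {R : realType}.

(** The reflection j -> 2 h - j fixes 0 and h on the cycle, which are therefore counted once. *)
Lemma fold_sum (V : zmodType) h (phi : nat -> V) : (0 < h)%N ->
  (forall j, (0 < j < 2 * h)%N -> phi (2 * h - j)%N = phi j) ->
  \sum_(j < 2 * h) phi j = phi 0%N + \sum_(1 <= j < h) phi j *+ 2 + phi h.
Proof.
move=> h0 hphi; rewrite -(big_mkord xpredT phi).
rewrite big_ltn; last by lia.
rewrite -addrA; congr (_ + _).
rewrite (@big_cat_nat _ _ _ h) //=; [|lia..].
rewrite [X in _ + X]big_ltn; last by lia.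
rewrite addrCA addrC; congr (_ + _).
under [RHS]eq_bigr do rewrite mulr2n.
rewrite big_split /=; congr (_ + _).
rewrite big_nat_rev /= -{1}[h.+1]add1n big_addn.
have -> : (2 * h - h = h)%N by lia.
rewrite !big_nat; apply: eq_bigr => j /andP[j1 j2].
have -> : (h.+1 + 2 * h - (j + h).+1 = 2 * h - j)%N by lia.
by apply: hphi; lia.
Qed.

Context (gam : R -> R) (eps : R).
Context (gam_per : forall t, gam (t + 2 * pi) = gam t).
Context (gam_even : forall t, gam (- t) = gam t).
Context (gam01 : forall t, 0 <= gam t <= 1).
Context (gam_mono : forall s t : R, 0 <= s -> s <= t -> t <= pi -> gam t <= gam s + eps).

Let eps0 : 0 <= eps.
Proof. by have := gam_mono (lexx 0) (lexx 0) (pi_ge0 R); lra. Qed.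

Lemma eigmu_sym n k : (k <= n)%N -> eigmu gam n (n - k) = eigmu gam n k.
Proof.
move=> kn; apply: eq_bigr => j _; congr (_ * _).
have n0 : (0 < n)%N by apply: leq_ltn_trans (ltn_ord j).
have -> : (n - k)%:R * ang n j = - (k%:R * ang n j) + j%:R * (2 * pi) :> R.
  by rewrite natrB // mulrBl -[n%:R * _]angM mulnC angM angKK // addrC.
rewrite (@periodic2pi_nat _ cos) ?cosN //.
by move=> t; rewrite mulr_natl cosD2pi.
Qed.

Lemma eigmu_le_mu0 n k : eigmu gam n k <= eigmu gam n 0.
Proof.
apply: ler_sum => j _; rewrite mul0r cos0.
by have := gam01 (ang n j) => ?; rewrite ler_wpM2l ?cos_le1 //; lra.
Qed.

Context (h : nat).
Hypothesis h0 : (0 < h)%N.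

(** [gam] decreases only up to [eps]; its maximum over the grid angles from m to the antipode is
    exactly nonincreasing in m and within [eps] of it. The default 0 is harmless because [gam] is
    nonnegative. *)
Let env m : R := \big[Num.max/0]_(m <= l < h.+1) gam (ang (2 * h) l).

Let envE m : (m <= h)%N -> env m = Num.max (gam (ang (2 * h) m)) (env m.+1).
Proof. by move=> mh; rewrite /env big_ltn. Qed.

Let env_dec m : (m <= h)%N -> env m.+1 <= env m.
Proof. by move=> /envE ->; rewrite le_max lexx orbT. Qed.

Let env_bounds m : (m <= h)%N -> gam (ang (2 * h) m) <= env m <= gam (ang (2 * h) m) + eps.
Proof.
move=> mh; apply/andP; split; first by rewrite envE // le_max lexx.
rewrite /env big_nat; elim/big_ind: _ => [|a b ha hb|l /andP[ml lh]].
- by have := gam01 (ang (2 * h) m); have := eps0; lra.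
- by rewrite ge_max ha hb.
- apply: gam_mono; [exact: ang_ge0|exact: ler_ang|].
  apply: le_trans (_ : ang (2 * h) h <= _); first exact: ler_ang.
  suff -> : ang (2 * h) h = pi :> R by [].
  by rewrite /ang natrM; field; rewrite pnatr_eq0 -lt0n.
Qed.

Let fold (j : nat) := minn j (2 * h - j).

Let mu_env k := \sum_(j < 2 * h) env (fold j) * cos (k%:R * ang (2 * h) j).

Let ang_sym j : (j <= 2 * h)%N -> ang (2 * h) (2 * h - j) = - ang (2 * h) j + 2 * pi :> R.
Proof.
move=> jh; have := @angD R (2 * h) (2 * h - j) j.
by rewrite subnK // angKK ?muln_gt0 //; lra.
Qed.

Let mu_envP k : `|eigmu gam (2 * h) k - mu_env k| <= (2 * h)%:R * eps.
Proof.
rewrite /eigmu /mu_env -sumrB.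
apply: le_trans (ler_norm_sum _ _ _) _.
apply: le_trans (_ : \sum_(j < 2 * h) eps <= _); last first.
  by rewrite sumr_const card_ord mulr_natl.
apply: ler_sum => j _; rewrite -mulrBl normrM.
apply: le_trans (_ : eps * 1 <= _); last by rewrite mulr1.
apply: ler_pM => //; last exact: cos_max.
have -> : gam (ang (2 * h) j) = gam (ang (2 * h) (fold j)).
  rewrite /fold /minn; case: ifP => // _.
  by rewrite ang_sym ?gam_per ?gam_even // ltnW.
have := @env_bounds (fold j) _; rewrite ler_norml => /(_ _) H.
have {}H := H (_ : is_true (fold j <= h)%N).
by apply/andP; split; have := H ltac:(rewrite /fold; lia); lra.
Qed.

(** Summation by parts: the folded sum becomes a combination of Dirichlet kernels with the
    nonnegative weights [env l - env l.+1], so the kernel inequality carries over. *)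
Let mu_env_abel k : (0 < k <= h)%N -> mu_env k =
  \sum_(l < h) (env l - env l.+1) * dirichlet l (k%:R * (pi / (2 * h)%:R)).
Proof.
move=> kh; pose c j : R := cos (k%:R * ang (2 * h) j).
have cE j : c j = cos (2 * j%:R * (k%:R * (pi / (2 * h)%:R))).
  by rewrite /c /ang; congr cos; ring.
have c_sym j : (0 < j < 2 * h)%N -> c (2 * h - j)%N = c j.
  move=> jh; rewrite /c ang_sym; last by lia.
  have := periodic_cosM k (0 : R) (- ang (2 * h) j); rewrite !subr0 => ->.
  by rewrite mulrN cosN.
have c0 : c 0%N = 1 by rewrite /c ang0 mulr0 cos0.
pose D l : R := dirichlet l (k%:R * (pi / (2 * h)%:R)).
(* The cosines sum to zero over the full grid. This turns the boundary term of the summation by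
   parts, where the antipode has weight one instead of two, into the last summand. *)
have full : D h.-1 + c h = 0.
  have : \sum_(j < 2 * h) c j = 0 by apply: sum_grid_cos; lia.
  rewrite (fold_sum h0 c_sym) c0 => <-; congr (_ + _).
  rewrite /D /dirichlet prednK //; congr (_ + _); apply: eq_bigr => j _.
  by rewrite cE mulr2n; ring.
rewrite /mu_env (@fold_sum _ h (fun j => env (fold j) * c j)) //; last first.
  move=> j jh; rewrite c_sym //; congr (env _ * _).
  by rewrite /fold; lia.
have fE j : (j <= h)%N -> fold j = j by rewrite /fold; lia.
rewrite c0 !fE //.
have -> : \sum_(1 <= j < h) (env (fold j) * c j) *+ 2 =
          \sum_(1 <= j < h) env j * (2 * c j).
  rewrite !big_nat; apply: eq_bigr => j /andP[_ jh].
  by rewrite fE ?(ltnW jh) // mulr2n; ring.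
have abel m : env 0%N * 1 + \sum_(1 <= j < m.+1) env j * (2 * c j) =
     \sum_(l < m) (env l - env l.+1) * D l + env m * D m.
  elim: m => [|m IH].
    by rewrite big_geq // big_ord0 /D dirichlet0; ring.
  rewrite big_nat_recr //= addrA IH big_ord_recr /=.
  by rewrite /D dirichletS -cE; ring.
have recr (F : nat -> R) : \sum_(l < h) F l = \sum_(l < h.-1) F l + F h.-1.
  by rewrite -[in LHS](prednK h0) big_ord_recr.
have := abel h.-1; rewrite prednK // => ->.
rewrite (recr (fun l => (env l - env l.+1) * D l)) prednK //.
have -> : c h = - D h.-1 by lra.
by ring.
Qed.

(* The exact inequality for a decreasing gam is the Dirichlet kernel bound, by
   summation by parts; the envelope reduces to it. *)
Lemma eigmu_le_mu1 k : (0 < k < 2 * h)%N ->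
  eigmu gam (2 * h) k <= eigmu gam (2 * h) 1 + 2 * (2 * h)%:R * eps.
Proof.
move=> kh.
wlog kh' : k kh / (k <= h)%N.
  move=> H; have [|hk] := leqP k h; first exact: H.
  by rewrite -eigmu_sym; [apply: H; lia|lia].
have h1 := mu_envP k; have h2 := mu_envP 1.
suff : mu_env k <= mu_env 1.
  by move: h1 h2; rewrite !ler_norml; lra.
rewrite !mu_env_abel; [|lia..].
apply: ler_sum => l _; rewrite ler_wpM2l ?subr_ge0 ?env_dec //; first exact: ltnW.
rewrite mul1r; apply: (@dirichlet_le _ h) => //; first lia.
by rewrite natrM; field; rewrite pnatr_eq0 -lt0n.
Qed.

End TopFrequency.

(** * Spectral theory of symmetric matrices *)

Section SpectralTheorem.
Context {R : realType}.

Lemma char_poly_involution n (H M : 'M[R]_n) : H *m H = 1%:M ->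
  char_poly (H *m M *m H) = char_poly M.
Proof.
move=> HH; rewrite /char_poly.
have HHp : map_mx polyC H *m map_mx polyC H = 1%:M.
  by rewrite -map_mxM HH map_mx1.
have -> : char_poly_mx (H *m M *m H) =
    map_mx polyC H *m char_poly_mx M *m map_mx polyC H.
  rewrite /char_poly_mx !map_mxM mulmxBr mulmxBl; congr (_ - _).
  by rewrite mul_mx_scalar -scalemxAl HHp -mul_scalar_mx mulmx1.
rewrite !det_mulmx mulrAC -det_mulmx HHp det1 mul1r //.
Qed.

Lemma sqnorm_row_gt0 n (w : 'rV[R]_n) : w != 0 -> 0 < (w *m w^T) 0 0.
Proof.
move=> w0; have [i wi] : exists i, w 0 i != 0.
  apply/existsP; apply: contraNT w0; rewrite negb_exists => /forallP h.
  by apply/eqP/rowP => i; rewrite mxE; apply/eqP; have := h i; rewrite negbK.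
rewrite mxE (bigD1 i) //= mxE -expr2 ltr_pwDl ?exprn_even_gt0 //.
by apply: sumr_ge0 => j _; rewrite mxE -expr2 sqr_ge0.
Qed.

(** The Householder reflection in the hyperplane orthogonal to [u - e]. *)
Lemma householder n (e u : 'rV[R]_n) : e *m e^T = 1%:M -> u *m u^T = 1%:M ->
  exists H : 'M[R]_n, [/\ H^T = H, H *m H = 1%:M & e *m H = u].
Proof.
move=> he hu; have [->|ne] := eqVneq u e.
  by exists 1%:M; rewrite trmx1 !mulmx1.
pose w := u - e; pose c := (w *m w^T) 0 0.
have w0 : w != 0 by rewrite subr_eq0.
have c0 : 0 < c := sqnorm_row_gt0 w0.
have ww : w *m w^T = c%:M by rewrite [LHS]mx11_scalar.
have tr11 (B : 'M[R]_1) : B^T = B by apply/matrixP => i j; rewrite mxE !ord1.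
have eu : u *m e^T = e *m u^T by rewrite -[LHS]tr11 trmx_mul trmxK.
have hc : c%:M = (1%:M - e *m u^T) - (e *m u^T - 1%:M).
  by rewrite -ww /w linearB /= mulmxBr !mulmxBl he hu eu.
have ew : e *m w^T = (- (c / 2))%:M.
  rewrite /w linearB /= mulmxBr he; apply/matrixP => i j.
  rewrite !ord1; have := congr1 (fun B : 'M[R]_1 => B 0 0) hc.
  by rewrite !mxE /= !mulr1n; lra.
exists (1%:M - (2 / c) *: (w^T *m w)); split.
- by rewrite linearB /= trmx1 linearZ /= trmx_mul trmxK.
- rewrite mulmxBr mulmx1 mulmxBl mul1mx.
  rewrite -scalemxAl -!scalemxAr mulmxA -(mulmxA w^T) ww mul_mx_scalar -scalemxAl.
  rewrite !scalerA.
  have -> : 2 / c * (2 / c * c) = 2 / c + 2 / c :> R by field; rewrite gt_eqF.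
  by rewrite scalerDl opprB addrK subrK.
- rewrite mulmxBr mulmx1 -scalemxAr mulmxA ew mul_scalar_mx scalerA.
  have -> : 2 / c * - (c / 2) = -1 :> R by field; rewrite gt_eqF.
  by rewrite scaleN1r opprK /w addrC subrK.
Qed.

(** Induction on the size: a Householder reflection carries the first basis vector to a unit
    eigenvector for the head of [s], and the remaining block has the tail as its list of roots.
    Starting from a given factorization puts the eigenvalues on the diagonal in the order of [s]. *)
Lemma spectral_theorem n (M : 'M[R]_n) (s : seq R) :
  M^T = M -> char_poly M = \prod_(a <- s) ('X - a%:P) ->
  exists P : 'M[R]_n, P^T *m P = 1%:M /\
    M = P^T *m diag_mx (\row_i s`_i) *m P.
Proof.
elim: n M s => [|n IH] M s sM hs.
  by exists 1%:M; split; apply/matrixP => -[].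
have := size_char_poly M; rewrite hs size_prod_XsubC => -[].
case: s hs => [//|a s] hs [ss].
have : eigenvalue M a.
  by rewrite eigenvalue_root_char hs big_cons rootM root_XsubC eqxx.
case/eigenvalueP => v vM v0.
pose q := Num.sqrt ((v *m v^T) 0 0); pose u := q^-1 *: v.
have q0 : 0 < q by rewrite sqrtr_gt0 sqnorm_row_gt0.
have uM : u *m M = a *: u.
  by rewrite /u -scalemxAl vM !scalerA mulrC.
have uu : u *m u^T = 1%:M.
  rewrite /u linearZ /= -scalemxAl -scalemxAr scalerA [_ *m _]mx11_scalar.
  rewrite -(@sqr_sqrtr _ ((v *m v^T) 0 0)) ?ltW ?sqnorm_row_gt0 // -/q.
  rewrite scale_scalar_mx; congr (_%:M).
  by field; rewrite gt_eqF.
pose e : 'rV[R]_(1 + n) := row_mx 1%:M 0.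
have ee : e *m e^T = 1%:M by rewrite tr_row_mx mul_row_col trmx1 mulmx1 trmx0 mulmx0 addr0.
have [H [sH HH eH]] := @householder (1 + n) e u ee uu.
pose B : 'M[R]_(1 + n) := H *m M *m H.
have sB : B^T = B by rewrite /B !trmx_mul sH sM mulmxA.
have eB : e *m B = a *: e.
  rewrite /B !mulmxA eH uM -scalemxAl; congr (_ *: _).
  by rewrite -eH -mulmxA HH mulmx1.
have dB : B = block_mx a%:M 0 0 (drsubmx B).
  rewrite -[LHS]submxK.
  have : e *m B = row_mx (ulsubmx B) (ursubmx B).
    by rewrite -{1}[B]submxK mul_row_block !mul1mx !mul0mx !addr0.
  rewrite eB /e scale_row_mx scaler0 scalemx1 => /eq_row_mx[<- h2].
  rewrite -h2; congr block_mx.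
  by rewrite -[LHS]trmxK trmx_dlsub sB -h2 trmx0.
have cB : char_poly B = char_poly M by exact: char_poly_involution.
have sB' : (drsubmx B)^T = drsubmx B by rewrite trmx_drsub sB.
have cB' : char_poly (drsubmx B) = \prod_(b <- s) ('X - b%:P).
  apply: (@mulfI _ ('X - a%:P)); first by rewrite polyXsubC_eq0.
  rewrite -[RHS](big_cons _ _ _ _ xpredT) -hs -cB [in RHS]dB /char_poly.
  rewrite char_block_diag_mx det_ublock; congr (_ * _).
  by rewrite /char_poly_mx det_mx11 !mxE eqxx.
have [P' [PP' hP']] := IH _ _ sB' cB'.
pose P0 : 'M[R]_(1 + n) := block_mx 1%:M 0 0 P'.
exists (P0 *m H); split.
  rewrite trmx_mul mulmxA -(mulmxA _ P0^T).
  rewrite tr_block_mx mulmx_block !trmx0 !mul0mx !mulmx0 !addr0 add0r trmx1 mul1mx PP'.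
  by rewrite -scalar_mx_block mulmx1 sH HH.
have -> : M = H *m B *m H.
  by rewrite /B !mulmxA HH mul1mx -mulmxA HH mulmx1.
suff -> : B = P0^T *m diag_mx (\row_i (a :: s)`_i) *m P0.
  by rewrite trmx_mul sH !mulmxA.
rewrite [LHS]dB hP'.
have -> : diag_mx (\row_i (a :: s)`_i) =
    block_mx a%:M 0 0 (diag_mx (\row_i s`_i)) :> 'M[R]_(1 + n).
  rewrite -[LHS]submxK; congr block_mx; apply/matrixP => i j; rewrite !mxE.
  - by rewrite !ord1.
  - by rewrite -val_eqE /= ord1.
  - by rewrite -val_eqE /= ord1.
  - by rewrite -!val_eqE /= eqSS.
rewrite tr_block_mx !mulmx_block !trmx0 !mul0mx !mulmx0 !addr0 !add0r trmx1 mul1mx mulmx1.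
by rewrite !mul0mx.
Qed.

End SpectralTheorem.

Section OperatorNorm.
Context {R : realType}.

Definition dotv n (x y : 'cV[R]_n) : R := \sum_i x i 0 * y i 0.

Definition nrm n (x : 'cV[R]_n) : R := Num.sqrt (dotv x x).

Lemma dotvE n (x y : 'cV[R]_n) : dotv x y = (x^T *m y) 0 0.
Proof. by rewrite mxE; apply: eq_bigr => i _; rewrite mxE. Qed.

Lemma dotvC n (x y : 'cV[R]_n) : dotv x y = dotv y x.
Proof. by apply: eq_bigr => i _; rewrite mulrC. Qed.

Lemma dotvDl n (x y z : 'cV[R]_n) : dotv (x + y) z = dotv x z + dotv y z.
Proof. by rewrite -big_split; apply: eq_bigr => i _; rewrite mxE mulrDl. Qed.

Lemma dotvDr n (x y z : 'cV[R]_n) : dotv x (y + z) = dotv x y + dotv x z.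
Proof. by rewrite dotvC dotvDl !(dotvC x). Qed.

Lemma dotvZl n a (x y : 'cV[R]_n) : dotv (a *: x) y = a * dotv x y.
Proof. by rewrite /dotv mulr_sumr; apply: eq_bigr => i _; rewrite mxE mulrA. Qed.

Lemma dotvZr n a (x y : 'cV[R]_n) : dotv x (a *: y) = a * dotv x y.
Proof. by rewrite dotvC dotvZl dotvC. Qed.

Lemma dotvNl n (x y : 'cV[R]_n) : dotv (- x) y = - dotv x y.
Proof. by rewrite -scaleN1r dotvZl mulN1r. Qed.

Lemma dotvNr n (x y : 'cV[R]_n) : dotv x (- y) = - dotv x y.
Proof. by rewrite dotvC dotvNl dotvC. Qed.

Lemma dotv0l n (y : 'cV[R]_n) : dotv 0 y = 0.
Proof. by rewrite -(scale0r 0) dotvZl mul0r. Qed.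

Lemma dotv_mull m n (A : 'M[R]_(m, n)) x y : dotv (A *m x) y = dotv x (A^T *m y).
Proof. by rewrite !dotvE trmx_mul mulmxA. Qed.

Lemma dotv_sqr n (x : 'cV[R]_n) : dotv x x = \sum_i x i 0 ^+ 2.
Proof. by apply: eq_bigr => i _; rewrite expr2. Qed.

Lemma dotv_ge0 n (x : 'cV[R]_n) : 0 <= dotv x x.
Proof. by rewrite dotv_sqr sumr_ge0 // => i _; rewrite sqr_ge0. Qed.

Lemma dotv_eq0 n (x : 'cV[R]_n) : dotv x x = 0 -> x = 0.
Proof.
rewrite dotv_sqr => /psumr_eq0P h; apply/matrixP => i j; rewrite ord1 mxE.
by apply/eqP; rewrite -sqrf_eq0; apply/eqP; apply: h => // k _; rewrite sqr_ge0.
Qed.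

Lemma dotv_gt0 n (x : 'cV[R]_n) : x != 0 -> 0 < dotv x x.
Proof.
move=> x0; rewrite lt_neqAle dotv_ge0 andbT eq_sym.
by apply: contraNN x0 => /eqP /dotv_eq0 ->.
Qed.

Lemma nrm_ge0 n (x : 'cV[R]_n) : 0 <= nrm x. Proof. exact: sqrtr_ge0. Qed.

Lemma nrm_sqr n (x : 'cV[R]_n) : nrm x ^+ 2 = dotv x x.
Proof. by rewrite sqr_sqrtr // dotv_ge0. Qed.

Lemma Cauchy_Schwarz_sum (I : finType) (a b : I -> R) :
  (\sum_i a i * b i) ^+ 2 <= (\sum_i a i ^+ 2) * (\sum_i b i ^+ 2).
Proof.
set A := \sum_i a i ^+ 2; set B := \sum_i b i ^+ 2; set C := \sum_i a i * b i.
have A0 : 0 <= A by apply: sumr_ge0 => i _; rewrite sqr_ge0.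
have key : 0 <= A * (A * B - C ^+ 2).
  have : 0 <= \sum_i (A * b i - C * a i) ^+ 2.
    by apply: sumr_ge0 => i _; rewrite sqr_ge0.
  under eq_bigr => i _.
    have -> : (A * b i - C * a i) ^+ 2 =
      A ^+ 2 * b i ^+ 2 - (2 * A * C) * (a i * b i) + C ^+ 2 * a i ^+ 2 by ring.
    over.
  rewrite big_split sumrB /= -!mulr_sumr -/A -/B -/C => h.
  by apply: le_trans h _; rewrite le_eqVlt; apply/orP; left; apply/eqP; ring.
have [A_gt0|A_le0] := ltP 0 A; first by move: key; rewrite pmulr_rge0 // subr_ge0.
have /psumr_eq0P a0 : A = 0 by apply/eqP; rewrite eq_le A_le0.
have -> : C = 0.
  apply: big1 => i _; have /eqP := a0 (fun k _ => sqr_ge0 (a k)) i isT.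
  by rewrite sqrf_eq0 => /eqP ->; rewrite mul0r.
by rewrite expr0n mulr_ge0 // sumr_ge0 // => i _; rewrite sqr_ge0.
Qed.

Lemma dotv_le_nrm n (x y : 'cV[R]_n) : `|dotv x y| <= nrm x * nrm y.
Proof.
rewrite -ler_sqr ?nnegrE ?mulr_ge0 ?nrm_ge0 // exprMn !nrm_sqr.
by rewrite real_normK ?num_real // !dotv_sqr; exact: Cauchy_Schwarz_sum.
Qed.

Lemma nrmD n (x y : 'cV[R]_n) : nrm (x + y) <= nrm x + nrm y.
Proof.
rewrite -ler_sqr ?nnegrE ?addr_ge0 ?nrm_ge0 // nrm_sqr sqrrD !nrm_sqr.
rewrite dotvDl !dotvDr (dotvC y x); have := dotv_le_nrm x y.
by rewrite ler_norml => /andP[_]; rewrite mulr2n; lra.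
Qed.

Lemma nrmZ n a (x : 'cV[R]_n) : nrm (a *: x) = `|a| * nrm x.
Proof.
by rewrite /nrm dotvZl dotvZr mulrA -expr2 sqrtrM ?sqr_ge0 // sqrtr_sqr.
Qed.

Lemma nrmN n (x : 'cV[R]_n) : nrm (- x) = nrm x.
Proof. by rewrite -scaleN1r nrmZ normrN1 mul1r. Qed.

(** An upper bound on the operator norm, kept as a predicate so that no supremum has to be
    handled. *)
Definition opn n (A : 'M[R]_n) (eta : R) := forall x, nrm (A *m x) <= eta * nrm x.

Lemma opnD n (A B : 'M[R]_n) a b : opn A a -> opn B b -> opn (A + B) (a + b).
Proof.
move=> hA hB x; rewrite mulmxDl mulrDl.
exact: le_trans (nrmD _ _) (lerD (hA x) (hB x)).
Qed.

Lemma opnN n (A : 'M[R]_n) a : opn A a -> opn (- A) a.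
Proof. by move=> hA x; rewrite mulNmx nrmN. Qed.

Lemma opn_le n (A : 'M[R]_n) a b : a <= b -> opn A a -> opn A b.
Proof.
by move=> ab hA x; apply: le_trans (hA x) _; rewrite ler_wpM2r ?nrm_ge0.
Qed.

Lemma opn_form n (A : 'M[R]_n) a x : opn A a -> `|dotv x (A *m x)| <= a * dotv x x.
Proof.
move=> hA; apply: le_trans (dotv_le_nrm _ _) _.
rewrite -nrm_sqr expr2 mulrCA ler_wpM2l ?nrm_ge0 //; exact: hA.
Qed.

Lemma opn_entry n (A : 'M[R]_n) k : (forall i j, `|A i j| <= k) -> opn A (n%:R * k).
Proof.
move=> hA x.
have [n0|n0] := posnP n.
  move: A x hA; rewrite {}n0 => A x _.
  by rewrite /nrm /dotv !big_ord0 sqrtr0 mulr0.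
have k0 : 0 <= k by apply: le_trans (hA (Ordinal n0) (Ordinal n0)).
rewrite -ler_sqr ?nnegrE ?mulr_ge0 ?nrm_ge0 // exprMn !nrm_sqr dotv_sqr.
apply: le_trans (_ : \sum_(i < n) n%:R * k ^+ 2 * dotv x x <= _); last first.
  rewrite sumr_const card_ord -mulr_natl le_eqVlt; apply/orP; left; apply/eqP.
  by rewrite exprMn; ring.
apply: ler_sum => i _; rewrite mxE dotv_sqr.
apply: le_trans (Cauchy_Schwarz_sum _ _) _.
rewrite ler_wpM2r ?sumr_ge0 // => [j _|]; first by rewrite sqr_ge0.
apply: le_trans (_ : \sum_(j < n) k ^+ 2 <= _); last first.
  by rewrite sumr_const card_ord mulr_natl.
apply: ler_sum => j _; rewrite -[A i j ^+ 2]real_normK ?num_real //.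
by rewrite ler_sqr ?nnegrE.
Qed.

Lemma opn_diag n (d : 'rV[R]_n) k : (forall i, `|d 0 i| <= k) -> 0 <= k -> opn (diag_mx d) k.
Proof.
move=> hd k0 x; rewrite -ler_sqr ?nnegrE ?mulr_ge0 ?nrm_ge0 // exprMn !nrm_sqr.
rewrite mul_diag_mx !dotv_sqr mulr_sumr; apply: ler_sum => i _.
rewrite mxE exprMn ler_wpM2r ?sqr_ge0 // -[d 0 i ^+ 2]real_normK ?num_real //.
by rewrite ler_sqr ?nnegrE.
Qed.

(** Extending x by zero outside the range of [f] keeps its norm, and dropping the other coordinates
    of the image can only decrease the norm. *)
Lemma opn_mxsub m n (f : 'I_m -> 'I_n) (A : 'M[R]_n) a : injective f ->
  opn A a -> opn (mxsub f f A) a.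
Proof.
move=> injf hA x.
have uf : uniq (codom f) by apply/injectiveP.
have E (F : 'I_n -> R) : (forall j, j \notin codom f -> F j = 0) ->
    \sum_j F j = \sum_i F (f i).
  move=> F0; rewrite (bigID (mem (codom f))) /= [X in _ + X]big1 // addr0.
  by rewrite -big_uniq //= big_image.
pose y : 'cV[R]_n := \col_j (if [pick i | f i == j] is Some i then x i 0 else 0).
have yf i : y (f i) 0 = x i 0.
  rewrite mxE; case: pickP => [i' /eqP /injf -> //|/(_ i)].
  by rewrite eqxx.
have y0 j : j \notin codom f -> y j 0 = 0.
  move=> hj; rewrite mxE; case: pickP => // i /eqP e.
  by rewrite -e codom_f in hj.
have ny : nrm y = nrm x.
  congr Num.sqrt; rewrite /dotv E => [|j /y0 ->]; last by rewrite mulr0.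
  by apply: eq_bigr => i _; rewrite !yf.
rewrite -ny; apply: le_trans (hA y); apply: ler_wsqrtr.
have Ay i : (A *m y) (f i) 0 = (mxsub f f A *m x) i 0.
  rewrite !mxE E => [|j /y0 ->]; last by rewrite mulr0.
  by apply: eq_bigr => j _; rewrite yf mxE.
rewrite /dotv [leRHS](bigID (mem (codom f))) /=.
apply: le_trans (_ : \sum_(j in codom f) (A *m y) j 0 * (A *m y) j 0 <= _); last first.
  by rewrite lerDl sumr_ge0 // => j _; rewrite -expr2 sqr_ge0.
rewrite -big_uniq //= big_image /= le_eqVlt; apply/orP; left; apply/eqP.
by apply: eq_bigr => i _; rewrite Ay.
Qed.

End OperatorNorm.

(** * Courant-Fischer inequalities *)

Section CourantFischer.
Context {R : realType}.

Lemma wide_kernel m n (A : 'M[R]_(m, n)) : (m < n)%N ->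
  exists2 c : 'cV[R]_n, c != 0 & A *m c = 0.
Proof.
move=> mn; have : kermx A^T != 0.
  by rewrite kermx_eq0 /row_free neq_ltn (leq_ltn_trans (rank_leq_col _) mn).
case/rowV0Pn => v /sub_kermxP hv v0; exists v^T.
  by apply: contraNN v0 => /eqP h; rewrite -[v]trmxK h trmx0.
by rewrite -[A]trmxK -trmx_mul hv trmx0.
Qed.

Context n (M P : 'M[R]_n) (lam : seq R).
Context (PP : P^T *m P = 1%:M) (hM : M = P^T *m diag_mx (\row_i lam`_i) *m P).
Context (slam : sorted >=%R lam) (size_lam : size lam = n).

Lemma dotv_isometry x y : dotv (P *m x) (P *m y) = dotv x y.
Proof. by rewrite dotv_mull mulmxA PP mul1mx. Qed.

Lemma spectral_form x : dotv x (M *m x) = \sum_(i < n) lam`_i * (P *m x) i 0 ^+ 2.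
Proof.
rewrite hM -!mulmxA -{1}[P^T]trmxK trmxK dotvC dotv_mull trmxK.
rewrite mul_diag_mx; apply: eq_bigr => i _; rewrite !mxE expr2.
by rewrite -!mulrA.
Qed.

Lemma lam_le (i j : nat) : (i <= j)%N -> (j < n)%N -> lam`_j <= lam`_i.
Proof.
move=> ij jn.
have rt : transitive (>=%R : rel R) by move=> a b c /= h1 h2; exact: le_trans h2 h1.
have rr : reflexive (>=%R : rel R) by move=> a /=; exact: lexx.
have := sorted_leq_nth rt rr 0 slam; move=> /(_ i j); apply => //; rewrite inE size_lam //.
exact: leq_ltn_trans jn.
Qed.

(** The span of the first m + 1 eigenvectors meets the kernel of the m rows of [Z] in a nonzero
    vector, on which the form is at least [lam_m] times the squared norm. The matrix [J] embeds the
    coordinates of that span. *)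
Lemma eigenvalue_le m (Z : 'M[R]_(m, n)) b : (m < n)%N ->
  (forall x, Z *m x = 0 -> dotv x (M *m x) <= b * dotv x x) -> lam`_m <= b.
Proof.
move=> mn hZ.
pose J : 'M[R]_(n, m.+1) := \matrix_(i, j) (i == j :> nat)%:R.
have [c c0 hc] := @wide_kernel m m.+1 (Z *m P^T *m J) (ltnSn m).
have PPT : P *m P^T = 1%:M by apply: mulmx1C.
pose x := P^T *m (J *m c).
have Px : P *m x = J *m c by rewrite /x mulmxA PPT mul1mx.
have xx : dotv x x = dotv c c.
  rewrite -dotv_isometry Px dotv_mull mulmxA.
  suff -> : J^T *m J = 1%:M by rewrite mul1mx.
  apply/matrixP => i j; rewrite !mxE (bigD1 (widen_ord mn i)) //= !mxE /= eqxx mul1r.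
  rewrite big1 ?addr0 // => k; rewrite -val_eqE /= => ki.
  by rewrite !mxE (negPf ki) mul0r.
have Jc0 (i : 'I_n) : (m < i)%N -> (J *m c) i 0 = 0.
  move=> mi; rewrite mxE big1 // => j _; rewrite mxE.
  have -> : (i == j :> nat) = false by apply/eqP => e; have := ltn_ord j; lia.
  by rewrite mul0r.
have := hZ x _; rewrite /x !mulmxA in hc * => /(_ hc).
rewrite -!mulmxA -/x spectral_form => h.
have c1 : 0 < dotv x x by rewrite xx dotv_gt0.
rewrite -(ler_pM2r c1); apply: le_trans h.
rewrite -dotv_isometry dotv_sqr mulr_sumr; apply: ler_sum => i _.
have [im|im] := leqP i m; first by rewrite ler_wpM2r ?sqr_ge0 ?lam_le.
by rewrite Px Jc0 // expr0n !mulr0.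
Qed.

(** Dually, the range of [W] has dimension m + 1 and contains a nonzero vector orthogonal to the
    first m eigenvectors. *)
Lemma eigenvalue_ge m (W : 'M[R]_(n, m.+1)) b : (m < n)%N ->
  (forall c : 'cV_m.+1, W *m c = 0 -> c = 0) ->
  (forall c : 'cV_m.+1, b * dotv (W *m c) (W *m c) <= dotv (W *m c) (M *m (W *m c))) ->
  b <= lam`_m.
Proof.
move=> mn injW hW.
pose J : 'M[R]_(m, n) := \matrix_(i, j) (i == j :> nat)%:R.
have [c c0 hc] := @wide_kernel m m.+1 (J *m P *m W) (ltnSn m).
have Wc0 : W *m c != 0 by apply: contraNN c0 => /eqP /injW ->.
set x := W *m c in Wc0 *.
have x1 : 0 < dotv x x by rewrite dotv_gt0.
have Px (i : 'I_n) : (i < m)%N -> (P *m x) i 0 = 0.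
  move=> im; rewrite -!mulmxA -/x in hc.
  have := congr1 (fun A : 'cV[R]_m => A (Ordinal im) 0) hc.
  rewrite mxE [RHS]mxE (bigD1 i) //= [X in _ + X]big1 => [|k ki].
    by rewrite mxE eqxx mul1r addr0.
  by rewrite mxE /= eq_sym val_eqE (negPf ki) mul0r.
rewrite -(ler_pM2r x1); apply: le_trans (hW c) _; rewrite -/x spectral_form.
rewrite -dotv_isometry dotv_sqr mulr_sumr; apply: ler_sum => i _.
have [im|im] := ltnP i m; first by rewrite Px // expr0n !mulr0.
by rewrite ler_wpM2r ?sqr_ge0 ?lam_le.
Qed.

End CourantFischer.

Section PermutedCirculant.
Context {R : realType}.
Context (gam : R -> R).
Context (gam_per : forall t, gam (t + 2 * pi) = gam t).
Context (gam_even : forall t, gam (- t) = gam t).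

(** The permutation [p] gives the place of each index on the grid; it is known to the proof only,
    not to the algorithm. *)
Definition cvec K (p : 'S_K) (k : nat) : 'cV[R]_K := \col_i cos (k%:R * ang K (p i)).
Definition svec K (p : 'S_K) (k : nat) : 'cV[R]_K := \col_i sin (k%:R * ang K (p i)).
Definition circ_mx K (p : 'S_K) : 'M[R]_K :=
  \matrix_(i, j) gam (ang K (p i) - ang K (p j)).

Lemma sum_perm (V : nmodType) K (p : 'S_K) (F : 'I_K -> V) : \sum_i F (p i) = \sum_i F i.
Proof. by rewrite [RHS](reindex_inj (@perm_inj _ p)). Qed.

Lemma circ_mx_cvec K (p : 'S_K) k : circ_mx p *m cvec p k = eigmu gam K k *: cvec p k.
Proof.
apply/matrixP => i j; rewrite ord1 !mxE.
have := circulant_eigen gam_per gam_even K k (p i) 0; rewrite subr0 => <-.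
under eq_bigr do rewrite !mxE.
rewrite (@sum_perm _ _ p (fun l => gam (ang K (p i) - ang K l) * cos (k%:R * ang K l))).
by under [RHS]eq_bigr do rewrite subr0.
Qed.

Lemma circ_mx_svec K (p : 'S_K) k : circ_mx p *m svec p k = eigmu gam K k *: svec p k.
Proof.
apply/matrixP => i j; rewrite ord1 !mxE.
have := circulant_eigen gam_per gam_even K k (p i) (pi / 2); rewrite cosBpihalf => <-.
under eq_bigr do rewrite !mxE.
rewrite (@sum_perm _ _ p (fun l => gam (ang K (p i) - ang K l) * sin (k%:R * ang K l))).
by under [RHS]eq_bigr do rewrite cosBpihalf.
Qed.

Lemma circ_mx_sym K (p : 'S_K) : (circ_mx p)^T = circ_mx p.
Proof. by apply/matrixP => i j; rewrite !mxE -gam_even opprB. Qed.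

Lemma circ_mx_form K (p : 'S_K) (x : 'cV[R]_K) :
  dotv x (circ_mx p *m x) = quad gam (fun j => x (p^-1%g j) 0).
Proof.
rewrite /dotv /quad -[RHS](sum_perm p); apply: eq_bigr => i _; rewrite permK mxE mulr_sumr.
rewrite -[RHS](sum_perm p); apply: eq_bigr => j _; rewrite permK mxE.
by rewrite mulrAC mulrA.
Qed.

Lemma dotv_perm K (p : 'S_K) (x : 'cV[R]_K) :
  dotv x x = \sum_j x (p^-1%g j) 0 ^+ 2.
Proof. by rewrite dotv_sqr -[RHS](sum_perm p); apply: eq_bigr => i _; rewrite permK. Qed.

Lemma power_perm K (p : 'S_K) (x : 'cV[R]_K) k :
  power k (fun j => x (p^-1%g j) 0) = dotv x (cvec p k) ^+ 2 + dotv x (svec p k) ^+ 2.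
Proof.
rewrite /power; congr (_ ^+ 2 + _ ^+ 2);
  by rewrite -[LHS](sum_perm p); apply: eq_bigr => i _; rewrite permK mxE.
Qed.

Lemma dotv_cc K (p : 'S_K) k l : (l < k)%N -> (k + l < K)%N ->
  dotv (cvec p k) (cvec p l) = 0 :> R.
Proof.
move=> lk klK.
transitivity (\sum_(j < K) (cos ((k + l)%:R * ang K (p j)) + cos ((k - l)%:R * ang K (p j))) / 2 : R).
  apply: eq_bigr => j _; rewrite !mxE natrD natrB 1?ltnW //.
  by rewrite [X in cos X + _]mulrDl [X in _ + cos X]mulrBl cosD cosB; field.
rewrite -mulr_suml big_split /=.
rewrite (@sum_perm _ _ p (fun l0 => cos ((k + l)%:R * ang K l0))).
rewrite (@sum_perm _ _ p (fun l0 => cos ((k - l)%:R * ang K l0))).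
by rewrite !sum_grid_cos ?addr0 ?mul0r //; lia.
Qed.

Lemma dotv_cs K (p : 'S_K) k l : (l <= k)%N -> dotv (cvec p k) (svec p l) = 0 :> R.
Proof.
move=> lk.
transitivity (\sum_(j < K) (sin ((k + l)%:R * ang K (p j)) - sin ((k - l)%:R * ang K (p j))) / 2 : R).
  apply: eq_bigr => j _; rewrite !mxE natrD natrB //.
  by rewrite [X in sin X - _]mulrDl [X in _ - sin X]mulrBl sinD sinB; field.
rewrite -mulr_suml sumrB.
rewrite (@sum_perm _ _ p (fun l0 => sin ((k + l)%:R * ang K l0))).
rewrite (@sum_perm _ _ p (fun l0 => sin ((k - l)%:R * ang K l0))).
by rewrite !sum_grid_sin subr0 mul0r.
Qed.

Lemma dotv_1s K (p : 'S_K) l : dotv (cvec p 0) (svec p l) = 0 :> R.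
Proof.
transitivity (\sum_(j < K) sin (l%:R * ang K (p j)) : R).
  by apply: eq_bigr => j _; rewrite !mxE mul0r cos0 mul1r.
by rewrite (@sum_perm _ _ p (fun l0 => sin (l%:R * ang K l0))) sum_grid_sin.
Qed.

Lemma dotv_11 K (p : 'S_K) : dotv (cvec p 0) (cvec p 0) = K%:R :> R.
Proof.
rewrite /dotv; under eq_bigr do rewrite !mxE mul0r cos0 mul1r.
by rewrite sumr_const card_ord.
Qed.

Lemma dotv_c1 K (p : 'S_K) : (2 < K)%N -> dotv (cvec p 1) (cvec p 1) = K%:R / 2 :> R.
Proof.
move=> K2; have := sum_grid_dot2 (cis (0 : R)) K2.
rewrite dot2_cis subrr cos0 mulr1 -[X in X = _](sum_perm p) => <-.
apply: eq_bigr => j _; rewrite !mxE mul1r -expr2; congr (_ ^+ 2).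
by rewrite dot2_cis sub0r cosN.
Qed.

Lemma dotv_s1 K (p : 'S_K) : (2 < K)%N -> dotv (svec p 1) (svec p 1) = K%:R / 2 :> R.
Proof.
move=> K2; have := sum_grid_dot2 (cis (pi / 2 : R)) K2.
rewrite dot2_cis subrr cos0 mulr1 -[X in X = _](sum_perm p) => <-.
apply: eq_bigr => j _; rewrite !mxE mul1r -expr2; congr (_ ^+ 2).
by rewrite dot2_cis -cosN opprB cosBpihalf.
Qed.

Lemma cvec_gt0 K (p : 'S_K) k : (0 < K)%N -> (0 : R) < dotv (cvec p k) (cvec p k).
Proof.
move=> K0; rewrite dotv_sqr (bigD1 (p^-1%g (Ordinal K0))) //= ltr_pwDl //.
  by rewrite mxE permKV ang0 mulr0 cos0 expr1n.
by apply: sumr_ge0 => i _; rewrite sqr_ge0.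
Qed.

End PermutedCirculant.

Section EigenvaluePerturbation.
Context {R : realType} (n : nat) (M G P : 'M[R]_n) (lam : seq R) (eta : R).
Context (PP : P^T *m P = 1%:M) (hM : M = P^T *m diag_mx (\row_i lam`_i) *m P).
Context (slam : sorted >=%R lam) (size_lam : size lam = n).
Context (hMG : opn (M - G) eta).

Lemma form_perturb x : `|dotv x (M *m x) - dotv x (G *m x)| <= eta * dotv x x.
Proof. by rewrite -dotvNr -dotvDr -mulmxBl; apply: opn_form. Qed.

Lemma eigenvalue_perturb_le m (Z : 'M[R]_(m, n)) b : (m < n)%N ->
  (forall x, Z *m x = 0 -> dotv x (G *m x) <= b * dotv x x) -> lam`_m <= b + eta.
Proof.
move=> mn h; apply: (eigenvalue_le PP hM slam size_lam mn (Z := Z)) => x /h hx.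
by have := form_perturb x; rewrite ler_norml; lra.
Qed.

(** On the span of orthogonal eigenvectors of [G] the form of [G] is diagonal, hence at least [b]
    times the squared norm. *)
Lemma eigenvalue_perturb_ge m (w : 'I_m.+1 -> 'cV[R]_n) (nu : 'I_m.+1 -> R) b :
  (m < n)%N -> (forall a, 0 < dotv (w a) (w a)) ->
  (forall a a', a != a' -> dotv (w a) (w a') = 0) ->
  (forall a, G *m w a = nu a *: w a) -> (forall a, b <= nu a) ->
  b - eta <= lam`_m.
Proof.
move=> mn w0 wo Gw bnu.
pose W := \matrix_(i < n, a < m.+1) w a i 0.
pose d := \row_a dotv (w a) (w a).
have WW : W^T *m W = diag_mx d.
  apply/matrixP => a a'; rewrite !mxE.
  have [->|ne] := eqVneq a a'.
    by rewrite mulr1n; apply: eq_bigr => i _; rewrite !mxE.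
  by rewrite mulr0n; apply: etrans (wo _ _ ne); apply: eq_bigr => i _; rewrite !mxE.
have GW : G *m W = W *m diag_mx (\row_a nu a).
  apply/matrixP => i a; rewrite mul_mx_diag !mxE.
  have := congr1 (fun A : 'cV[R]_n => A i 0) (Gw a); rewrite !mxE mulrC => <-.
  by apply: eq_bigr => j _; rewrite !mxE.
have nW (c : 'cV_m.+1) : dotv (W *m c) (W *m c) = \sum_a d 0 a * c a 0 ^+ 2.
  rewrite dotv_mull mulmxA WW mul_diag_mx; apply: eq_bigr => a _.
  by rewrite !mxE; ring.
have fW (c : 'cV_m.+1) : dotv (W *m c) (G *m (W *m c)) = \sum_a nu a * (d 0 a * c a 0 ^+ 2).
  rewrite dotv_mull [G *m _]mulmxA GW -mulmxA [W^T *m _]mulmxA WW mul_diag_mx mul_diag_mx.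
  by apply: eq_bigr => a _; rewrite !mxE; ring.
apply: (eigenvalue_ge PP hM slam size_lam mn (W := W)).
  move=> c /(congr1 (fun x => dotv x x)); rewrite nW dotv0l => h.
  have d0 a : 0 <= d 0 a * c a 0 ^+ 2 by rewrite mulr_ge0 ?sqr_ge0 // mxE ltW.
  apply/matrixP => a j; rewrite ord1 mxE; apply/eqP.
  have /psumr_eq0P H := h; have /eqP := H (fun a _ => d0 a) a isT.
  by rewrite mulf_eq0 mxE gt_eqF //= sqrf_eq0.
move=> c; have := form_perturb (W *m c).
suff : b * dotv (W *m c) (W *m c) <= dotv (W *m c) (G *m (W *m c)).
  by rewrite ler_norml; lra.
rewrite fW nW mulr_sumr; apply: ler_sum => a _.
by rewrite ler_wpM2r // mulr_ge0 ?sqr_ge0 // mxE ltW.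
Qed.

End EigenvaluePerturbation.

Lemma sorted_eigenvaluesP (R : realType) n (M : 'M[R]_n) lam :
  M^T = M -> sorted_eigenvalues M lam ->
  exists P : 'M[R]_n, [/\ P^T *m P = 1%:M, M = P^T *m diag_mx (\row_i lam`_i) *m P
    & size lam = n].
Proof.
move=> sM [slam cM]; have [P [PP hM]] := spectral_theorem sM cM.
exists P; split => //.
by have := size_char_poly M; rewrite cM size_prod_XsubC => -[].
Qed.

(** * Spectral gaps in the Fourier basis *)

Lemma cos_lip (R : realType) (s t : R) : `|cos s - cos t| <= `|s - t|.
Proof.
apply: le_trans (dcirc_cis_le s t).
apply: le_trans (chord_le_dcirc (circle_cis s) (circle_cis t)).
rewrite norm2_R2E -sqrtr_sqr ler_wsqrtr // /dot2 !mxE -!expr2 /=.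
by rewrite lerDl sqr_ge0.
Qed.

Section SpectralGap.
Context {R : realType}.
Context (gam : R -> R) (ce rr : R).
Context (gam_per : forall t, gam (t + 2 * pi) = gam t).
Context (gam_even : forall t, gam (- t) = gam t).
Context (gam01 : forall t, 0 <= gam t <= 1).

Local Notation mu := (eigmu gam).

(* The two gaps of F force 1, cos and sin to carry the three largest Fourier eigenvalues. *)
Section FullSample.
Context (n : nat) (F : 'M[R]_n) (p : 'S_n) (lam : seq R) (E0 cb : R).
Context (n8 : (8 <= n)%N).
Context (sF : F^T = F) (hlam : sorted_eigenvalues F lam).
Context (hF : opn (F - circ_mx gam p) (E0 * n%:R * rr)).
Let triple (a : 'I_3) : 'cV[R]_n :=
  if a == 0 :> nat then cvec p 0 else if a == 1%N :> nat then cvec p 1 else svec p 1.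

Lemma lam2_ge : mu n 1 - E0 * n%:R * rr <= lam`_2.
Proof.
have [P [PP hM sz]] := sorted_eigenvaluesP sF hlam.
have n2 : (2 < n)%N by apply: leq_trans n8.
have n00 : (0 < n)%N by apply: leq_trans n8.
have nR : (0 : R) < n%:R by rewrite ltr0n.
apply: (@eigenvalue_perturb_ge _ _ _ _ _ _ _ PP hM hlam.1 sz hF 2 triple
  (fun a => if a == 0 :> nat then mu n 0 else mu n 1)) => //.
- case=> [[|[|[|//]]]] Hi; rewrite /triple /=.
  + by rewrite dotv_11.
  + by rewrite dotv_c1 // divr_gt0.
  + by rewrite dotv_s1 // divr_gt0.
- have cc : dotv (cvec p 1) (cvec p 0) = 0 :> R by rewrite dotv_cc //; lia.
  have cs : dotv (cvec p 1) (svec p 1) = 0 :> R by rewrite dotv_cs.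
  have c1s := @dotv_1s R _ p 1.
  case=> [[|[|[|//]]]] Hi [[|[|[|//]]]] Hj; rewrite /triple -val_eqE //= => _ //.
  + by rewrite dotvC.
  + by rewrite dotvC.
  + by rewrite dotvC.
- case=> [[|[|[|//]]]] Hi; rewrite /triple /=.
  + by rewrite circ_mx_cvec.
  + by rewrite circ_mx_cvec.
  + by rewrite circ_mx_svec.
- by move=> a; case: ifP => // _; apply: eigmu_le_mu0.
Qed.

Lemma lam0_le : lam`_0 <= mu n 0 + E0 * n%:R * rr.
Proof.
have [P [PP hM sz]] := sorted_eigenvaluesP sF hlam.
apply: (@eigenvalue_perturb_le _ _ _ _ _ _ _ PP hM hlam.1 sz hF 0 (0 : 'M[R]_(0, n))).
  by apply: leq_trans n8.
move=> x _; rewrite circ_mx_form (dotv_perm p).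
by apply: quad_le => // k; right; apply: eigmu_le_mu0.
Qed.

Context (gam_mono : forall s t : R, 0 <= s -> s <= t -> t <= pi -> gam t <= gam s + ce * rr).
Context (n_even : ~~ odd n).

Let hn : n = (2 * n./2)%N. Proof. by rewrite mul2n even_halfK. Qed.
Let h0 : (0 < n./2)%N. Proof. by move: n8; lia. Qed.

Lemma eigmu1_max k : (0 < k < n)%N -> mu n k <= mu n 1 + 2 * n%:R * (ce * rr).
Proof. by rewrite hn => kn; apply: eigmu_le_mu1. Qed.

Lemma quad_mean0 (y : 'I_n -> R) : power 0 y = 0 ->
  quad gam y <= (mu n 1 + 2 * n%:R * (ce * rr)) * \sum_j y j ^+ 2.
Proof.
move=> y0; apply: quad_le => // k.
have [k0|k0] := posnP k; first by left; rewrite k0.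
by right; apply: eigmu1_max; rewrite k0 ltn_ord.
Qed.

Lemma lam1_le : lam`_1 <= mu n 1 + 2 * n%:R * (ce * rr) + E0 * n%:R * rr.
Proof.
have [P [PP hM sz]] := sorted_eigenvaluesP sF hlam.
apply: (@eigenvalue_perturb_le _ _ _ _ _ _ _ PP hM hlam.1 sz hF 1 (cvec p 0)^T).
  by apply: leq_trans n8.
move=> x hx; rewrite circ_mx_form (dotv_perm p).
apply: quad_mean0; rewrite power_perm.
have -> : dotv x (cvec p 0) = 0 by rewrite dotvC dotvE hx mxE.
suff -> : dotv x (svec p 0) = 0 by rewrite expr0n addr0.
by apply: big1 => i _; rewrite mxE mul0r sin0 mulr0.
Qed.

(** The test space is spanned by the constants, cos, sin and the cosine at frequency k; as k <= n /
    2, the sum k + 1 stays below n and these vectors are orthogonal. The minimum appears because the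
    order of the two eigenvalues is not known yet. *)
Lemma lam3_ge k : (1 < k <= n./2)%N ->
  Num.min (mu n k) (mu n 1) - E0 * n%:R * rr <= lam`_3.
Proof.
move=> kn.
have [P [PP hM sz]] := sorted_eigenvaluesP sF hlam.
have n2 : (2 < n)%N by apply: leq_trans n8.
have n00 : (0 < n)%N by apply: leq_trans n8.
have nR : (0 : R) < n%:R by rewrite ltr0n.
pose w (a : 'I_4) : 'cV[R]_n :=
  if a == 3 :> nat then cvec p k else if a == 0 :> nat then cvec p 0 else
  if a == 1%N :> nat then cvec p 1 else svec p 1.
apply: (@eigenvalue_perturb_ge _ _ _ _ _ _ _ PP hM hlam.1 sz hF 3 w
  (fun a => if a == 3 :> nat then mu n k else if a == 0 :> nat then mu n 0 else mu n 1)).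
- by apply: leq_trans n8.
- case=> [[|[|[|[|//]]]]] Hi; rewrite /w /=.
  + by rewrite dotv_11.
  + by rewrite dotv_c1 // divr_gt0.
  + by rewrite dotv_s1 // divr_gt0.
  + exact: cvec_gt0.
- have cc : dotv (cvec p 1) (cvec p 0) = 0 :> R by rewrite dotv_cc //; lia.
  have cs : dotv (cvec p 1) (svec p 1) = 0 :> R by rewrite dotv_cs.
  have c1s := @dotv_1s R _ p 1.
  have k0 : dotv (cvec p k) (cvec p 0) = 0 :> R by rewrite dotv_cc //; move: hn; lia.
  have k1 : dotv (cvec p k) (cvec p 1) = 0 :> R by rewrite dotv_cc //; move: hn n8; lia.
  have ks : dotv (cvec p k) (svec p 1) = 0 :> R by rewrite dotv_cs //; lia.
  by case=> [[|[|[|[|//]]]]] Hi [[|[|[|[|//]]]]] Hj; rewrite /w -val_eqE //= => _;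
    rewrite // dotvC.
- case=> [[|[|[|[|//]]]]] Hi; rewrite /w /=.
  + by rewrite circ_mx_cvec.
  + by rewrite circ_mx_cvec.
  + by rewrite circ_mx_svec.
  + by rewrite circ_mx_cvec.
- move=> a; case: ifP => _; first by rewrite ge_min lexx.
  have : Num.min (mu n k) (mu n 1) <= mu n 1 by rewrite ge_min lexx orbT.
  by case: ifP => // _ h; apply: le_trans h _; exact: eigmu_le_mu0.
Qed.

Context (gap1 : cb * n%:R <= lam`_0 - lam`_1) (gap2 : cb * n%:R <= lam`_2 - lam`_3).
Context (hcb : (2 * ce + 2 * E0) * rr < cb).

(** The first gap separates [lam_0] from [lam_1], and [lam_1 >= lam_2], which is bounded below by
    the test space of 1, cos and sin. *)
Lemma eigmu_gap0 : cb * n%:R - 2 * (E0 * n%:R * rr) <= mu n 0 - mu n 1.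
Proof.
have [P [PP hM sz]] := sorted_eigenvaluesP sF hlam.
have h21 : lam`_2 <= lam`_1.
  by apply: (lam_le hlam.1 sz) => //; apply: leq_trans n8.
by have := lam0_le; have := lam2_ge; have := gap1; lra.
Qed.

(** If the minimum in [lam3_ge] were [mu n 1], the eigenvalue [lam_3] would be so close to
    [lam_1 >= lam_2] that, by [hcb], the second gap would fail. So the minimum is [mu n k], and the
    gap bounds it. Frequencies above n / 2 fold back. *)
Lemma eigmu_gap1 k : (1 < k < n.-1)%N ->
  mu n k <= mu n 1 - cb * n%:R + 2 * n%:R * (ce * rr) + 2 * (E0 * n%:R * rr).
Proof.
move=> kn.
wlog kh : k kn / (k <= n./2)%N.
  move=> H; have [|hk] := leqP k n./2; first exact: H.
  rewrite -eigmu_sym; last by lia.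
  by apply: H; move: hn; lia.
have [P [PP hM sz]] := sorted_eigenvaluesP sF hlam.
have h21 : lam`_2 <= lam`_1.
  by apply: (lam_le hlam.1 sz) => //; apply: leq_trans n8.
have nR : (0 : R) < n%:R by rewrite ltr0n; apply: leq_trans n8.
have hl1 := lam1_le.
have hl3 : Num.min (mu n k) (mu n 1) - E0 * n%:R * rr <= lam`_3 by apply: lam3_ge; lia.
have h : (2 * ce + 2 * E0) * rr * n%:R < cb * n%:R by rewrite ltr_pM2r.
by move: hl3 gap2; rewrite /Order.min; case: ltP; lra.
Qed.

End FullSample.

End SpectralGap.

(** * Transfer of the gaps from n grid points to n / 4 *)

Section Decimation.
Context {R : realType}.
Context (gam : R -> R) (cL ce rr E0 cb : R) (N : nat).
Context (gam_per : forall t, gam (t + 2 * pi) = gam t).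
Context (gam_even : forall t, gam (- t) = gam t).
Context (gam01 : forall t, 0 <= gam t <= 1).
Context (gam_lip : forall s t : R, `|gam s - gam t| <= cL * `|s - t| + ce * rr).
Context (cL0 : 0 <= cL) (ce0 : 0 <= ce) (rr0 : 0 <= rr).
Context (N8 : (8 <= N)%N).
Local Notation n := (N * 4)%N.
Context (hrr : 1 <= n%:R * rr).
Local Notation mu := (eigmu gam).
Context (mu1_max : forall k, (0 < k < n)%N -> mu n k <= mu n 1 + 2 * n%:R * (ce * rr)).
Context (mu_gap0 : cb * n%:R - 2 * (E0 * n%:R * rr) <= mu n 0 - mu n 1).
Context (mu_gap1 : forall k, (1 < k < n.-1)%N ->
  mu n k <= mu n 1 - cb * n%:R + 2 * n%:R * (ce * rr) + 2 * (E0 * n%:R * rr)).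

(** A block of four fine grid points spans the angle 6 pi / n <= 24 rate, by pi <= 4 and 1 <= n
    rate. Over it [gam] varies by at most (24 cL + ce) rate; the last 24 is the variation of the
    cosine. *)
Definition lip_const : R := 24 * cL + ce + 24.

Let n0 : (0 < n)%N. Proof. by rewrite muln_gt0; move: N8; case: (N). Qed.
Let nR : (0 : R) < n%:R. Proof. by rewrite ltr0n. Qed.

Lemma ang_block i : ang n i = ang N (i %/ 4) + ang n (i %% 4) :> R.
Proof.
rewrite {1}(divn_eq i 4) angD; congr (_ + _).
rewrite /ang !natrM; field.
by rewrite pnatr_eq0; move: N8; case: (N).
Qed.

Lemma ang_rem_le (a : nat) : (a < 4)%N -> (0 : R) <= ang n a <= 24 * rr.
Proof.
move=> a4; rewrite ang_ge0 /=.
apply: le_trans (_ : ang n 3 <= _); first exact: ler_ang.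
rewrite /ang ler_pdivrMr // -mulrA.
have p4 : pi <= 4 :> R by have := pihalf_lt2 R; lra.
have := hrr; lra.
Qed.

Lemma ang_block_dist i : `|ang n i - ang N (i %/ 4) : R| <= 24 * rr.
Proof.
rewrite ang_block addrC addKr.
have /andP[h1 h2] := @ang_rem_le (i %% 4) (ltn_pmod _ (isT : (0 < 4)%N)).
by rewrite ger0_norm.
Qed.

(** A function of all naturals, as [sum_blocks] requires; the default 0 is never read, since i %/ 4
    < N for i < n. *)
Let nat_ext (y : 'I_N -> R) (m : nat) : R := oapp y 0 (insub m).

Let nat_extE y (j : 'I_N) : nat_ext y j = y j.
Proof. by rewrite /nat_ext valK. Qed.

Let lift_fun (y : 'I_N -> R) (i : 'I_n) : R := nat_ext y (i %/ 4).

Let sum_lift (F : nat -> R) : \sum_(i < n) F (i %/ 4)%N = 4 * \sum_(j < N) F j.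
Proof.
rewrite (@sum_blocks R N 4 (fun j _ => F j)) mulr_sumr; apply: eq_bigr => j _.
by rewrite sumr_const card_ord mulr_natl.
Qed.

Lemma sqsum_lift y : \sum_i lift_fun y i ^+ 2 = 4 * \sum_j y j ^+ 2.
Proof.
rewrite (sum_lift (fun m => nat_ext y m ^+ 2)).
by congr (_ * _); apply: eq_bigr => j _; rewrite nat_extE.
Qed.

(** Each pair of coarse points gives 16 pairs of fine ones. Replacing the coarse angles by the fine
    ones changes each kernel value by at most (24 cL + ce) rate, and the Cauchy-Schwarz inequality
    bounds the sum of these errors. *)
Lemma quad_lift y :
  16 * quad gam y <= quad gam (lift_fun y) +
     (24 * cL + ce) * rr * n%:R * (4 * \sum_j y j ^+ 2).
Proof.
have e : 16 * quad gam y = \sum_(i < n) \sum_(i' < n) lift_fun y i * lift_fun y i' *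
    gam (ang N (i %/ 4) - ang N (i' %/ 4)).
  rewrite (sum_lift (fun m => \sum_(i' < n) nat_ext y m * lift_fun y i' *
    gam (ang N m - ang N (i' %/ 4)))).
  have -> : 16 * quad gam y = 4 * \sum_(i < N) 4 * \sum_(j < N) y i * y j * gam (ang N i - ang N j).
    by rewrite -mulr_sumr mulrA; congr (_ * _); ring.
  congr (_ * _); apply: eq_bigr => i _; rewrite (sum_lift (fun m' => nat_ext y i *
    nat_ext y m' * gam (ang N i - ang N m'))); congr (_ * _).
  by apply: eq_bigr => j _; rewrite !nat_extE.
rewrite e -lerBlDl -sumrB -sqsum_lift.
set kap := (24 * cL + ce) * rr.
have kap0 : 0 <= kap by rewrite mulr_ge0 // addr_ge0 // mulr_ge0.
apply: le_trans (_ : \sum_(i < n) \sum_(i' < n) kap * (`|lift_fun y i| * `|lift_fun y i'|) <= _).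
  apply: ler_sum => i _; rewrite -sumrB; apply: ler_sum => i' _.
  rewrite -mulrBr; apply: le_trans (ler_norm _) _.
  rewrite !normrM mulrC ler_wpM2r ?mulr_ge0 //.
  apply: le_trans (gam_lip _ _) _.
  rewrite (ang_block i) (ang_block i').
  have := @ang_rem_le (i %% 4) (ltn_pmod _ (isT : (0 < 4)%N)).
  have := @ang_rem_le (i' %% 4) (ltn_pmod _ (isT : (0 < 4)%N)).
  set a := ang n _; set b := ang n (i %% 4) => /andP[a0 a1] /andP[b0 b1].
  have h : `|ang N (i %/ 4) - ang N (i' %/ 4) - (ang N (i %/ 4) + b - (ang N (i' %/ 4) + a))|
     <= 24 * rr by rewrite ler_norml; apply/andP; split; lra.
  by have := ler_wpM2l cL0 h; rewrite /kap; lra.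
have -> : \sum_(i < n) \sum_(i' < n) kap * (`|lift_fun y i| * `|lift_fun y i'|) =
    kap * (\sum_(i < n) `|lift_fun y i| * 1) ^+ 2.
  rewrite expr2 big_distrl mulr_sumr; apply: eq_bigr => i _ /=.
  by rewrite big_distrr mulr_sumr; apply: eq_bigr => i' _ /=; rewrite !mulr1.
rewrite -mulrA ler_wpM2l //.
apply: le_trans (Cauchy_Schwarz_sum _ _) _.
rewrite [X in _ * X](_ : _ = n%:R); last first.
  by under eq_bigr do rewrite expr1n; rewrite sumr_const card_ord.
rewrite mulrC ler_wpM2l // le_eqVlt; apply/orP; left; apply/eqP.
by apply: eq_bigr => i _; rewrite real_normK ?num_real.
Qed.

Lemma power_lift0 y : \sum_j y j = 0 -> power 0 (lift_fun y) = 0.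
Proof.
move=> y0; rewrite /power.
have -> : \sum_(j < n) lift_fun y j * cos (0%:R * ang n j) = 0.
  under eq_bigr do rewrite mul0r cos0 mulr1.
  rewrite (sum_lift (nat_ext y)); under eq_bigr do rewrite nat_extE.
  by rewrite y0 mulr0.
by rewrite big1 ?expr0n ?addr0 // => j _; rewrite mul0r sin0 mulr0.
Qed.

(** By the addition formulas, the fine coefficients at frequency 1 are combinations of the coarse
    cosine and sine coefficients, with factors that depend only on the place r in the block. *)
Lemma power_lift1 y : power 1 y = 0 -> power 1 (lift_fun y) = 0.
Proof.
move/eqP; rewrite /power paddr_eq0 ?sqr_ge0 // !sqrf_eq0 => /andP[/eqP hc /eqP hs].
have H (F : nat -> R -> R) : \sum_(i < n) lift_fun y i * F (i %% 4)%N (ang N (i %/ 4)) =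
    \sum_(r < 4) \sum_(j < N) y j * F r (ang N j).
  rewrite (@sum_blocks R N 4 (fun j r => nat_ext y j * F r (ang N j))) exchange_big.
  by apply: eq_bigr => r _; apply: eq_bigr => j _; rewrite nat_extE.
have -> : \sum_(j < n) lift_fun y j * cos (1%:R * ang n j) = 0.
  under eq_bigr do rewrite mul1r ang_block.
  rewrite (H (fun r t => cos (t + ang n r))) big1 // => r _.
  transitivity (cos (ang n r) * (\sum_(j < N) y j * cos (1%:R * ang N j)) -
     sin (ang n r) * (\sum_(j < N) y j * sin (1%:R * ang N j))).
    rewrite !mulr_sumr -sumrB; apply: eq_bigr => j _; rewrite cosD !mul1r.
    by ring.
  by rewrite hc hs !mulr0 subr0.
have -> : \sum_(j < n) lift_fun y j * sin (1%:R * ang n j) = 0.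
  under eq_bigr do rewrite mul1r ang_block.
  rewrite (H (fun r t => sin (t + ang n r))) big1 // => r _.
  transitivity (cos (ang n r) * (\sum_(j < N) y j * sin (1%:R * ang N j)) +
     sin (ang n r) * (\sum_(j < N) y j * cos (1%:R * ang N j))).
    rewrite !mulr_sumr -big_split; apply: eq_bigr => j _ /=; rewrite sinD !mul1r.
    by ring.
  by rewrite hc hs !mulr0 addr0.
by rewrite expr0n addr0.
Qed.

(** Frequency n - 1 is frequency -1. It is excluded from [mu_gap1] just as frequency 1 is, so a
    lifted vector must be shown to have no component there. *)
Lemma power_pred (y : 'I_n -> R) : power n.-1 y = power 1 y.
Proof.
have E (j : nat) : n.-1%:R * ang n j = - (1%:R * ang n j) + j%:R * (2 * pi) :> R.
  rewrite -subn1 natrB // mulrBl -[n%:R * _]angM [(_ * j)%N]mulnC angM angKK //.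
  by rewrite addrC.
rewrite /power; congr (_ + _).
  congr (_ ^+ 2); apply: eq_bigr => j _; congr (_ * _).
  rewrite E (@periodic2pi_nat _ cos) ?cosN // => t.
  by rewrite mulr_natl cosD2pi.
rewrite -sqrrN -sumrN; congr (_ ^+ 2); apply: eq_bigr => j _; rewrite -mulrN; congr (_ * _).
rewrite E (@periodic2pi_nat _ sin) ?sinN ?opprK // => t.
by rewrite mulr_natl sinD2pi.
Qed.

Lemma eigmu_decimate k : (k <= 1)%N -> `|mu n k - 4 * mu N k| <= lip_const * n%:R * rr.
Proof.
move=> k1.
rewrite -(sum_lift (fun m => gam (ang N m) * cos (k%:R * ang N m))) -sumrB.
apply: le_trans (ler_norm_sum _ _ _) _.
have -> : lip_const * n%:R * rr = \sum_(i < n) lip_const * rr.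
  by rewrite sumr_const card_ord -mulr_natl; ring.
apply: ler_sum => i _.
have h := ang_block_dist i.
have hg := gam_lip (ang n i) (ang N (i %/ 4)).
have hc := cos_lip (k%:R * ang n i : R) (k%:R * ang N (i %/ 4)).
have hk : `|k%:R * ang n i - k%:R * ang N (i %/ 4)| <= 24 * rr.
  rewrite -mulrBr normrM; apply: le_trans h; rewrite -[leRHS]mul1r.
  by rewrite ler_wpM2r // ger0_norm ?ler0n // (ler_nat _ _ 1).
set a := gam _ in hg *; set b := gam (ang N _) in hg *.
set c := cos _ in hc *; set d := cos (_ * ang N _) in hc *.
have -> : a * c - b * d = (a - b) * c + b * (c - d) by ring.
apply: le_trans (ler_normD _ _) _; rewrite !normrM.
have h1 : `|a - b| * `|c| <= (cL * (24 * rr) + ce * rr) * 1.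
  apply: ler_pM => //; last exact: cos_max.
  by apply: le_trans hg _; rewrite lerD2r ler_wpM2l.
have h2 : `|b| * `|c - d| <= 1 * (24 * rr).
  apply: ler_pM => //; last by apply: le_trans hc hk.
  by have := gam01 (ang N (i %/ 4)); rewrite -/b ler_norml; lra.
by rewrite /lip_const; lra.
Qed.

Let NR : (0 : R) < N%:R. Proof. by rewrite ltr0n; move: N8; case: (N). Qed.
Let nN : n%:R = 4 * N%:R :> R. Proof. by rewrite natrM mulrC. Qed.

Lemma eigmu_gap_decimate : cb * N%:R - (2 * E0 + 2 * lip_const) * N%:R * rr <= mu N 0 - mu N 1.
Proof.
have := @eigmu_decimate 0 isT; have := @eigmu_decimate 1 isT; have := mu_gap0.
by rewrite nN !ler_norml => g /andP[h1 h2] /andP[h3 h4]; lra.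
Qed.

Lemma quad_decimate_le (y : 'I_N -> R) m :
  (forall k : 'I_n, power k (lift_fun y) = 0 \/ mu n k <= m) ->
  quad gam y <= (m / 4 + lip_const * N%:R * rr) * \sum_j y j ^+ 2.
Proof.
move=> /quad_le -/(_ gam_per gam_even); rewrite sqsum_lift => h1.
have h2 := quad_lift y; move: h1 h2; rewrite nN /lip_const.
have : 0 <= \sum_j y j ^+ 2 by apply: sumr_ge0 => j _; rewrite sqr_ge0.
set S := \sum_j _ => S0.
have : 0 <= N%:R * rr * S by rewrite !mulr_ge0 // ltW.
by lra.
Qed.

Context (p : 'S_N).

Lemma decimated_form_mean0 x : dotv x (cvec p 0) = 0 ->
  dotv x (circ_mx gam p *m x) <= (mu N 1 + 4 * lip_const * N%:R * rr) * dotv x x.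
Proof.
move=> x0; rewrite circ_mx_form (dotv_perm p).
set y := fun j => _.
have y0 : \sum_j y j = 0.
  rewrite -(sum_perm p) -[RHS]x0; apply: eq_bigr => i _.
  by rewrite /y permK mxE mul0r cos0 mulr1.
have := @quad_decimate_le y (mu n 1 + 2 * n%:R * (ce * rr)).
move=> /(_ _) h; apply: le_trans (h _) _ => [k|].
  have [k0|k0] := posnP k; first by left; rewrite k0; apply: power_lift0.
  by right; apply: mu1_max; rewrite k0 ltn_ord.
rewrite ler_wpM2r //; first by apply: sumr_ge0 => j _; rewrite sqr_ge0.
have := @eigmu_decimate 1 isT; rewrite nN ler_norml => /andP[h1 h2].
have : 0 <= N%:R * rr by rewrite mulr_ge0 // ltW.
have : 0 <= N%:R * rr * cL by rewrite !mulr_ge0 // ltW.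
have : 0 <= N%:R * rr * ce by rewrite !mulr_ge0 // ltW.
by rewrite /lip_const in h2 *; lra.
Qed.

Lemma decimated_form_gap x : dotv x (cvec p 0) = 0 -> dotv x (cvec p 1) = 0 ->
    dotv x (svec p 1) = 0 ->
  dotv x (circ_mx gam p *m x) <=
  (mu N 1 - (cb * N%:R - (4 * lip_const + 2 * E0) * N%:R * rr)) * dotv x x.
Proof.
move=> x0 xc xs; rewrite circ_mx_form (dotv_perm p).
set y := fun j => _.
have y0 : \sum_j y j = 0.
  rewrite -(sum_perm p) -[RHS]x0; apply: eq_bigr => i _.
  by rewrite /y permK mxE mul0r cos0 mulr1.
have y1 : power 1 y = 0 by rewrite power_perm xc xs expr0n addr0.
have := @quad_decimate_le y
  (mu n 1 - cb * n%:R + 2 * n%:R * (ce * rr) + 2 * (E0 * n%:R * rr)).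
move=> /(_ _) h; apply: le_trans (h _) _ => [k|].
  have [k0|k0] := posnP k; first by left; rewrite k0; apply: power_lift0.
  have [k1|k1] := eqVneq (k : nat) 1%N; first by left; rewrite k1; apply: power_lift1.
  have [kn|kn] := eqVneq (k : nat) n.-1.
    by left; rewrite kn power_pred; apply: power_lift1.
  right; apply: mu_gap1; move: k0 k1 kn (ltn_ord k); clear; lia.
rewrite ler_wpM2r //; first by apply: sumr_ge0 => j _; rewrite sqr_ge0.
have := @eigmu_decimate 1 isT; rewrite nN ler_norml => /andP[h1 h2].
have : 0 <= N%:R * rr by rewrite mulr_ge0 // ltW.
have : 0 <= N%:R * rr * cL by rewrite !mulr_ge0 // ltW.
have : 0 <= N%:R * rr * ce by rewrite !mulr_ge0 // ltW.
by rewrite /lip_const in h2 *; lra.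
Qed.

Section Eigenvectors.
Context (M : 'M[R]_N) (lam : seq R) (E1 : R).
Context (sM : M^T = M) (hlam : sorted_eigenvalues M lam).
Context (E10 : 0 <= E1) (hM : opn (M - circ_mx gam p) (E1 * N%:R * rr)).
Context (hcb : (4 * lip_const + 2 * E0) * rr <= cb / 2) (cb0 : 0 < cb).

(** Both eigenvalues lie between two bounds: the test space of 1, cos and sin from below, and the
    form on mean-zero vectors from above. *)
Lemma decimated_lam (j : nat) : (0 < j < 3)%N ->
  `|lam`_j - mu N 1| <= (4 * lip_const + E1) * N%:R * rr.
Proof.
move=> j3; have [P [PP hMP sz]] := sorted_eigenvaluesP sM hlam.
have /andP[j0 j2] := j3; have N2 : (2 < N)%N by apply: leq_trans N8.
have hj2 : lam`_2 <= lam`_j by apply: (lam_le hlam.1 sz).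
have hj1 : lam`_j <= lam`_1 by apply: (lam_le hlam.1 sz) => //; apply: leq_trans N2.
have lo : mu N 1 - E1 * N%:R * rr <= lam`_2.
  exact: (lam2_ge gam_per gam_even gam01 N8 sM hlam hM).
have up : lam`_1 <= mu N 1 + 4 * lip_const * N%:R * rr + E1 * N%:R * rr.
  apply: (@eigenvalue_perturb_le _ _ _ _ _ _ _ PP hMP hlam.1 sz hM 1 (cvec p 0)^T).
    by apply: leq_trans N8.
  move=> x hx; apply: decimated_form_mean0.
  by rewrite dotvC dotvE hx mxE.
have : 0 <= lip_const * N%:R * rr.
  by rewrite !mulr_ge0 // /lip_const ?addr_ge0 ?mulr_ge0 // ltW.
by rewrite ler_norml; lra.
Qed.

(** A bound of Davis-Kahan type. The part [w] of [u] off the plane splits as [a + r], with [a]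
    constant and [r] orthogonal to constants, cos and sin. The form of [G - mu N 1] is at least cb N
    / 2 times the squared norm on [a] and at most - cb N / 2 times it on [r], so pairing
    [z = (G - mu N 1) w] with [a - r], which has the norm of [w], makes both contributions
    nonnegative. On the other hand [z = (lam_j - mu N 1) u - (M - G) u] is small. *)
Lemma eigenvector_near_plane (j : nat) u : (0 < j < 3)%N ->
  M *m u = lam`_j *: u -> dotv u u = 1 ->
  nrm (u - (2 / N%:R * dotv u (cvec p 1)) *: cvec p 1
         - (2 / N%:R * dotv u (svec p 1)) *: svec p 1)
    <= (8 * lip_const + 4 * E1) / cb * rr.
Proof.
move=> j3 Mu uu; have hl := decimated_lam j3.
have N2 : (2 < N)%N by apply: leq_trans N8.
set c := @cvec R N p 1; set s := @svec R N p 1.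
pose G := circ_mx gam p; pose one := @cvec R N p 0.
set be := _ * dotv u c; set de := _ * dotv u s.
pose al := dotv u one / N%:R; pose a := al *: one.
set w := u - be *: c - de *: s; pose r := w - a.
have wE0 : w = u - be *: c - de *: s by [].
have aE : a = al *: one by [].
have rE : r = w - a by [].
clearbody w r a.
have N0 : N%:R != 0 :> R by rewrite gt_eqF.
have cc : dotv c c = N%:R / 2 := dotv_c1 p N2.
have ss : dotv s s = N%:R / 2 := dotv_s1 p N2.
have oo : dotv one one = N%:R := dotv_11 p.
have cs : dotv c s = 0 := dotv_cs p (leqnn 1).
have co : dotv c one = 0 by apply: dotv_cc => //; rewrite addn0; apply: leq_trans N2.
have so : dotv s one = 0 by rewrite dotvC; exact: dotv_1s.
have Gc : G *m c = mu N 1 *: c by exact: circ_mx_cvec.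
have Gs : G *m s = mu N 1 *: s by exact: circ_mx_svec.
have Go : G *m one = mu N 0 *: one by exact: circ_mx_cvec.
have rc : dotv r c = 0.
  rewrite rE wE0 aE !dotvDl !dotvNl !dotvZl cc (dotvC s) cs (dotvC one) co /be.
  by field.
have rs : dotv r s = 0.
  rewrite rE wE0 aE !dotvDl !dotvNl !dotvZl ss cs (dotvC one) so /de.
  by field.
have ro : dotv r one = 0.
  rewrite rE wE0 aE !dotvDl !dotvNl !dotvZl oo co so /al.
  by field.
have ra : dotv r a = 0 by rewrite aE dotvZr ro mulr0.
have ar : dotv a r = 0 by rewrite dotvC.
have wE : w = a + r by rewrite rE addrC subrK.
have hgap := decimated_form_gap ro rc rs; rewrite -/G in hgap.
have sG : G^T = G by exact: circ_mx_sym.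
have aGr : dotv a (G *m r) = 0.
  by rewrite -[G]sG -dotv_mull aE -scalemxAr Go scalerA dotvZl dotvC ro mulr0.
have aGa : dotv a (G *m a) = mu N 0 * dotv a a.
  by rewrite aE -scalemxAr Go !dotvZl !dotvZr; ring.
have rGa : dotv r (G *m a) = 0.
  by rewrite aE -scalemxAr Go scalerA dotvZr ro mulr0.
pose z := G *m w - mu N 1 *: w.
have hz : nrm z <= (4 * lip_const + 2 * E1) * N%:R * rr.
  have -> : z = (lam`_j - mu N 1) *: u - (M - G) *m u.
    rewrite /z wE0 !mulmxBr -!scalemxAr Gc Gs !scalerBr mulmxBl Mu scalerBl.
    rewrite !scalerA (mulrC be) (mulrC de).
    apply/matrixP => i k; rewrite !mxE; ring.
  apply: le_trans (nrmD _ _) _; rewrite nrmN nrmZ.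
  have nu : nrm u = 1 by rewrite /nrm uu sqrtr1.
  have := hM u; rewrite nu !mulr1 -/G => h.
  by move: hl h; lra.
have gam_pos : 0 < cb * N%:R / 2 by rewrite divr_gt0 ?mulr_gt0.
have hcbN : (4 * lip_const + 2 * E0) * N%:R * rr <= cb * N%:R / 2.
  by have := ler_wpM2r (ltW NR) hcb; lra.
have key : cb * N%:R / 2 * dotv w w <= dotv (a - r) z.
  have -> : dotv w w = dotv a a + dotv r r.
    by rewrite wE dotvDl !dotvDr ar ra addr0 add0r.
  have -> : dotv (a - r) z = (mu N 0 - mu N 1) * dotv a a
      + (mu N 1 * dotv r r - dotv r (G *m r)).
    rewrite /z wE mulmxDr scalerDr !dotvDl !dotvNl !dotvDr !dotvNr !dotvDr !dotvZr.
    by rewrite aGa aGr rGa ra ar; ring.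
  have a0 := dotv_ge0 a; have r0 := dotv_ge0 r.
  have hg0 : cb * N%:R / 2 <= mu N 0 - mu N 1.
    have := eigmu_gap_decimate; move: hcbN.
    have : 0 <= lip_const * N%:R * rr.
      by rewrite !mulr_ge0 // /lip_const ?addr_ge0 ?mulr_ge0 // ltW.
    by lra.
  have := ler_wpM2r a0 hg0; have := ler_wpM2r r0 hcbN; move: hgap.
  by rewrite /lip_const; lra.
have nt : nrm (a - r) = nrm w.
  congr Num.sqrt; rewrite wE !dotvDl !dotvDr !dotvNl !dotvNr ar ra.
  by ring.
have [w0|w0] := eqVneq (nrm w) 0.
  rewrite w0 mulr_ge0 // divr_ge0 ?addr_ge0 ?mulr_ge0 ?(ltW cb0) // /lip_const.
  by rewrite !addr_ge0 ?mulr_ge0.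
have {}w0 : 0 < nrm w by rewrite lt_neqAle eq_sym w0 nrm_ge0.
have h1 := dotv_le_nrm (a - r) z; rewrite nt in h1.
have h2 : cb * N%:R / 2 * nrm w <= nrm z.
  rewrite -(ler_pM2l w0); rewrite -nrm_sqr in key.
  by move: h1; rewrite ler_norml; lra.
rewrite mulrAC ler_pdivlMr // -(ler_pM2r NR).
by move: h2 hz; lra.
Qed.

End Eigenvectors.
End Decimation.

(** * From eigenvectors to grid points *)

Section NearestRotation.
Context {R : realType}.

Lemma norm2_nrm (x : 'cV[R]_2) : norm2_R2 x = nrm x.
Proof. by rewrite norm2_R2E /nrm /dotv sum2E. Qed.

(** Normalising moves x by the difference of its norm from 1, which is at most the distance to the
    unit vector y. If x = 0, the arbitrary choice of z is at distance at most 2, which is the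
    right-hand side. *)
Lemma normalize_le (x y z : 'cV[R]_2) : circle y -> circle z ->
  (norm2_R2 x != 0 -> z = (norm2_R2 x)^-1 *: x) ->
  norm2_R2 (z - y) <= 2 * norm2_R2 (x - y).
Proof.
rewrite /circle /= !norm2_nrm => ny nz hz.
have [x0|x0] := eqVneq (nrm x) 0.
  have -> : x = 0 by apply: dotv_eq0; rewrite -nrm_sqr x0 expr0n.
  rewrite sub0r nrmN ny mulr1; apply: le_trans (nrmD _ _) _.
  by rewrite nrmN nz ny.
have {}hz := hz x0.
have -> : z - y = (z - x) + (x - y) by rewrite addrA subrK.
apply: le_trans (nrmD _ _) _.
suff : nrm (z - x) <= nrm (x - y) by lra.
have -> : z - x = (1 - nrm x) *: z.
  by rewrite scalerBl scale1r {3}hz scalerA divff // scale1r.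
rewrite nrmZ nz mulr1 ler_norml; apply/andP; split.
  have := nrmD (x - y) y; rewrite subrK ny; lra.
have := nrmD (y - x) x; rewrite subrK ny -opprB nrmN; lra.
Qed.

Definition mx22 (a b c d : R) : 'M[R]_2 :=
  \matrix_(i, j) (if i == 0 then if j == 0 then a else b else if j == 0 then c else d).

Lemma mx22_00 a b c d : mx22 a b c d 0 0 = a. Proof. by rewrite mxE. Qed.
Lemma mx22_01 a b c d : mx22 a b c d 0 1 = b. Proof. by rewrite mxE. Qed.
Lemma mx22_10 a b c d : mx22 a b c d 1 0 = c. Proof. by rewrite mxE. Qed.
Lemma mx22_11 a b c d : mx22 a b c d 1 1 = d. Proof. by rewrite mxE. Qed.
Definition mx22E := (mx22_00, mx22_01, mx22_10, mx22_11).

(* Normalise the first row and complete it by the orthogonal direction closest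
   to the second row. *)
Lemma nearest_orth (a1 a2 b1 b2 e : R) : 0 <= e <= 1 / 2 ->
  1 - e ^+ 2 <= a1 ^+ 2 + a2 ^+ 2 <= 1 -> 1 - e ^+ 2 <= b1 ^+ 2 + b2 ^+ 2 <= 1 ->
  `|a1 * b1 + a2 * b2| <= e ^+ 2 ->
  exists2 Q : 'M[R]_2, orthogonal2 Q &
    (a1 - Q 0 0) ^+ 2 + (a2 - Q 0 1) ^+ 2 + (b1 - Q 1 0) ^+ 2 + (b2 - Q 1 1) ^+ 2
      <= 2 * e ^+ 2.
Proof.
move=> /andP[e0 e1] /andP[la ua] /andP[lb ub] hab.
have E0 : 0 <= e ^+ 2 by rewrite sqr_ge0.
have E1 : e ^+ 2 <= 1 / 4.
  by have := ler_pM e0 e0 e1 e1; rewrite -expr2; lra.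
set t := Num.sqrt (a1 ^+ 2 + a2 ^+ 2).
have t2 : t ^+ 2 = a1 ^+ 2 + a2 ^+ 2 by rewrite sqr_sqrtr // addr_ge0 ?sqr_ge0.
have t0 : 0 < t by rewrite sqrtr_gt0; lra.
have t1 : t <= 1.
  by rewrite -ler_sqr ?nnegrE ?(ltW t0) // t2 expr1n.
pose q1 := a1 / t; pose q2 := a2 / t.
have qq : q1 ^+ 2 + q2 ^+ 2 = 1.
  rewrite /q1 /q2 !expr_div_n -mulrDl -t2 divff // expf_neq0 //.
  by rewrite gt_eqF.
have aq1 : a1 = t * q1 by rewrite /q1 mulrCA divff ?mulr1 // gt_eqF.
have aq2 : a2 = t * q2 by rewrite /q2 mulrCA divff ?mulr1 // gt_eqF.
clearbody q1 q2.
pose f := b1 * q1 + b2 * q2; pose h := b2 * q1 - b1 * q2.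
have bb : f ^+ 2 + h ^+ 2 = b1 ^+ 2 + b2 ^+ 2.
  have -> : f ^+ 2 + h ^+ 2 = (b1 ^+ 2 + b2 ^+ 2) * (q1 ^+ 2 + q2 ^+ 2).
    by rewrite /f /h; ring.
  by rewrite qq mulr1.
have hf : f ^+ 2 <= 4 / 3 * e ^+ 4.
  have hft : (t * f) ^+ 2 <= (e ^+ 2) ^+ 2.
    rewrite -[X in X <= _]real_normK ?num_real // ler_sqr ?nnegrE //.
    suff -> : t * f = a1 * b1 + a2 * b2 by [].
    by rewrite /f [in RHS]aq1 [in RHS]aq2; ring.
  have : 3 / 4 * f ^+ 2 <= t ^+ 2 * f ^+ 2 by rewrite ler_wpM2r ?sqr_ge0 // t2; lra.
  rewrite exprMn -exprM in hft; lra.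
have e4 : e ^+ 4 <= e ^+ 2 / 4.
  by have := ler_wpM2r E0 E1; rewrite -exprD; lra.
pose sg := if 0 <= h then 1 else -1 : R.
have sg2 : sg ^+ 2 = 1 by rewrite /sg; case: ifP; rewrite ?sqrrN expr1n.
have sgh : 1 - sg * h <= 2 * e ^+ 2 - e ^+ 2 / 2.
  have hs : 0 <= sg * h <= 1.
    have h2 : (sg * h) ^+ 2 <= 1 by rewrite exprMn sg2 mul1r; have := sqr_ge0 f; lra.
    have hp : 0 <= sg * h by rewrite /sg; case: ifP => [|/negbT]; rewrite -?ltNge ?mul1r ?mulN1r ?oppr_ge0 // => /ltW.
    by rewrite hp /= -ler_sqr ?nnegrE // expr1n.
  have : (sg * h) ^+ 2 <= sg * h.
    by case/andP: hs => h0 h1; rewrite expr2 ler_piMl.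
  rewrite exprMn sg2 mul1r; lra.
have sgh0 : 0 <= 1 - sg * h.
  have h2 : (sg * h) ^+ 2 <= 1 by rewrite exprMn sg2 mul1r; have := sqr_ge0 f; lra.
  by have := sqr_ge0 (sg * h - 1); rewrite sqrrB1 mulr2n; lra.
exists (mx22 q1 q2 (- sg * q2) (sg * q1)).
  apply: orthogonal2I; rewrite !mx22E.
  - by rewrite exprMn sqrrN sg2 mul1r qq.
  - by rewrite exprMn sg2 mul1r addrC qq.
  - have -> : q1 * q2 + - sg * q2 * (sg * q1) = q1 * q2 * (1 - sg ^+ 2) by ring.
    by rewrite sg2 subrr mulr0.
rewrite !mx22E.
have -> : (a1 - q1) ^+ 2 + (a2 - q2) ^+ 2 = (1 - t) ^+ 2.
  have -> : (a1 - q1) ^+ 2 + (a2 - q2) ^+ 2 = (1 - t) ^+ 2 * (q1 ^+ 2 + q2 ^+ 2).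
    by rewrite [in LHS]aq1 [in LHS]aq2; ring.
  by rewrite qq mulr1.
have -> : (1 - t) ^+ 2 + (b1 - - sg * q2) ^+ 2 + (b2 - sg * q1) ^+ 2 =
   (1 - t) ^+ 2 + (f ^+ 2 + h ^+ 2 + sg ^+ 2 * (q1 ^+ 2 + q2 ^+ 2) - 2 * (sg * h)).
  by rewrite bb /h; ring.
rewrite sg2 mul1r qq.
have -> : h ^+ 2 = (sg * h) ^+ 2 by rewrite exprMn sg2 mul1r.
have h1 : (1 - t) ^+ 2 <= e ^+ 2 / 4.
  have : 1 - t <= e ^+ 2.
    have : t ^+ 2 <= t by rewrite expr2 ler_piMl // ltW.
    by rewrite t2; lra.
  move=> ht; have h0 : 0 <= 1 - t by lra.
  by have := ler_pM h0 h0 ht ht; rewrite -exprD -expr2; lra.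
have h2 : (1 - sg * h) ^+ 2 <= 9 / 4 * e ^+ 4.
  have ht : 1 - sg * h <= 3 / 2 * e ^+ 2 by lra.
  have := ler_pM sgh0 sgh0 ht ht.
  have -> : 3 / 2 * e ^+ 2 * (3 / 2 * e ^+ 2) = 9 / 4 * e ^+ 4 by field.
  by rewrite -expr2.
have : (1 - sg * h) ^+ 2 = 1 - 2 * (sg * h) + (sg * h) ^+ 2 by ring.
lra.
Qed.

Context (N : nat) (p : 'S_N) (u v : 'cV[R]_N) (dl : R).
Context (N2 : (2 < N)%N) (dl01 : 0 <= dl <= 1 / 2).

Let NR : (0 : R) < N%:R. Proof. by rewrite ltr0n (leq_trans _ N2). Qed.

Definition plane_cos (x : 'cV[R]_N) : R := 2 / N%:R * dotv x (cvec p 1).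
Definition plane_sin (x : 'cV[R]_N) : R := 2 / N%:R * dotv x (svec p 1).
Definition off_plane (x : 'cV[R]_N) : 'cV[R]_N :=
  x - plane_cos x *: cvec p 1 - plane_sin x *: svec p 1.

Lemma off_plane_dotv x y : dotv x y = N%:R / 2 * (plane_cos x * plane_cos y +
  plane_sin x * plane_sin y) + dotv (off_plane x) (off_plane y).
Proof.
have cc : dotv (cvec p 1) (cvec p 1) = N%:R / 2 :> R := dotv_c1 p N2.
have ss : dotv (svec p 1) (svec p 1) = N%:R / 2 :> R := dotv_s1 p N2.
have cs : dotv (cvec p 1) (svec p 1) = 0 :> R := dotv_cs p (leqnn 1).
have xc z : dotv z (cvec p 1) = N%:R / 2 * plane_cos z.
  by rewrite /plane_cos; field; rewrite gt_eqF.
have xs z : dotv z (svec p 1) = N%:R / 2 * plane_sin z.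
  by rewrite /plane_sin; field; rewrite gt_eqF.
rewrite /off_plane !dotvDl !dotvNl !dotvDr !dotvNr !dotvZl !dotvZr.
rewrite (dotvC (svec p 1) (cvec p 1)) cc ss cs !xc !xs.
rewrite (dotvC (cvec p 1) y) (dotvC (svec p 1) y) !xc !xs.
by field.
Qed.

Context (uu : dotv u u = 1) (vv : dotv v v = 1) (uv : dotv u v = 0).
Context (hu : nrm (off_plane u) <= dl) (hv : nrm (off_plane v) <= dl).

Let embed (i : 'I_N) : 'cV[R]_2 :=
  \col_(k < 2) (Num.sqrt (N%:R / 2) * (if k == 0 then u i 0 else v i 0)).

(** Orthonormality of u and v makes the 2 x 2 matrix of their plane coordinates orthogonal up to
    dl^2, hence close to some [Q]. The off-plane parts and the distance from that matrix to [Q],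
    averaged over the grid, each contribute 2 N dl^2. *)
Lemma eigenvectors_near_orth : exists2 Q : 'M[R]_2, orthogonal2 Q &
  \sum_i dotv (embed i - Q *m cis (ang N (p i))) (embed i - Q *m cis (ang N (p i)))
    <= 4 * N%:R * dl ^+ 2.
Proof.
pose q : R := Num.sqrt (N%:R / 2).
have q2 : q ^+ 2 = N%:R / 2 by rewrite sqr_sqrtr // divr_ge0 // ltW.
have dl0 : 0 <= dl by case/andP: dl01.
have sq x : nrm (off_plane x) <= dl -> 0 <= dotv (off_plane x) (off_plane x) <= dl ^+ 2.
  by move=> hx; rewrite dotv_ge0 /= -nrm_sqr ler_sqr ?nnegrE ?nrm_ge0.
have /andP[u0 u1] := sq _ hu; have /andP[v0 v1] := sq _ hv.
have := @nearest_orth (q * plane_cos u) (q * plane_sin u) (q * plane_cos v)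
  (q * plane_sin v) dl dl01.
have e1 x : (q * plane_cos x) ^+ 2 + (q * plane_sin x) ^+ 2 =
    dotv x x - dotv (off_plane x) (off_plane x).
  by rewrite [in RHS]off_plane_dotv -q2; ring.
have e2 : q * plane_cos u * (q * plane_cos v) + q * plane_sin u * (q * plane_sin v) =
   - dotv (off_plane u) (off_plane v).
  have := uv; rewrite off_plane_dotv -q2 => h.
  apply/eqP; rewrite -subr_eq0 opprK; apply/eqP; rewrite -[RHS]h.
  by ring.
rewrite !e1 uu vv e2 => -[||| Q oQ hQ]; [lra|lra| |].
  rewrite normrN; apply: le_trans (dotv_le_nrm _ _) _.
  by rewrite expr2; apply: ler_pM => //; exact: nrm_ge0.
exists Q => //.
pose A := mx22 (q * plane_cos u) (q * plane_sin u) (q * plane_cos v) (q * plane_sin v).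
pose w i := cis (ang N (p i)) : 'cV[R]_2.
have split2 (x y z : 'cV[R]_2) : dotv (x - z) (x - z) <=
    2 * dotv (x - y) (x - y) + 2 * dotv (y - z) (y - z).
  rewrite /dotv !sum2E !mxE.
  have := sqr_ge0 (x 0 0 - y 0 0 - (y 0 0 - z 0 0)).
  have := sqr_ge0 (x 1 0 - y 1 0 - (y 1 0 - z 1 0)).
  by rewrite !expr2; lra.
apply: le_trans (_ : \sum_i (2 * dotv (embed i - A *m w i) (embed i - A *m w i) +
   2 * dotv (A *m w i - Q *m w i) (A *m w i - Q *m w i)) <= _).
  by apply: ler_sum => i _; apply: split2.
rewrite big_split /= -!mulr_sumr.
have -> : \sum_i dotv (embed i - A *m w i) (embed i - A *m w i) =
    q ^+ 2 * (dotv (off_plane u) (off_plane u) + dotv (off_plane v) (off_plane v)).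
  rewrite mulrDr /dotv !mulr_sumr -big_split; apply: eq_bigr => i _ /=.
  have E (x : 'cV[R]_N) : (off_plane x) i 0 = x i 0 -
      plane_cos x * cos (ang N (p i)) - plane_sin x * sin (ang N (p i)).
    by rewrite !mxE !mul1r.
  rewrite !E sum2E.
  have D k (B : 'M[R]_2) : (embed i - B *m w i) k 0 =
      q * (if k == 0 then u i 0 else v i 0) - (B *m w i) k 0 by rewrite [LHS]mxE !mxE.
  rewrite !D !mulmx2E /A !mx22E /w !cisE0 !cisE1 /=.
  by ring.
have -> : \sum_i dotv (A *m w i - Q *m w i) (A *m w i - Q *m w i) = N%:R / 2 *
   ((A 0 0 - Q 0 0) ^+ 2 + (A 0 1 - Q 0 1) ^+ 2 + (A 1 0 - Q 1 0) ^+ 2 + (A 1 1 - Q 1 1) ^+ 2).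
  pose r (k : 'I_2) : 'cV[R]_2 := \col_j (A k j - Q k j).
  transitivity (\sum_(k < 2) \sum_(i < N) dot2 (r k) (cis (ang N i)) ^+ 2).
    rewrite [RHS]exchange_big -[RHS](sum_perm p); apply: eq_bigr => i _ /=.
    apply: eq_bigr => k _; have -> : (A *m w i - Q *m w i) k 0 = (A *m w i) k 0 - (Q *m w i) k 0.
      by rewrite mxE [X in _ + X]mxE.
    have rE j : r k j 0 = A k j - Q k j by rewrite mxE.
    by rewrite !mulmx2E /dot2 !rE expr2 -/(w i); ring.
  under eq_bigr do rewrite sum_grid_dot2 //.
  rewrite sum2E -mulrDr /dot2 !mxE; congr (_ * _).
  by ring.
rewrite /A !mx22E q2.
have := ler_wpM2l (ltW NR) hQ.
have h1 : N%:R * (dotv (off_plane u) (off_plane u) + dotv (off_plane v) (off_plane v))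
   <= N%:R * (2 * dl ^+ 2) by rewrite ler_wpM2l ?(ltW NR) //; lra.
by move: h1; lra.
Qed.

End NearestRotation.

Section GridRotation.
Context {R : realType}.

Lemma orthogonal2_cis (Q : 'M[R]_2) : orthogonal2 Q ->
  exists al : R, exists b : bool, 0 <= al < 2 * pi /\
    forall t, Q *m cis t = cis (al + (if b then t else - t)).
Proof.
move=> oQ; have [h1 h2 h3] := orthogonal2P oQ.
have cq : circle (Q *m cis 0) by apply: circle_orth => //; exact: circle_cis.
have [al [hal e]] := circle_cisP cq.
have e0 : Q 0 0 = cos al.
  have := congr1 (fun x : 'cV[R]_2 => x 0 0) e; rewrite mulmx2E !cisE0 cisE1 cos0 sin0.
  by rewrite mulr1 mulr0 addr0.
have e1 : Q 1 0 = sin al.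
  have := congr1 (fun x : 'cV[R]_2 => x 1 0) e; rewrite mulmx2E cisE0 !cisE1 cos0 sin0.
  by rewrite mulr1 mulr0 addr0.
have cs := cos2Dsin2 al.
(* The determinant of [Q], whose first column is (cos al, sin al). *)
pose d := cos al * Q 1 1 - sin al * Q 0 1.
have d2 : d ^+ 2 = 1.
  have -> : d ^+ 2 = (cos al ^+ 2 + sin al ^+ 2) * (Q 0 1 ^+ 2 + Q 1 1 ^+ 2)
     - (cos al * Q 0 1 + sin al * Q 1 1) ^+ 2 by rewrite /d; ring.
  by rewrite cs h2 -e0 -e1 h3 expr0n subr0 mulr1.
have q01 : Q 0 1 = - d * sin al.
  have -> : - d * sin al = (cos al ^+ 2 + sin al ^+ 2) * Q 0 1 -
     cos al * (cos al * Q 0 1 + sin al * Q 1 1) by rewrite /d; ring.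
  by rewrite cs -e0 -e1 h3 mulr0 subr0 mul1r.
have q11 : Q 1 1 = d * cos al.
  have -> : d * cos al = (cos al ^+ 2 + sin al ^+ 2) * Q 1 1 -
     sin al * (cos al * Q 0 1 + sin al * Q 1 1) by rewrite /d; ring.
  by rewrite cs -e0 -e1 h3 mulr0 subr0 mul1r.
have /orP[/eqP d1|/eqP d1] : (d == 1) || (d == -1) by rewrite -eqf_sqr d2 expr1n.
- exists al, true; split => // t.
  apply: vec2P; rewrite mulmx2E !cisE0 !cisE1 ?cosD ?sinD ?e0 ?e1 ?q01 ?q11 d1; ring.
- exists al, false; split => // t.
  by apply: vec2P; rewrite mulmx2E !cisE0 !cisE1 ?cosB ?sinB ?e0 ?e1 ?q01 ?q11 d1; ring.
Qed.

Lemma cis_ang_mod K (j : nat) : (0 < K)%N -> cis (ang K (j %% K)) = cis (ang K j) :> 'cV[R]_2.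
Proof.
move=> K0; rewrite [in RHS](divn_eq j K) angD angM angKK //.
apply: vec2P; rewrite ?cisE0 ?cisE1 addrC.
- by rewrite (@periodic2pi_nat _ cos) // => t; rewrite mulr_natl cosD2pi.
- by rewrite (@periodic2pi_nat _ sin) // => t; rewrite mulr_natl sinD2pi.
Qed.

Definition rot_mx (al : R) (b : bool) : 'M[R]_2 :=
  if b then mx22 (cos al) (- sin al) (sin al) (cos al)
  else mx22 (cos al) (sin al) (sin al) (- cos al).

Lemma rot_mx_orth al b : orthogonal2 (rot_mx al b).
Proof.
have cs := cos2Dsin2 al.
by case: b; apply: orthogonal2I; rewrite !mx22E ?sqrrN //; (rewrite 1?addrC //; ring).
Qed.

Lemma rot_mx_cis al b t : rot_mx al b *m cis t = cis (al + (if b then t else - t)).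
Proof.
case: b; apply: vec2P; rewrite mulmx2E !mx22E !cisE0 !cisE1 ?cosD ?sinD ?cosN ?sinN; ring.
Qed.

(** The angle of [Q] is rounded down to the grid, at a cost of at most 2 pi / N <= 8 / N. The
    rounded map permutes the grid, so the points to be matched are grid points again. *)
Lemma orth_grid N (p : 'S_N) (Q : 'M[R]_2) : (0 < N)%N -> orthogonal2 Q ->
  exists Q' : 'M[R]_2, exists p' : 'S_N, [/\ orthogonal2 Q',
    forall i, Q' *m cis (ang N (p i)) = cis (ang N (p' i))
  & forall x, circle x -> dcirc (Q *m x) (Q' *m x) <= 8 / N%:R].
Proof.
move=> N0 oQ; have [al [b [/andP[al0 al1] Qcis]]] := orthogonal2_cis oQ.
have NR : (0 : R) < N%:R by rewrite ltr0n.
have p0 := pi_gt0 R.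
pose x := al * N%:R / (2 * pi); pose a := Num.truncn x.
have x0 : 0 <= x by rewrite /x !mulr_ge0 // ?invr_ge0 ?mulr_ge0 // ltW.
have /andP[ax xa] := truncn_itv x0; rewrite -/a in ax xa.
have angx : x * (2 * pi / N%:R) = al.
  have E (q : R) : q != 0 -> al * N%:R / (2 * q) * (2 * q / N%:R) = al.
    by move=> q0; field; rewrite q0 gt_eqF.
  exact: E (lt0r_neq0 p0).
have angE j : ang N j = j%:R * (2 * pi / N%:R) :> R by rewrite /ang; ring.
have hc : (0 : R) < 2 * pi / N%:R by rewrite divr_gt0 ?mulr_gt0.
have dal : `|al - ang N a| <= 8 / N%:R.
  have h1 : ang N a <= al by rewrite angE -angx ler_wpM2r ?(ltW hc).
  have h2 : al <= ang N a.+1 by rewrite angE -angx ler_wpM2r ?ltW.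
  have h3 : ang N a.+1 = ang N a + 2 * pi / N%:R :> R by rewrite !angE -natr1 mulrDl mul1r.
  have h4 : 2 * pi / N%:R <= 8 / N%:R :> R.
    by rewrite ler_wpM2r ?invr_ge0 ?ler0n //; have := pihalf_lt2 R; lra.
  by rewrite ger0_norm; lra.
(* For a reflection the position is a - p i; adding N keeps it in the naturals. *)
pose pos (i : 'I_N) := if b then (a + p i)%N else (a + (N - p i))%N.
have lt i : (pos i %% N < N)%N by rewrite ltn_pmod.
have inj : injective (fun i => Ordinal (lt i)).
  move=> i j /(congr1 val) /= /eqP; rewrite /pos.
  have pi_lt := ltn_ord (p i); have pj_lt := ltn_ord (p j).
  case: (b) => h; apply: (@perm_inj _ p); apply: val_inj => /=.
    by move: h; rewrite eqn_modDl !modn_small // => /eqP.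
  have : (a + (N - p i) + (p i + p j) == a + (N - p j) + (p i + p j) %[mod N]).
    by rewrite eqn_modDr.
  have -> : (a + (N - p i) + (p i + p j) = (a + N) + p j)%N by lia.
  have -> : (a + (N - p j) + (p i + p j) = (a + N) + p i)%N by lia.
  by rewrite eqn_modDl !modn_small // => /eqP.
exists (rot_mx (ang N a) b), (perm inj); split; first exact: rot_mx_orth.
  move=> i; rewrite permE /= cis_ang_mod // rot_mx_cis /pos; case: (b).
    by rewrite angD.
  have := @angD R N (N - p i) (p i); rewrite subnK 1?ltnW // angKK // => h.
  rewrite angD -(@cis_periodic _ (ang N a - _)); congr cis.
  by rewrite -addrA; congr (_ + _); rewrite h; ring.
move=> y /circle_cisP[t [_ ->]]; rewrite Qcis rot_mx_cis.
apply: le_trans (dcirc_cis_le _ _) _.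
by rewrite opprD addrACA subrr addr0.
Qed.

End GridRotation.

(** * Optimal matching of sorted points on a circle *)

Section CyclicMatching.
Context {R : realType} (N : nat) (x : 'I_N -> R).
Context (x_sorted : forall l l' : 'I_N, (l <= l')%N -> x l <= x l' <= x l + N%:R).

Let cost (m : 'I_N -> int) : R := \sum_l `|x l - (m l)%:~R|.
(** The potential that makes the uncrossing stop; the cost alone may stay constant along the way. *)
Let energy (m : 'I_N -> int) : int := \sum_l (m l - l%:Z) ^+ 2.
Let inj_mod (m : 'I_N -> int) := forall l l', (N%:Z %| m l - m l')%Z -> l = l'.
(** Integers lift grid positions to the line. The targets of [a] and of its successor [b] are
    exchanged; the [t] turns account for the last index, whose successor is the first index one turn
    later. *)
Let exchange (m : 'I_N -> int) (a b : 'I_N) (t : nat) (l : 'I_N) : int :=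
  if l == a then m b + (t * N)%:Z else if l == b then m a - (t * N)%:Z else m l.

Let sum_pair (V : nmodType) (a b : 'I_N) (F : 'I_N -> V) : a != b ->
  \sum_l F l = F a + F b + \sum_(l | (l != a) && (l != b)) F l.
Proof. by move=> ab; rewrite (bigD1 a) //= (bigD1 b) 1?eq_sym //= addrA. Qed.

Let exchange_others (V : nmodType) m (a b : 'I_N) t (F : 'I_N -> int -> V) : a != b ->
  \sum_l F l (exchange m a b t l) = F a (m b + (t * N)%:Z) + F b (m a - (t * N)%:Z) +
     \sum_(l | (l != a) && (l != b)) F l (m l).
Proof.
move=> ab; rewrite (sum_pair _ ab); congr (_ + _ + _).
- by rewrite /exchange eqxx.
- by rewrite /exchange eq_sym (negPf ab) eqxx.
- by apply: eq_bigr => l /andP[la lb]; rewrite /exchange (negPf la) (negPf lb).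
Qed.

(* Uncrossing two neighbours does not increase the cost and lowers the energy. *)
Let exchange_step m (a b : 'I_N) t : a != b -> (b + t * N = a.+1)%N ->
  m b + (t * N)%:Z < m a -> inj_mod m ->
  [/\ inj_mod (exchange m a b t), cost (exchange m a b t) <= cost m
    & energy (exchange m a b t) < energy m].
Proof.
move=> ab bt hm injm; split.
- have D l : exists l0, (N%:Z %| exchange m a b t l - m l0)%Z /\
      (l0 = if l == a then b else if l == b then a else l).
    exists (if l == a then b else if l == b then a else l); split => //.
    rewrite /exchange; case: ifP => _; first by rewrite addrC addKr PoszM dvdz_mull.
    case: ifP => _; last by rewrite subrr dvdz0.
    by rewrite addrAC subrr add0r rpredN PoszM dvdz_mull.
  move=> l l' h; have [l0 [h0 e0]] := D l; have [l1 [h1 e1]] := D l'.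
  have {}h : l0 = l1.
    apply: injm; have -> : m l0 - m l1 = (exchange m a b t l - exchange m a b t l') -
      (exchange m a b t l - m l0) + (exchange m a b t l' - m l1) by ring.
    by apply: rpredD => //; apply: rpredB.
  move: h; rewrite e0 e1; case: (l =P a) => la; case: (l =P b) => lb;
    case: (l' =P a) => l'a; case: (l' =P b) => l'b; congruence.
- rewrite /cost (exchange_others m t (fun l v => `|x l - v%:~R|) ab).
  rewrite [leRHS](sum_pair _ ab) lerD2r.
  have xab : x a <= x b + (t * N)%:R.
    case: t bt {hm} => [|t] bt.
      rewrite mul0n addr0; rewrite mul0n addn0 in bt.
      have ab' : (a <= b)%N by rewrite bt.
      by have /andP[] := x_sorted ab'.
    have aN := ltn_ord a.
    have t0 : t = 0%N.
      apply/eqP; rewrite -leqn0 leqNgt; apply/negP => t1.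
      have : (2 * N <= t.+1 * N)%N by rewrite leq_mul2r orbC ltnS t1.
      by move: aN bt; clear; lia.
    have ba : (b <= a)%N by move: aN bt; rewrite t0 mul1n; clear; lia.
    have /andP[_ h] := x_sorted ba.
    by rewrite t0 mul1n.
  have hm' : ((m b)%:~R + (t * N)%:R : R) <= (m a)%:~R.
    by have := ltW hm; rewrite -(ler_int R) rmorphD /= -pmulrn.
  rewrite rmorphD rmorphB /= -!pmulrn.
  set A := (m a)%:~R in hm' *; set B := (m b)%:~R in hm' *; set T := _%:R in xab hm' *.
  have -> : x b - (A - T) = (x b + T) - A by ring.
  have -> : x b - B = (x b + T) - (B + T) by ring.
  set y := x b + T in xab *; set C := B + T in hm' *.
  by do 4! case: ger0P => ?; lra.
- rewrite /energy (exchange_others m t (fun l v => (v - l%:Z) ^+ 2) ab).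
  rewrite [ltRHS](sum_pair _ ab) ltrD2r.
  have e : (a : nat)%:Z = b%:Z + (t * N)%:Z - 1 by lia.
  rewrite e; move: hm; set T := (t * N)%:Z; set b' := (b : nat)%:Z.
  by move: (m a) (m b) => A B hm; nia.
Qed.

(** The extension [f] of [m] with [f (i + N) = f i + N] does not decrease when nothing crosses, and
    injectivity modulo N makes it increase strictly. As it gains exactly N over one turn, every step
    is one. *)
Let no_crossing m : (0 < N)%N -> inj_mod m ->
  (forall (a b : 'I_N) t, a != b -> (b + t * N = a.+1)%N -> m a <= m b + (t * N)%:Z) ->
  exists h : int, forall l, m l = l%:Z + h.
Proof.
move=> N0 injm nc.
pose f (i : nat) : int := m (Ordinal (ltn_pmod i N0)) + (i %/ N * N)%:Z.
have fS i : f i + 1 <= f i.+1.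
  set a := Ordinal (ltn_pmod i N0); set b := Ordinal (ltn_pmod i.+1 N0).
  pose t := (i.+1 %/ N - i %/ N)%N.
  have le_div : (i %/ N <= i.+1 %/ N)%N by apply: leq_div2r.
  have bt : (b + t * N = a.+1)%N.
    rewrite /= /t mulnBl; have := divn_eq i N; have := divn_eq i.+1 N.
    have : (i %/ N * N <= i.+1 %/ N * N)%N by rewrite leq_mul2r le_div orbT.
    by lia.
  have ft : f i.+1 = m b + (t * N)%:Z + (i %/ N * N)%:Z.
    rewrite /f -/b -addrA -PoszD -mulnDl subnK //.
  have [ab|ab] := eqVneq a b.
    have : (t * N)%N = 1%N by move: bt; rewrite ab; lia.
    by rewrite ft /f -/a -ab => ->; lia.
  have h := nc a b t ab bt.
  suff : m a != m b + (t * N)%:Z by rewrite ft /f -/a; lia.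
  apply/eqP => e; case/eqP: ab; apply: injm.
  by rewrite e addrC addKr PoszM dvdz_mull.
have fD i k : f i + k%:Z <= f (i + k)%N.
  elim: k => [|k IH]; first by rewrite addr0 addn0.
  by rewrite addnS; apply: le_trans (fS _); lia.
have fN : f N = f 0%N + N%:Z.
  rewrite /f divnn N0 mul1n div0n mul0n addr0; congr (m _ + _).
  by apply: val_inj; rewrite /= modnn mod0n.
exists (f 0%N) => l.
have fl : f l = m l.
  rewrite /f divn_small // mul0n addr0; congr m; apply: val_inj.
  by rewrite /= modn_small.
have h1 := fD 0%N l; have h2 := fD l (N - l)%N.
have lN := ltn_ord l; rewrite subnKC 1?ltnW // in h2.
by rewrite add0n in h1; lia.
Qed.

(** Uncrossing neighbours until no crossing is left turns any assignment to distinct residues into a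
    cyclic shift without raising the cost. The arg min of Spectral Localization ranges exactly over
    these shifts. *)
Lemma cyclic_matching m : inj_mod m -> exists h : int,
  \sum_l `|x l - (l%:Z + h)%:~R| <= \sum_l `|x l - (m l)%:~R|.
Proof.
have [N0|N0] := posnP N.
  by exists 0; rewrite !big1 // => l _; have := ltn_ord l; rewrite {2}N0.
have [K] : exists K : nat, energy m <= K%:Z.
  exists `|energy m|%N; rewrite gez0_abs //.
  by apply: sumr_ge0 => l _; rewrite sqr_ge0.
elim: K m => [|K IH] m hK injm.
  have m0 l : m l = l%:Z + 0.
    have E0 : energy m = 0.
      by apply/eqP; rewrite eq_le hK sumr_ge0 // => i _; rewrite sqr_ge0.
    have /psumr_eq0P H := E0; have := H (fun i _ => sqr_ge0 _) l isT.
    by move/eqP; rewrite sqrf_eq0 subr_eq0 addr0 => /eqP.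
  by exists 0; under eq_bigr do rewrite -m0.
have [[a [b [t [ab bt hm]]]]|nc] := pselect (exists (a b : 'I_N) t,
    [/\ a != b, (b + t * N = a.+1)%N & m b + (t * N)%:Z < m a]).
  have [i' c' e'] := exchange_step ab bt hm injm.
  have [|h hh] := IH (exchange m a b t) _ i'; first by lia.
  by exists h; apply: le_trans hh c'.
have [|h hh] := @no_crossing m N0 injm.
  move=> a b t ab bt; rewrite leNgt; apply/negP => hm; apply: nc.
  by exists a, b, t.
by exists h; under [leRHS]eq_bigr do rewrite hh.
Qed.

End CyclicMatching.

Section LocalizationOutput.
Context {R : realType}.

Lemma periodic2pi_int (phi : R -> R) (k : int) t : (forall t, phi (t + 2 * pi) = phi t) ->
  phi (t + k%:~R * (2 * pi)) = phi t.
Proof.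
move=> hp; case: k => k; first exact: periodic2pi_nat.
rewrite NegzE mulrNz mulNr -(periodic2pi_nat k.+1 _ hp).
by rewrite -pmulrn subrK.
Qed.

Lemma cis_periodic_int (k : int) (t : R) : cis (t + k%:~R * (2 * pi)) = cis t.
Proof.
apply: vec2P; rewrite ?cisE0 ?cisE1.
- by rewrite (@periodic2pi_int cos) // => u; rewrite mulr_natl cosD2pi.
- by rewrite (@periodic2pi_int sin) // => u; rewrite mulr_natl sinD2pi.
Qed.

Lemma cis_eq (a b : R) : cis a = cis b -> exists k : int, a = b + k%:~R * (2 * pi).
Proof.
move=> e; have p0 : 0 < 2 * pi :> R by rewrite mulr_gt0 ?pi_gt0.
pose u := (a - b) / (2 * pi); exists (Num.floor u).
have /andP[f1 f2] := floor_itv u.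
have au : a - b = u * (2 * pi) by rewrite mulfVK // gt_eqF.
pose w := a - b - (Num.floor u)%:~R * (2 * pi).
have w0 : 0 <= w by rewrite /w au subr_ge0 ler_wpM2r // ltW.
have w1 : w < 2 * pi.
  have := f2; rewrite -(ltr_pM2r p0) -au intrD mulrDl mul1r /w; lra.
have cw : cos w = 1.
  have -> : w = a - b + (- Num.floor u)%:~R * (2 * pi) by rewrite /w mulrNz mulNr.
  rewrite (@periodic2pi_int cos); last by move=> t; rewrite mulr_natl cosD2pi.
  by rewrite -dot2_cis e dot2_cis subrr cos0.
have w00 : w = 0.
  apply/eqP; rewrite eq_le w0 andbT leNgt; apply/negP => wp.
  by have := @cos_lt1 _ w; rewrite cw ltxx wp w1 => /(_ isT).
by move: w00; rewrite /w; lra.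
Qed.

Lemma dcirc_cisE (a b : R) : exists k : int,
  dcirc (cis a) (cis b) = `|a - (b + k%:~R * (2 * pi))|.
Proof.
have [a' /cis_eq[k ->] ->] := dcirc_lift b (circle_cis a).
by exists k; congr `|_|; ring.
Qed.

Context (N : nat) (z y : 'I_N -> 'cV[R]_2) (s : 'S_N) (k : 'I_N) (p : 'S_N).
Context (zc : forall i, circle (z i)).
Context (yE : forall i, y i = cis (ang N (p i))).
Context (hs : trig_order (z \o s)).
Context (hk : forall k', align_cost z s k <= align_cost z s k').

Let N0 : (0 < N)%N. Proof. exact: leq_ltn_trans (ltn_ord k). Qed.
Let NR : (0 : R) < N%:R. Proof. by rewrite ltr0n. Qed.

(** Each distance to [y] is realised on the line by a multiple [m l] of the grid step. The residues
    of the [m l] are distinct, so some shift does at least as well. The factor 2 compares the two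
    norms of the plane. *)
Lemma align_cost_le : align_cost z s k <= 2 * \sum_i dcirc (z i) (y i).
Proof.
have p0 := pi_gt0 R.
have c0 : (0 : R) < 2 * pi / N%:R by rewrite divr_gt0 ?mulr_gt0.
have [th [hth mono]] := hs.
have hm l : exists m : int, dcirc (z (s l)) (y (s l)) = `|th l - m%:~R * (2 * pi / N%:R)| /\
    (N%:Z %| m - (p (s l) : nat)%:Z)%Z.
  have := hth l => /= ->; rewrite yE; have [j ->] := dcirc_cisE (th l) (ang N (p (s l))).
  exists ((p (s l) : nat)%:Z + j * N%:Z); split; last by rewrite addrC addKr dvdz_mull.
  congr `|_ - _|; rewrite intrD intrM /ang -!pmulrn; field.
  by rewrite gt_eqF.
have {hm} [m hm] := choice hm.
pose x l := th l / (2 * pi / N%:R).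
have thx l : th l = x l * (2 * pi / N%:R) by rewrite /x mulfVK // gt_eqF.
have cN : 2 * pi / (2 * pi / N%:R) = N%:R :> R.
  have E (q : R) : q != 0 -> 2 * q / (2 * q / N%:R) = N%:R.
    by move=> q0; field; rewrite q0 gt_eqF.
  exact: E (lt0r_neq0 p0).
have xs (l l' : 'I_N) : (l <= l')%N -> x l <= x l' <= x l + N%:R.
  have -> : x l + N%:R = (th l + 2 * pi) / (2 * pi / N%:R) by rewrite mulrDl cN.
  move=> /mono /andP[h1 h2]; rewrite /x.
  by rewrite !ler_pM2r ?invr_gt0 // h1 h2.
have injm (l l' : 'I_N) : (N%:Z %| m l - m l')%Z -> l = l'.
  move=> h; apply: (@perm_inj _ s); apply: (@perm_inj _ p); apply: val_inj.
  have := hm l; have := hm l' => -[_ h1] [_ h2].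
  have : (N%:Z %| (p (s l) : nat)%:Z - (p (s l') : nat)%:Z)%Z.
    have -> : (p (s l) : nat)%:Z - (p (s l') : nat)%:Z =
       (m l - m l') - (m l - (p (s l) : nat)%:Z) + (m l' - (p (s l') : nat)%:Z) by ring.
    by apply: rpredD => //; apply: rpredB.
  move: (ltn_ord (p (s l))) (ltn_ord (p (s l'))).
  set a := nat_of_ord _; set b := nat_of_ord (p (s l')) => aN bN.
  rewrite -eqz_mod_dvd => /eqP; rewrite !modz_nat !modn_small // => -[].
  by [].
have [h hh] := cyclic_matching xs injm.
(* The offset 2 undoes the two successors in [grid_point]. *)
pose k1 := ((h - 2) %% N%:Z)%Z.
have k10 : 0 <= k1 by by apply: modz_ge0; have := N0; case: (N).
have k1N : (`|k1| < N)%N.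
  have : k1 < N%:Z by apply: ltz_pmod; rewrite ltz_nat.
  by rewrite -ltz_nat gez0_abs.
pose k0 := Ordinal k1N.
have gE l : grid_point k0 l = cis ((l%:Z + h)%:~R * (2 * pi / N%:R)) :> 'cV[R]_2.
  rewrite /grid_point -[RHS](@cis_periodic_int (- ((h - 2) %/ N%:Z)%Z) _); congr cis.
  have -> : (k0.+1 + l.+1)%:R = (k1 + l%:Z + 2)%:~R :> R.
    rewrite pmulrn; congr (_%:~R); rewrite /k0 /=.
    have -> : k1 = `|k1|%N%:Z by rewrite gez0_abs.
    by rewrite absz_nat; lia.
  have hd := divz_eq (h - 2) N%:Z.
  have -> : k1 = h - 2 - ((h - 2) %/ N%:Z)%Z * N%:Z by rewrite [X in _ = X - _]hd -/k1 addrAC subrr add0r.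
  rewrite !(intrD, intrM, mulrNz) -?pmulrn; field.
  by rewrite gt_eqF.
apply: le_trans (hk k0) _; rewrite /align_cost mulr_sumr.
apply: le_trans (_ : \sum_(l < N) 2 * (`|x l - (l%:Z + h)%:~R| * (2 * pi / N%:R)) <= _).
  apply: ler_sum => l _; apply: le_trans (norm1_le_norm2 _) _; rewrite ler_pM2l //.
  have -> : z (s l) = cis (th l) by have := hth l.
  rewrite gE; apply: le_trans (chord_le_dcirc (circle_cis _) (circle_cis _)) _.
  apply: le_trans (dcirc_cis_le _ _) _.
  by rewrite thx -mulrBl normrM (gtr0_norm c0) distrC.
rewrite -[leRHS](sum_perm s) -!mulr_sumr ler_pM2l //.
rewrite -mulr_suml.
have -> : \sum_i dcirc (z (s i)) (y (s i)) = (\sum_l `|x l - (m l)%:~R|) * (2 * pi / N%:R).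
  rewrite mulr_suml; apply: eq_bigr => l _; have [-> _] := hm l.
  by rewrite thx -mulrBl normrM (gtr0_norm c0).
by rewrite ler_pM2r.
Qed.

(** 5 = 2 * 2 + 1: the distance from the output to z is at most twice the alignment cost, since pi /
    2 <= 2; that cost is at most twice the distance from z to y; and one more such distance comes
    from the triangle inequality. *)
Lemma aligned_close : \sum_l dcirc (grid_point k l) (y (s l)) <= 5 * \sum_i dcirc (z i) (y i).
Proof.
have p4 : pi <= 4 :> R by have := pihalf_lt2 R; lra.
have yc i : circle (y i) by rewrite yE; exact: circle_cis.
have gc l : circle (grid_point (R := R) k l) by exact: circle_cis.
apply: le_trans (_ : \sum_l (dcirc (grid_point k l) (z (s l)) + dcirc (z (s l)) (y (s l))) <= _).
  by apply: ler_sum => l _; apply: dcirc_triangle.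
rewrite big_split /= (sum_perm s (fun i => dcirc (z i) (y i))).
suff : \sum_(l < N) dcirc (grid_point k l) (z (s l)) <= 2 * align_cost z s k.
  by have := align_cost_le; lra.
rewrite /align_cost mulr_sumr; apply: ler_sum => l _.
have h1 := dcirc_le_chord (gc l) (zc (s l)).
have h2 := norm2_le_norm1 (grid_point k l - z (s l)).
have h3 := norm2_R2_ge0 (grid_point k l - z (s l)).
by have := ler_wpM2r h3 p4; lra.
Qed.

End LocalizationOutput.

(** * Refinement of a localized sample *)

Section GeometricSignal.
Context {R : realType} (n : nat) (cl cL ce : R) (f : 'cV[R]_2 -> 'cV[R]_2 -> R).
Context (hf : biLipschitz n cl cL ce f) (hgeo : geometric_fun f).
Context (cl0 : 0 < cl) (cL0 : 0 <= cL) (ce0 : 0 <= ce).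
Local Notation rr := (rate (R := R) n).

(** The even and periodic function of the angle to which the circulant lemmas apply, in place of g
    on [0, pi]. *)
Definition profile (t : R) : R := f (cis t) (cis 0).

Lemma signal_dot x y x' y' : circle x -> circle y -> circle x' -> circle y' ->
  dot2 x y = dot2 x' y' -> f x y = f x' y'.
Proof.
have [g [_ hg]] := hgeo => cx cy cx' cy' e.
by rewrite !hg // !dcircE // e.
Qed.

Lemma signal_profile a b : f (cis a) (cis b) = profile (a - b).
Proof.
by apply: signal_dot; rewrite ?dot2_cis ?subr0 //; exact: circle_cis.
Qed.

Lemma signal_orth (Q : 'M[R]_2) x y : orthogonal2 Q -> circle x -> circle y ->
  f (Q *m x) (Q *m y) = f x y.
Proof.
by move=> oQ cx cy; apply: signal_dot => //; rewrite ?dot2_orth //; apply: circle_orth.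
Qed.

Lemma profile_per t : profile (t + 2 * pi) = profile t.
Proof. by rewrite /profile cis_periodic. Qed.

Lemma profile_even t : profile (- t) = profile t.
Proof.
by apply: signal_dot; rewrite ?dot2_cis ?subr0 ?cosN //; exact: circle_cis.
Qed.

Lemma profile01 t : 0 <= profile t <= 1.
Proof. by have [h _ _ _] := hf; apply: h; exact: circle_cis. Qed.

Lemma signal_lip x x' y y' : circle x -> circle x' -> circle y -> circle y' ->
  `|f x y - f x' y'| <= cL * (dcirc x x' + dcirc y y') + 2 * (ce * rr).
Proof.
have [_ sym lip _] := hf => cx cx' cy cy'.
have h1 := lip _ _ _ cx cy cy'.
have h2 := lip _ _ _ cy' cx cx'.
rewrite (sym _ _ cy' cx) (sym _ _ cy' cx') in h2.
have -> : f x y - f x' y' = (f x y - f x y') + (f x y' - f x' y') by ring.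
by apply: le_trans (ler_normD _ _) _; lra.
Qed.

Lemma profile_lip s t : `|profile s - profile t| <= cL * `|s - t| + ce * rr.
Proof.
have [_ sym lip _] := hf.
have h := lip _ _ _ (circle_cis 0) (circle_cis s) (circle_cis t).
rewrite (sym _ _ (circle_cis 0) (circle_cis s)) (sym _ _ (circle_cis 0) (circle_cis t)) in h.
apply: le_trans h _; rewrite lerD2r ler_wpM2l //.
exact: dcirc_cis_le.
Qed.

Lemma rate_ge0 : 0 <= rr.
Proof. exact: sqrtr_ge0. Qed.

Lemma profile_mono s t : 0 <= s -> s <= t -> t <= pi -> profile t <= profile s + ce * rr.
Proof.
move=> s0 st tp; have [_ sym _ mono] := hf.
have d0 u : 0 <= u <= pi -> dcirc (cis 0) (cis u) = u :> R.
  move=> hu; rewrite dcircE; [|exact: circle_cis..].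
  by rewrite dot2_cis sub0r cosN cosK // in_itv.
have := mono _ _ _ (circle_cis 0) (circle_cis t) (circle_cis s).
rewrite !d0; [|lra..] => /(_ st).
rewrite (sym _ _ (circle_cis 0) (circle_cis s)) (sym _ _ (circle_cis 0) (circle_cis t)).
have : 0 <= cl * (t - s) by rewrite mulr_ge0 ?subr_ge0 // ltW.
by rewrite /profile; lra.
Qed.

(** The lower condition multiplied by the difference of distances; in this form it is symmetric in x
    and y, so no order has to be assumed. *)
Lemma signal_gap x y w : circle x -> circle y -> circle w ->
  cl * (dcirc x w - dcirc y w) ^+ 2 - ce * rr * `|dcirc x w - dcirc y w|
    <= (f y w - f x w) * (dcirc x w - dcirc y w).
Proof.
have [_ sym _ mono] := hf.
have H x' y' : circle x' -> circle y' -> circle w -> dcirc y' w <= dcirc x' w ->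
    cl * (dcirc x' w - dcirc y' w) ^+ 2 - ce * rr * `|dcirc x' w - dcirc y' w|
    <= (f y' w - f x' w) * (dcirc x' w - dcirc y' w).
  move=> cx cy cw h; have := mono _ _ _ cw cx cy.
  rewrite (dcircC cw cx) (dcircC cw cy) (sym _ _ cw cx) (sym _ _ cw cy) => /(_ h) hm.
  have D0 : 0 <= dcirc x' w - dcirc y' w by rewrite subr_ge0.
  by rewrite ger0_norm //; have := ler_wpM2r D0 hm; lra.
move=> cx cy cw; have [h|h] := leP (dcirc y w) (dcirc x w); first exact: H.
have := H _ _ cy cx cw (ltW h); rewrite distrC.
have -> : (dcirc y w - dcirc x w) ^+ 2 = (dcirc x w - dcirc y w) ^+ 2 by ring.
have -> : (f x w - f y w) * (dcirc y w - dcirc x w) =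
  (f y w - f x w) * (dcirc x w - dcirc y w) by ring.
by [].
Qed.

Context (N : nat) (N2 : (2 < N)%N).
Let NR : (0 : R) < N%:R. Proof. by rewrite ltr0n (leq_trans _ N2). Qed.

(* The reflection of the grid exchanging y and z turns the excess cost into a
   sum of products of increments of f and of the distance. *)
Lemma grid_reflection (a b : nat) (y z : 'cV[R]_2) :
  y = cis (ang N a) -> z = cis (ang N b) ->
  2 * \sum_(j < N) f y (cis (ang N j)) * (dcirc z (cis (ang N j)) - dcirc y (cis (ang N j))) =
  \sum_(j < N) (f y (cis (ang N j)) - f z (cis (ang N j))) *
     (dcirc z (cis (ang N j)) - dcirc y (cis (ang N j))).
Proof.
move=> yE zE; pose D t := acos (cos t) : R.
have dE s t : dcirc (cis s) (cis t) = D (s - t).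
  by rewrite dcircE ?dot2_cis //; exact: circle_cis.
have Dper t : D (t + 2 * pi) = D t by rewrite /D mulr_natl cosD2pi.
have Deven t : D (- t) = D t by rewrite /D cosN.
have refl (c e : nat) : \sum_(j < N) profile (ang N c - ang N j) * D (ang N e - ang N j) =
    \sum_(j < N) profile (ang N e - ang N j) * D (ang N c - ang N j).
  pose phi t := profile (ang N c - t) * D (ang N e - t).
  transitivity (\sum_(j < N) phi (ang N j)) => //.
  rewrite -(sum_reflect N (c + e)).
    apply: eq_bigr => j _; rewrite /phi angD.
    by rewrite -profile_even -Deven; congr (profile _ * D _); ring.
  have pB u : profile (u - 2 * pi) = profile u by rewrite -profile_per subrK.
  have DB u : D (u - 2 * pi) = D u by rewrite -Dper subrK.
  by move=> t; rewrite /phi !opprD !addrA pB DB.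
have diag (c : nat) : \sum_(j < N) profile (ang N c - ang N j) * D (ang N c - ang N j) =
    \sum_(j < N) profile (ang N j) * D (ang N j).
  rewrite (@sum_reflect _ (fun t => profile t * D t)) // => t.
  by rewrite profile_per Dper.
rewrite yE zE; under eq_bigr do rewrite !signal_profile !dE mulrBr.
under [RHS]eq_bigr do rewrite !signal_profile !dE mulrBl !mulrBr.
by rewrite !sumrB (refl b a) (diag a) (diag b); ring.
Qed.

(** After the reflection, [signal_gap] bounds each term below by cl times the squared difference of
    distances, up to the rate. As cos is 1-Lipschitz, the sum of these squares is at least that of
    the squared scalar products of z - y with the grid points, which is N / 2 times |z - y|^2, at
    least N d^2 / 8. *)
Lemma grid_excess (a b : nat) (y z : 'cV[R]_2) :
  y = cis (ang N a) -> z = cis (ang N b) ->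
  cl * N%:R / 16 * dcirc y z ^+ 2 - ce * rr * N%:R / 2 * dcirc y z <=
  \sum_(j < N) f y (cis (ang N j)) * (dcirc z (cis (ang N j)) - dcirc y (cis (ang N j))).
Proof.
move=> yE zE; set d := dcirc y z; have cy : circle y by rewrite yE; exact: circle_cis.
have cz : circle z by rewrite zE; exact: circle_cis.
have cg (j : nat) : circle (cis (ang N j) : 'cV[R]_2) by exact: circle_cis.
have d0 : 0 <= d by apply: dcirc_ge0.
have p4 : pi <= 4 :> R by have := pihalf_lt2 R; lra.
have hsq : N%:R / 8 * d ^+ 2 <= \sum_(j < N) (dcirc z (cis (ang N j)) - dcirc y (cis (ang N j))) ^+ 2.
  apply: le_trans (_ : \sum_(j < N) dot2 (z - y) (cis (ang N j)) ^+ 2 <= _).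
    rewrite sum_grid_dot2 // -norm2_R2_sqr.
    have h1 := dcirc_le_chord cy cz; rewrite -/d in h1.
    have nzy : norm2_R2 (z - y) = norm2_R2 (y - z) by rewrite !norm2_nrm -nrmN opprB.
    have h2 : d / 2 <= norm2_R2 (z - y).
      by have := ler_wpM2r (norm2_R2_ge0 (y - z)) p4; rewrite nzy; lra.
    have h3 : (d / 2) ^+ 2 <= norm2_R2 (z - y) ^+ 2.
      by rewrite !expr2; apply: ler_pM => //; lra.
    have := ler_wpM2l (ltW NR) h3.
    have -> : (d / 2) ^+ 2 = d ^+ 2 / 4 by field.
    by lra.
  apply: ler_sum => j _.
  have -> : dot2 (z - y) (cis (ang N j)) = cos (dcirc z (cis (ang N j))) - cos (dcirc y (cis (ang N j))).
    by rewrite !cos_dcirc // /dot2 !mxE; ring.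
  rewrite -[X in X <= _]real_normK ?num_real // -[X in _ <= X]real_normK ?num_real //.
  by rewrite ler_sqr ?nnegrE // cos_lip.
have hab : \sum_(j < N) `|dcirc z (cis (ang N j)) - dcirc y (cis (ang N j))| <= N%:R * d.
  apply: le_trans (_ : \sum_(j < N) d <= _); last by rewrite sumr_const card_ord mulr_natl.
  by apply: ler_sum => j _; rewrite distrC; apply: dcirc_lip.
have key : cl * \sum_(j < N) (dcirc z (cis (ang N j)) - dcirc y (cis (ang N j))) ^+ 2 -
    ce * rr * \sum_(j < N) `|dcirc z (cis (ang N j)) - dcirc y (cis (ang N j))| <=
    2 * \sum_(j < N) f y (cis (ang N j)) * (dcirc z (cis (ang N j)) - dcirc y (cis (ang N j))).
  rewrite (grid_reflection yE zE) !mulr_sumr -sumrB; apply: ler_sum => j _.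
  exact: signal_gap.
have := ler_wpM2l (ltW cl0) hsq.
have er : 0 <= ce * rr by rewrite mulr_ge0 ?rate_ge0.
have := ler_wpM2l er hab.
by move: key; lra.
Qed.

End GeometricSignal.

Section Refinement.
Context {R : realType} (n : nat) (cl cL ce : R) (f : 'cV[R]_2 -> 'cV[R]_2 -> R).
Context (hf : biLipschitz n cl cL ce f) (hgeo : geometric_fun f).
Context (cl0 : 0 < cl) (cL0 : 0 <= cL) (ce0 : 0 <= ce).
Local Notation rr := (rate (R := R) n).

Lemma nearest_grid N (x : 'cV[R]_2) : (0 < N)%N -> circle x ->
  exists a : 'I_N, dcirc (cis (ang N a)) x <= 8 / N%:R.
Proof.
move=> N0 /circle_cisP[t [_ ->]].
have [Q' [p' [oQ hp hQ]]] := orth_grid (1%g : 'S_N) N0 (rot_mx_orth t true).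
exists (p' (Ordinal N0)).
have := hQ _ (circle_cis 0); rewrite rot_mx_cis addr0.
have := hp (Ordinal N0); rewrite perm1 ang0 => ->.
by rewrite dcircC //; exact: circle_cis.
Qed.

Context (S : {set 'I_n}) (A : 'M[R]_n) (xs xt : 'I_n -> 'cV[R]_2) (Q : 'M[R]_2).
Local Notation N := #|S|.
Context (p : 'S_N) (B0 D0 : R) (E : 'I_n -> R) (i : 'I_n) (x2 : 'cV[R]_2).
Context (B00 : 0 <= B0) (N2 : (2 < N)%N) (hN : 1 <= 4 * N%:R * rr).
Context (hxs : forall j, circle (xs j)) (oQ : orthogonal2 Q).
Context (hxt : forall l, xt (enum_val l) = cis (ang N (p l))).
Context (hD : \sum_(j in S) dcirc (xt j) (Q *m xs j) <= D0 * N%:R * rr).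
Context (hA : forall j, j \in S -> A i j = f (xs i) (xs j) + E j).
Context (hB : forall y z, Cgrid N y -> Cgrid N z ->
  - (B0 * N%:R * rr * dcirc y z) <= \sum_(j in S) E j * (dcirc z (xt j) - dcirc y (xt j))).
Context (x2g : Cgrid N x2).
Context (hmin : forall z, Cgrid N z -> refine_cost A S xt i x2 <= refine_cost A S xt i z).

(** 16 / cl inverts the quadratic coefficient of [grid_excess]. In the bracket, 3 ce covers the 1 /
    2 + 2 from the signal, 32 cL the rounding of the true point to the grid, cL D0 the average
    localization error and B0 the noise. The final 32 is the rounding once more. *)
Definition refine_const : R := 16 / cl * (3 * ce + 32 * cL + cL * D0 + B0) + 32.

(** Compare the minimiser with the grid point [y] nearest to the true position. The excess cost is
    nonpositive, its main part is quadratic in [d], and both errors are at most linear in [d], since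
    every difference of distances is at most [d]. Dividing by [d] bounds it by the rate. *)
Lemma refine_close : dcirc x2 (Q *m xs i) <= refine_const * rr.
Proof.
have N0 : (0 < N)%N by apply: leq_trans N2.
have NR : (0 : R) < N%:R by rewrite ltr0n.
have r0 := @rate_ge0 R n.
have rpos : 0 < rr.
  rewrite lt_neqAle r0 andbT eq_sym; apply/eqP => e; move: hN; rewrite e mulr0.
  by rewrite ler10.
have cxi : circle (Q *m xs i) by apply: circle_orth.
have cx j : circle (Q *m xs j) by apply: circle_orth.
have [a ha] := nearest_grid N0 cxi.
have [b hb] := x2g.
set y := cis (ang N a) in ha.
have cy : circle y by exact: circle_cis.
have cz : circle x2 by rewrite hb; exact: circle_cis.
have ct j : j \in S -> circle (xt j).
  move=> jS; rewrite -(enum_rankK_in jS jS) hxt; exact: circle_cis.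
set d := dcirc y x2.
have d0 : 0 <= d by apply: dcirc_ge0.
have hb8 : 8 / N%:R <= 32 * rr.
  by rewrite ler_pdivrMr //; have := hN; lra.
have hy : Cgrid N y by exists a.
pose Dl j := dcirc x2 (xt j) - dcirc y (xt j).
have Dl_le j : j \in S -> `|Dl j| <= d.
  by move=> /ct ctj; rewrite /Dl distrC; apply: dcirc_lip.
have h1 : \sum_(j in S) A i j * Dl j <= 0.
  have := hmin hy; rewrite /refine_cost -subr_le0 -sumrB.
  by apply: le_trans; rewrite le_eqVlt; apply/orP; left; apply/eqP;
     apply: eq_bigr => j _; rewrite /Dl mulrBr.
have h2 : \sum_(j in S) A i j * Dl j = \sum_(j in S) f y (xt j) * Dl j +
    \sum_(j in S) (f (Q *m xs i) (Q *m xs j) - f y (xt j)) * Dl j + \sum_(j in S) E j * Dl j.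
  rewrite -!big_split; apply: eq_bigr => j jS /=.
  by rewrite hA // (signal_orth hgeo) //; ring.
have h3 : cl * N%:R / 16 * d ^+ 2 - ce * rr * N%:R / 2 * d <= \sum_(j in S) f y (xt j) * Dl j.
  have h := grid_excess hf hgeo cl0 ce0 N2 (erefl y) hb; rewrite -/d in h.
  apply: le_trans h _; rewrite [leRHS]big_enum_val /=.
  rewrite [leLHS](reindex_inj (@perm_inj _ p)) /=.
  rewrite le_eqVlt; apply/orP; left; apply/eqP; apply: eq_bigr => l _.
  by rewrite /Dl hxt.
have h4 : - (d * (cL * (N%:R * (32 * rr) + D0 * N%:R * rr) + 2 * (ce * rr) * N%:R)) <=
    \sum_(j in S) (f (Q *m xs i) (Q *m xs j) - f y (xt j)) * Dl j.
  rewrite lerNl -sumrN.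
  apply: le_trans (_ : \sum_(j in S) d * (cL * (32 * rr + dcirc (xt j) (Q *m xs j)) + 2 * (ce * rr)) <= _).
    apply: ler_sum => j jS; apply: le_trans (ler_norm _) _; rewrite normrN normrM mulrC.
    apply: ler_pM => //; first exact: Dl_le.
    apply: le_trans (signal_lip hf cxi cy (cx j) (ct j jS)) _.
    rewrite lerD2r ler_wpM2l // (dcircC (cx j) (ct j jS)) lerD2r.
    by rewrite (dcircC cxi cy); apply: le_trans ha hb8.
  rewrite -mulr_sumr ler_wpM2l // big_split /= -mulr_sumr big_split /=.
  rewrite !sumr_const -[_ *+ N]mulr_natl -[2 * _ *+ N]mulr_natl.
  have := ler_wpM2l cL0 hD; lra.
have h5 := hB hy x2g; rewrite -/d in h5.
rewrite (eq_bigr (fun j => E j * Dl j)) // in h5.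
have key : cl * N%:R / 16 * d ^+ 2 <= d * N%:R * rr * (3 * ce + 32 * cL + cL * D0 + B0).
  have : 0 <= ce * rr * N%:R * d by rewrite !mulr_ge0 // ltW.
  by lra.
have hd : d <= 16 / cl * (3 * ce + 32 * cL + cL * D0 + B0) * rr.
  have [->|dn] := eqVneq d 0.
    have D00 : 0 <= D0.
      have : 0 <= D0 * N%:R * rr.
        apply: le_trans hD; apply: sumr_ge0 => j jS.
        by apply: dcirc_ge0; [exact: ct|exact: cx].
      by rewrite -mulrA pmulr_lge0 // mulr_gt0.
    rewrite !mulr_ge0 ?invr_ge0 ?(ltW cl0) // !addr_ge0 ?mulr_ge0 //.
  have dp : 0 < d by rewrite lt_neqAle eq_sym dn.
  have hdN : 0 < d * N%:R by rewrite mulr_gt0.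
  set K := (X in 16 / cl * X * rr); rewrite -/K in key.
  have h : cl * d / 16 <= K * rr.
    by rewrite -(ler_pM2l hdN); move: key; rewrite expr2; lra.
  have -> : 16 / cl * K * rr = 16 * K * rr / cl by ring.
  by rewrite ler_pdivlMr //; lra.
apply: le_trans (dcirc_triangle cz cy cxi) _.
by rewrite (dcircC cz cy) -/d /refine_const mulrDl lerD // (le_trans ha).
Qed.
End Refinement.

Section RankMatching.
Context {R : realType} (n : nat) (sg : 'S_n) (S : {set 'I_n}).
Local Notation N := #|S|.

Definition count_below (m : nat) : nat := #|[set i in S | (sg i < m)%N]%SET|.

(** A discrepancy bound along the order of the grid, against the density 1 / 4 of the sample. *)
Definition evenly_spread (e : R) : Prop :=
  forall m, (m <= n)%N -> `|(count_below m)%:R - m%:R / 4| <= e.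

Lemma rank_perm : exists p : 'S_N, forall l, p l = count_below (sg (enum_val l)) :> nat.
Proof.
have ev (l : 'I_N) : enum_val l \in S := enum_valP l.
have lt (l : 'I_N) : (count_below (sg (enum_val l)) < N)%N.
  apply: proper_card; apply/properP; split.
    by apply/fintype.subsetP => i; rewrite inE => /andP[].
  by exists (enum_val l) => //; rewrite inE ltnn andbF.
have mono (l l' : 'I_N) : (sg (enum_val l) < sg (enum_val l'))%N ->
    (count_below (sg (enum_val l)) < count_below (sg (enum_val l')))%N.
  move=> h; apply: proper_card; apply/properP; split.
    by apply/fintype.subsetP => i; rewrite !inE => /andP[-> /ltn_trans] /=; apply.
  by exists (enum_val l); rewrite !inE ?ev ?h // ltnn andbF.
have inj : injective (fun l => Ordinal (lt l)).
  move=> l l' /(congr1 val) /= e.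
  apply: enum_val_inj; apply: (@perm_inj _ sg); apply: val_inj.
  by case: (ltngtP (sg (enum_val l)) (sg (enum_val l'))) => // /mono; rewrite e ltnn.
by exists (perm inj) => l; rewrite permE.
Qed.

(** A sampled index at position m has a rank c with |c - m / 4| <= e n. The two angles thus differ
    by at most (2 pi / N) e n = 8 pi e <= 32 e. *)
Lemma rank_close (e : R) : n = (N * 4)%N -> (0 < N)%N -> evenly_spread (e * n%:R) ->
  exists p : 'S_N, forall l,
    dcirc (cis (ang n (sg (enum_val l)))) (cis (ang N (p l))) <= 32 * e.
Proof.
move=> hn N0 hS; have [p hp] := rank_perm; exists p => l.
have NR : (0 : R) < N%:R by rewrite ltr0n.
have nR : n%:R = 4 * N%:R :> R by have := congr1 (fun m => m%:R : R) hn; rewrite /= natrM mulrC.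
have p0 := pi_gt0 R; have p4 := pihalf_lt2 R.
apply: le_trans (dcirc_cis_le _ _) _.
have := hS (sg (enum_val l)) (ltnW (ltn_ord _)); rewrite -hp.
set c := (p l)%:R; set m := (sg _)%:R => h.
have -> : ang n (sg (enum_val l)) - ang N (p l) = 2 * pi / N%:R * (m / 4 - c).
  have E (q : R) : 2 * q * m / (4 * N%:R) - 2 * q * c / N%:R = 2 * q / N%:R * (m / 4 - c).
    by field; rewrite gt_eqF.
  by rewrite /ang nR -E.
rewrite normrM distrC gtr0_norm ?divr_gt0 ?mulr_gt0 //.
apply: le_trans (_ : 2 * pi / N%:R * (e * n%:R) <= _).
  by rewrite ler_wpM2l // divr_ge0 ?mulr_ge0 // ltW.
have e0 : 0 <= e * n%:R by apply: le_trans h.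
have {}e0 : 0 <= e by move: e0; rewrite nR pmulr_lge0 // mulr_gt0.
have -> : 2 * pi / N%:R * (e * n%:R) = 8 * pi * e.
  have E (q : R) : 2 * q / N%:R * (e * (4 * N%:R)) = 8 * q * e.
    by field; rewrite gt_eqF.
  by rewrite nR E.
by rewrite ler_wpM2r //; lra.
Qed.

End RankMatching.

Section LocalizeSample.
Context {R : realType} (n : nat) (cl cL ce ca cb w0 : R) (f : 'cV[R]_2 -> 'cV[R]_2 -> R).
Context (hf : biLipschitz n cl cL ce f) (hgeo : geometric_fun f).
Context (cl0 : 0 < cl) (cL0 : 0 <= cL) (ce0 : 0 <= ce) (ca0 : 0 <= ca) (cb0 : 0 < cb).
Context (w00 : 0 <= w0).
Local Notation rr := (rate (R := R) n).
Context (xs : 'I_n -> 'cV[R]_2) (hxs : forall i, circle (xs i)).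
Context (sg : 'S_n) (hsg : forall i, dcirc (xs i) (cis (ang n (sg i))) <= ca * rr).
Local Notation F := (signal_mx f xs).
Local Notation gam := (profile f).
Context (lam : seq R) (hlam : sorted_eigenvalues F lam).
Context (hgap : cb * n%:R <= Num.min (lam`_0 - lam`_1) (lam`_2 - lam`_3)).
Context (A : 'M[R]_n) (symA : A^T = A) (diagA : forall i, A i i = 0).

Definition off_diag_noise : 'M[R]_n := \matrix_(i, j) (if i == j then 0 else A i j - F i j).

Context (hW : opn off_diag_noise (w0 * n%:R * rr)).
Context (S : {set 'I_n}).
Local Notation N := #|S|.
Context (hn : n = (N * 4)%N) (N8 : (8 <= N)%N) (hrr : 1 <= n%:R * rr).
Context (hS : evenly_spread sg S (6 * rr * n%:R)).

(** In [sample_const], 4 w0 is the noise since n = 4 N, 4 pays for the missing diagonal since 1 <= n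
    rate, and 192 = 32 * 6 is the displacement to the ranks. In [locate_const], 40 and 160 come from
    the factor 5 of [aligned_close] on a total error 8 N plane_const rate + 8, and ca + 192 is the
    distance from a point to its rank. *)
Definition full_const : R := 2 * cL * ca + 2 * ce.
Definition sample_const : R := 4 * w0 + 4 + 2 * cL * (ca + 192) + 2 * ce.
Definition plane_const : R := (8 * lip_const cL ce + 4 * sample_const) / cb.
Definition locate_const : R := 40 * plane_const + 160 + ca + 192.

Context (small1 : (2 * ce + 2 * full_const) * rr < cb).
Context (small2 : (4 * lip_const cL ce + 2 * full_const) * rr <= cb / 2).
Context (small3 : plane_const * rr <= 1 / 2).

Let r0 : 0 <= rr. Proof. exact: rate_ge0. Qed.
Let NR : (0 : R) < N%:R. Proof. by rewrite ltr0n (leq_trans _ N8). Qed.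
Let nR : n%:R = 4 * N%:R :> R. Proof. by have := congr1 (fun m => m%:R : R) hn; rewrite /= natrM mulrC. Qed.

Lemma signal_mx_sym : F^T = F.
Proof. by apply/matrixP => i j; rewrite !mxE; have [_ -> ] := hf. Qed.

Lemma full_opn : opn (F - circ_mx gam sg) (full_const * n%:R * rr).
Proof.
have -> : full_const * n%:R * rr = n%:R * (full_const * rr) by ring.
apply: opn_entry => i j; rewrite !mxE -signal_profile //.
apply: le_trans (signal_lip hf (hxs i) (circle_cis _) (hxs j) (circle_cis _)) _.
have := ler_wpM2l cL0 (lerD (hsg i) (hsg j)); rewrite /full_const; lra.
Qed.

(** Three errors: the noise block, the diagonal of F that A lacks, and the displacement of the
    points to the grid of ranks. The last is bounded entrywise. *)
Lemma sample_opn (p : 'S_N) :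
  (forall l, dcirc (xs (enum_val l)) (cis (ang N (p l))) <= (ca + 192) * rr) ->
  opn (submx_of S A - circ_mx gam p) (sample_const * N%:R * rr).
Proof.
move=> hp.
pose D : 'rV[R]_N := \row_l F (enum_val l) (enum_val l).
have -> : submx_of S A - circ_mx gam p = mxsub enum_val enum_val off_diag_noise
    + (- diag_mx D) + (mxsub enum_val enum_val F - circ_mx gam p).
  apply/matrixP => l l'; rewrite !mxE (inj_eq enum_val_inj).
  case: eqVneq => [->|_]; last by rewrite mulr0n; ring.
  by rewrite diagA mulr1n; ring.
apply: (@opn_le _ _ _ (w0 * n%:R * rr + 1 + N%:R * ((2 * cL * (ca + 192) + 2 * ce) * rr))).
  by rewrite /sample_const; move: hrr; rewrite nR; lra.
apply: opnD; [apply: opnD|].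
- by apply: opn_mxsub => //; exact: enum_val_inj.
- apply: opnN; apply: opn_diag => // l; rewrite !mxE.
  have [h _ _ _] := hf; have := h _ _ (hxs (enum_val l)) (hxs (enum_val l)).
  by case/andP => a b; rewrite ger0_norm.
- apply: opn_entry => l l'; rewrite !mxE -signal_profile //.
  apply: le_trans (signal_lip hf (hxs _) (circle_cis _) (hxs _) (circle_cis _)) _.
  by have := ler_wpM2l cL0 (lerD (hp l) (hp l')); lra.
Qed.

Lemma sample_localized xt : spectral_localization (submx_of S A) xt ->
  exists (Q : 'M[R]_2) (p2 : 'S_N), [/\ orthogonal2 Q,
    forall l, xt (enum_val l) = cis (ang N (p2 l))
  & \sum_(j in S) dcirc (xt j) (Q *m xs j) <= locate_const * N%:R * rr].
Proof.
have N0 : (0 < N)%N by apply: leq_trans N8.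
have N2 : (2 < N)%N by apply: leq_trans N8.
have [p hp0] := rank_close hn N0 hS.
have hp l : dcirc (xs (enum_val l)) (cis (ang N (p l))) <= (ca + 192) * rr.
  have := dcirc_triangle (hxs (enum_val l)) (circle_cis (ang n (sg (enum_val l)))) (circle_cis (ang N (p l))).
  by have := hsg (enum_val l); have := hp0 l; lra.
have hM := sample_opn hp.
have symM : (submx_of S A)^T = submx_of S A.
  by apply/matrixP => l l'; rewrite !mxE -{1}symA mxE.
have E10 : 0 <= sample_const.
  by rewrite /sample_const !addr_ge0 ?mulr_ge0 ?addr_ge0.
have E00 : 0 <= full_const by rewrite /full_const addr_ge0 ?mulr_ge0.
have gper := profile_per f; have geven := profile_even hgeo.
have g01 := profile01 hf; have glip := profile_lip hf cL0.
have gmono := profile_mono hf cl0.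
have n8 : (8 <= n)%N by rewrite hn; apply: leq_trans N8 _; rewrite leq_pmulr.
have even_n : ~~ odd n by rewrite hn oddM andbF.
have [gap1 gap2] : cb * n%:R <= lam`_0 - lam`_1 /\ cb * n%:R <= lam`_2 - lam`_3.
  by move: hgap; rewrite le_min => /andP[].
have g0 := eigmu_gap0 gper geven g01 n8 signal_mx_sym hlam full_opn gap1.
have g1 := eigmu_gap1 gper geven g01 n8 signal_mx_sym hlam full_opn gmono even_n gap1 gap2 small1.
have gm := eigmu1_max gper geven g01 n8 gmono even_n.
have plane := @eigenvector_near_plane _ gam cL ce rr full_const cb N gper geven g01 glip cL0 ce0 r0 N8.
rewrite -hn in plane.
case=> X [z [s [k [[lamM [u [v [hlamM [Mu Mv] [uu vv uv] XE]]]] hz htrig hk xtE]]]].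
have d11 (a b : 'cV[R]_N) (c : R) : a^T *m b = c%:M -> dotv a b = c.
  by rewrite dotvE => ->; rewrite mxE eqxx mulr1n.
have duv : dotv u v = 0 by rewrite dotvE uv mxE.
have pu := plane hrr gm g0 g1 p _ lamM sample_const symM hlamM E10 hM small2 cb0 1%N u isT Mu (d11 _ _ _ uu).
have pv := plane hrr gm g0 g1 p _ lamM sample_const symM hlamM E10 hM small2 cb0 2%N v isT Mv (d11 _ _ _ vv).
set dl := plane_const * rr in pu pv.
have dlh : dl <= 1 / 2 := small3.
have lip0 : 0 <= lip_const cL ce by rewrite /lip_const !addr_ge0 ?mulr_ge0.
have pc0 : 0 <= plane_const.
  by rewrite /plane_const divr_ge0 ?(ltW cb0) // addr_ge0 ?mulr_ge0.
have dl0 : 0 <= dl by rewrite mulr_ge0.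
have dl01 : 0 <= dl <= 1 / 2 by rewrite dl0 dlh.
have [Q oQ hQ] := eigenvectors_near_orth N2 dl01 (d11 _ _ _ uu) (d11 _ _ _ vv) duv pu pv.
have XcE i : col i X = \col_(k < 2) (Num.sqrt (N%:R / 2) * (if k == 0 then u i 0 else v i 0)).
  by apply/matrixP => a b; rewrite XE !mxE.
have cw i : circle (cis (ang N (p i)) : 'cV[R]_2) by exact: circle_cis.
have cQw i : circle (Q *m cis (ang N (p i))) by apply: circle_orth.
have cz i : circle (z i) by have [] := hz i.
(* The Cauchy-Schwarz inequality turns the squared bound 4 N dl^2 into the sum 2 N dl; the further
   factor 4 comes from normalising and from passing from chords to arcs. *)
have zQ : \sum_i dcirc (z i) (Q *m cis (ang N (p i))) <= 8 * N%:R * dl.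
  have p4 : pi <= 4 :> R by have := pihalf_lt2 R; lra.
  apply: le_trans (_ : \sum_i 4 * nrm (col i X - Q *m cis (ang N (p i))) <= _).
    apply: ler_sum => i _; have [_ hzi] := hz i.
    have h1 := normalize_le (cQw i) (cz i) hzi.
    have h2 := dcirc_le_chord (cz i) (cQw i).
    have h3 := norm2_R2_ge0 (z i - Q *m cis (ang N (p i))).
    rewrite -norm2_nrm; have := ler_wpM2r h3 p4; lra.
  rewrite -mulr_sumr.
  suff h : \sum_i nrm (col i X - Q *m cis (ang N (p i))) <= 2 * N%:R * dl by lra.
  have s0 : 0 <= \sum_i nrm (col i X - Q *m cis (ang N (p i))).
    by apply: sumr_ge0 => i _; exact: nrm_ge0.
  rewrite -ler_sqr ?nnegrE //; last by apply: mulr_ge0 => //; apply: mulr_ge0.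
  have -> : \sum_i nrm (col i X - Q *m cis (ang N (p i))) =
     \sum_i nrm (col i X - Q *m cis (ang N (p i))) * 1.
    by apply: eq_bigr => i _; rewrite mulr1.
  apply: le_trans (Cauchy_Schwarz_sum _ _) _.
  under [X in _ * X]eq_bigr do rewrite expr1n.
  rewrite sumr_const card_ord.
  under eq_bigr do rewrite nrm_sqr XcE.
  have := ler_wpM2r (ltW NR) hQ.
  by have -> : (2 * N%:R * dl) ^+ 2 = 4 * N%:R * dl ^+ 2 * N%:R by ring.
have [Q' [p' [oQ' hp' hQQ']]] := orth_grid p N0 oQ.
pose y i := cis (ang N (p' i)) : 'cV[R]_2.
have zy : \sum_i dcirc (z i) (y i) <= 8 * N%:R * dl + 8.
  apply: le_trans (_ : \sum_i (dcirc (z i) (Q *m cis (ang N (p i))) + 8 / N%:R) <= _).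
    apply: ler_sum => i _; apply: le_trans (dcirc_triangle (cz i) (cQw i) (circle_cis _)) _.
    by rewrite lerD2l -hp'; apply: hQQ'.
  rewrite big_split /=; apply: lerD; first exact: zQ.
  rewrite sumr_const card_ord -[X in X <= _]mulr_natl.
  by rewrite mulrCA divff ?mulr1 // gt_eqF.
have al := aligned_close cz (fun i => erefl (y i)) htrig hk.
have xtc l : xt (enum_val l) = grid_point k (s^-1%g l) by rewrite -xtE permKV.
pose q (l : 'I_N) := ((k.+1 + (s^-1%g l).+1) %% N)%N.
have ltq l : (q l < N)%N by rewrite ltn_pmod.
have injq : injective (fun l => Ordinal (ltq l)).
  move=> l l' /(congr1 val) /= /eqP; rewrite eqn_modDl.
  rewrite -(addn1 (s^-1%g l)) -(addn1 (s^-1%g l')) eqn_modDr !modn_small //.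
  by move=> /eqP /val_inj /perm_inj.
exists Q', (perm injq); split => //.
  by move=> l; rewrite xtc [perm injq _]permE; exact: esym (@cis_ang_mod R N (k.+1 + (s^-1%g l).+1) N0).
rewrite big_enum_val /= [leLHS](reindex_inj (@perm_inj _ s)) /=.
apply: le_trans (_ : \sum_l (dcirc (grid_point k l) (y (s l)) + (ca + 192) * rr) <= _).
  apply: ler_sum => l _; rewrite xtE.
  have cQ' : circle (Q' *m xs (enum_val (s l))) by apply: circle_orth.
  apply: le_trans (dcirc_triangle (circle_cis _) (circle_cis (ang N (p' (s l)))) cQ') _.
  rewrite lerD2l -hp' dcirc_orth // dcircC //.
rewrite big_split /= sumr_const card_ord -[_ *+ N]mulr_natl /locate_const.
move: al zy hrr; rewrite nR /dl; lra.
Qed.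

Definition final_refine_const (B0 : R) : R := refine_const cl cL ce B0 locate_const.

Lemma sample_refined (B0 : R) xt x2 : 0 <= B0 -> spectral_localization (submx_of S A) xt ->
  (forall i y z, i \notin S -> Cgrid N y -> Cgrid N z ->
    - (B0 * N%:R * rr * dcirc y z) <=
    \sum_(j in S) (A i j - F i j) * (dcirc z (xt j) - dcirc y (xt j))) ->
  refinement N A S xt x2 ->
  exists2 Q : 'M[R]_2, orthogonal2 Q &
    forall i, i \notin S -> circle (x2 i) /\ dcirc (x2 i) (Q *m xs i) <= final_refine_const B0 * rr.
Proof.
move=> B00 hxt hB hx2; have [Q [p2 [oQ xtE hD]]] := sample_localized hxt.
exists Q => // i iS; have [x2g hmin] := hx2 i iS; split.
  by case: x2g => j ->; exact: circle_cis.
have N2 : (2 < N)%N by apply: leq_trans N8.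
have hN : 1 <= 4 * N%:R * rr by move: hrr; rewrite nR.
have hA j : j \in S -> A i j = f (xs i) (xs j) + (A i j - F i j) by rewrite !mxE => _; ring.
have hB' y z (gy : Cgrid N y) (gz : Cgrid N z) := hB i y z iS gy gz.
exact: (refine_close hf hgeo cl0 cL0 ce0 B00 N2 hN hxs oQ xtE hD hA hB' x2g hmin).
Qed.

End LocalizeSample.

(** * Alignment of the two halves *)

Section TwoPointRigidity.
Context {R : realType}.

Definition det2 (x y : 'cV[R]_2) : R := x 0 0 * y 1 0 - x 1 0 * y 0 0.

Lemma det2_cis a b : det2 (cis a) (cis b) = sin (b - a).
Proof. by rewrite /det2 !cisE0 !cisE1 sinB; ring. Qed.

Lemma det2_le1 x y : circle x -> circle y -> `|det2 x y| <= 1.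
Proof.
move=> /circle_cisP[a [_ ->]] /circle_cisP[b [_ ->]].
by rewrite det2_cis sin_max.
Qed.

(** By Cramer's rule v is a combination of x and y, with coefficients at most 1 divided by a
    determinant at least 1 / 2. So the chord moves by at most 4 tau, and the arc by at most 8
    tau. *)
Lemma rigidity (O : 'M[R]_2) (x y v : 'cV[R]_2) (tau : R) : orthogonal2 O ->
  circle x -> circle y -> circle v -> 1 / 2 <= det2 x y ->
  dcirc (O *m x) x <= tau -> dcirc (O *m y) y <= tau -> dcirc (O *m v) v <= 8 * tau.
Proof.
move=> oO cx cy cv hdet hx hy.
have cO w : circle w -> circle (O *m w) by move=> cw; apply: circle_orth.
have nle w : circle w -> dcirc (O *m w) w <= tau -> nrm (O *m w - w) <= tau.
  by move=> cw; apply: le_trans; rewrite -norm2_nrm; apply: chord_le_dcirc => //; exact: cO.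
have d0 : 0 < det2 x y by lra.
have key : det2 x y *: (O *m v - v) = det2 v y *: (O *m x - x) + det2 x v *: (O *m y - y).
  have e : det2 x y *: v = det2 v y *: x + det2 x v *: y.
    by apply: vec2P; rewrite !mxE /det2; ring.
  by rewrite !scalerBr !scalemxAr e mulmxDr -!scalemxAr addrACA opprD.
have h : det2 x y * nrm (O *m v - v) <= tau + tau.
  have -> : det2 x y * nrm (O *m v - v) = nrm (det2 x y *: (O *m v - v)).
    by rewrite nrmZ gtr0_norm.
  rewrite key; apply: le_trans (nrmD _ _) _; rewrite !nrmZ.
  apply: lerD; rewrite -[leRHS]mul1r; apply: ler_pM => //; try exact: nrm_ge0;
    by [exact: det2_le1|exact: nle].
have h2 := dcirc_le_chord (cO v cv) cv; rewrite norm2_nrm in h2.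
have p4 : pi <= 4 :> R by have := pihalf_lt2 R; lra.
have n0 := nrm_ge0 (O *m v - v).
have := ler_wpM2r n0 p4; have := ler_wpM2r n0 hdet; lra.
Qed.

End TwoPointRigidity.

Section Overlap.
Context {R : realType} (n : nat) (sg : 'S_n) (S S' : {set 'I_n}) (e : R).
Context (dS : S' \subset ~: S).
Context (hS : evenly_spread sg S e) (hS' : evenly_spread sg S' e).

Lemma card_initial m : (m <= n)%N -> #|[set i | (sg i < m)%N]%SET| = m.
Proof.
move=> mn; rewrite -sum1_card (eq_bigl (fun i => (sg i < m)%N)); last by move=> i; rewrite inE.
transitivity (\sum_(j < n | (j < m)%N) 1)%N.
  by rewrite [RHS](reindex_inj (@perm_inj _ sg)).
by rewrite -(big_ord_widen n (fun _ => 1%N)) // sum1_card card_ord.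
Qed.

Lemma overlap_point (a h : nat) : (a + h <= n)%N -> 4 * e < h%:R / 2 ->
  exists i, [/\ i \notin S, i \notin S' & (a <= sg i < a + h)%N].
Proof.
move=> ahn he.
pose X m := [set i | (sg i < m)%N]%SET; pose D := ~: S :&: ~: S'.
have split m : (m <= n)%N ->
    m%:R = (count_below sg S m)%:R + (count_below sg S' m)%:R + #|X m :&: D|%:R :> R.
  move=> mn; rewrite -!natrD; congr (_%:R).
  rewrite -{1}(card_initial mn) -/(X m) -(cardsID S (X m)) -addnA; congr (_ + _)%N.
    by apply: eq_card => i; rewrite !inE andbC.
  rewrite -(cardsID S' (X m :\: S)); congr (_ + _)%N.
    apply: eq_card => i; rewrite !inE; case: (boolP (i \in S')) => iS'; rewrite ?andbF //=.
    have := fintype.subsetP dS i iS'; rewrite inE => ->.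
    by rewrite andbT.
  by apply: eq_card => i; rewrite !inE; do !case: (_ \in _) => //=; rewrite ?andbF ?andbT.
have a_n : (a <= n)%N by apply: leq_trans ahn; rewrite leq_addr.
have h1 := hS ahn; have h2 := hS a_n; have h3 := hS' ahn; have h4 := hS' a_n.
have e1 := split _ ahn; have e2 := split _ a_n.
have lt : (#|X a :&: D| < #|X (a + h)%N :&: D|)%N.
  rewrite -(ltr_nat R); rewrite natrD in e1 h1 h3.
  by move: h1 h2 h3 h4; rewrite !ler_norml; lra.
have /subsetPn[i] : ~~ (X (a + h)%N :&: D \subset X a :&: D).
  by apply: contraL lt => /subset_leq_card; rewrite -leqNgt.
rewrite !inE => /andP[ih /andP[iS iS']]; rewrite iS iS' !andbT -leqNgt => ai.
by exists i; rewrite ai ih.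
Qed.

End Overlap.

Section Alignment.
Context {R : realType} (n : nat) (ca rho rr : R) (sg : 'S_n) (S S' : {set 'I_n}).
Context (xs x2 x2' xhat : 'I_n -> 'cV[R]_2) (Q1 Q2 Qh : 'M[R]_2).
Local Notation N := #|S|.
Context (ca0 : 0 <= ca) (rho0 : 0 <= rho) (rr0 : 0 <= rr) (rr1 : rr <= 1 / 1000).
Context (hn : n = (N * 4)%N) (N8 : (8 <= N)%N) (dS : S' \subset ~: S).
Context (hxs : forall i, circle (xs i)).
Context (hsg : forall i, dcirc (xs i) (cis (ang n (sg i))) <= ca * rr).
Context (hS : evenly_spread sg S (6 * rr * n%:R)) (hS' : evenly_spread sg S' (6 * rr * n%:R)).
Context (oQ1 : orthogonal2 Q1) (oQ2 : orthogonal2 Q2) (oQh : orthogonal2 Qh).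
Context (h1 : forall i, i \notin S -> circle (x2 i) /\ dcirc (x2 i) (Q1 *m xs i) <= rho * rr).
Context (h2 : forall i, i \notin S' -> circle (x2' i) /\ dcirc (x2' i) (Q2 *m xs i) <= rho * rr).
Context (hQh : forall Q', orthogonal2 Q' ->
  dinf_on (~: S :&: ~: S') x2 (orth_act Qh x2') <= dinf_on (~: S :&: ~: S') x2 (orth_act Q' x2')).
Context (hout : forall j, j \notin S -> xhat j = x2 j).
Context (hin : forall j, j \in S -> xhat j = Qh *m x2' j).

Definition align_const : R := rho + 8 * (4 * rho + 2 * ca).

Let NR : (0 : R) < N%:R. Proof. by rewrite ltr0n (leq_trans _ N8). Qed.
Let nR : n%:R = 4 * N%:R :> R.
Proof. by have := congr1 (fun m => m%:R : R) hn; rewrite /= natrM mulrC. Qed.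

Let rr_rho : 0 <= rho * rr. Proof. exact: mulr_ge0. Qed.

(** The map Q1 Q2^T competes in the alignment with error at most 2 rho rate, so the minimiser does
    no worse on the overlap. Passing from estimates to true points on both sides adds another 2 rho
    rate. *)
Lemma overlap_aligned i : i \notin S -> i \notin S' ->
  dcirc (Q1 *m xs i) (Qh *m (Q2 *m xs i)) <= 4 * rho * rr.
Proof.
move=> iS iS'; have [c2 e2] := h1 iS; have [c2' e2'] := h2 iS'.
have oQc : orthogonal2 (Q1 *m Q2^T) by apply: orthogonal2_mul => //; exact: orthogonal2_tr.
have bound : dinf_on (~: S :&: ~: S') x2 (orth_act (Q1 *m Q2^T) x2') <= 2 * rho * rr.
  apply: bigmax_le => [|j]; first by rewrite -mulrA mulr_ge0.
  rewrite !inE => /andP[jS jS']; have [cj ej] := h1 jS; have [cj' ej'] := h2 jS'.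
  have cQ1 : circle (Q1 *m xs j) by apply: circle_orth.
  have cQ2 : circle (Q2 *m xs j) by apply: circle_orth.
  have cc : circle (Q1 *m Q2^T *m x2' j) by apply: circle_orth.
  apply: le_trans (dcirc_triangle cj cQ1 cc) _.
  have -> : Q1 *m xs j = Q1 *m Q2^T *m (Q2 *m xs j).
    by rewrite -mulmxA [Q2^T *m _]mulmxA oQ2 mul1mx.
  rewrite (dcirc_orth oQc) // (dcircC cQ2 cj').
  have -> : Q1 *m Q2^T *m (Q2 *m xs j) = Q1 *m xs j.
    by rewrite -mulmxA [Q2^T *m _]mulmxA oQ2 mul1mx.
  by lra.
have hi : dcirc (x2 i) (Qh *m x2' i) <= 2 * rho * rr.
  apply: le_trans (le_trans (hQh oQc) bound).
  by apply: (@le_bigmax_cond _ _ _ _ _ _ (fun j => dcirc (x2 j) (Qh *m x2' j))); rewrite !inE iS iS'.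
have cQ1 : circle (Q1 *m xs i) by apply: circle_orth.
have cQ2 : circle (Q2 *m xs i) by apply: circle_orth.
have ch : circle (Qh *m x2' i) by apply: circle_orth.
have chh : circle (Qh *m (Q2 *m xs i)) by apply: circle_orth.
have := dcirc_triangle cQ1 c2 chh; have := dcirc_triangle c2 ch chh.
rewrite (dcirc_orth oQh) // (dcircC cQ1 c2); lra.
Qed.

(** The windows of length about N / 2 that start at 0 and at N, a quarter turn later, provide two
    overlap points whose angles differ by between pi / 4 and 3 pi / 4. The sine of the difference is
    at least 1 / 2, and [rigidity] applies at the grid points [w i], which costs 2 ca more than at
    the true ones. An index of S is outside S', so its second estimate is controlled. *)
Lemma alignment_close : dist_orth xhat xs <= align_const * rr.
Proof.
have p0 := pi_gt0 R.
pose h := (N %/ 2)%N.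
have hN : N%:R - 1 <= 2 * h%:R :> R.
  have : (N <= 2 * h + 1)%N by rewrite /h; clear; lia.
  by rewrite -(ler_nat R) natrD natrM; lra.
have hN2 : 2 * h%:R <= N%:R :> R.
  by rewrite -natrM ler_nat /h; clear; lia.
have N8R : 8 <= N%:R :> R by rewrite (ler_nat _ 8).
have he : 4 * (6 * rr * n%:R) < h%:R / 2.
  by have := ler_wpM2r (ltW NR) rr1; rewrite nR; lra.
have hNN : (h <= N)%N by rewrite /h leq_div.
have hle : (0 + h <= n)%N.
  by rewrite add0n; apply: leq_trans hNN _; have := hn; clear; lia.
have hle' : (N + h <= n)%N by have := hn; move: hNN; clear; lia.
have [i1 [i1S i1S' /andP[_ i1h]]] := overlap_point dS hS hS' hle he.
have [i2 [i2S i2S' /andP[i2a i2h]]] := overlap_point dS hS hS' hle' he.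
pose O := Q1^T *m (Qh *m Q2).
have oO : orthogonal2 O.
  by apply: orthogonal2_mul; [exact: orthogonal2_tr|exact: orthogonal2_mul].
have Q1O x : Q1 *m (O *m x) = Qh *m (Q2 *m x).
  by rewrite /O !mulmxA (mulmx1C oQ1) mul1mx.
pose w i := cis (ang n (sg i)) : 'cV[R]_2.
have cw i : circle (w i) by exact: circle_cis.
have tauP i : i \notin S -> i \notin S' -> dcirc (O *m w i) (w i) <= (4 * rho + 2 * ca) * rr.
  move=> iS iS'; have := overlap_aligned iS iS'.
  rewrite -Q1O (dcirc_orth oQ1) //; last exact: circle_orth.
  have cOw : circle (O *m w i) by apply: circle_orth.
  have cOx : circle (O *m xs i) by apply: circle_orth.
  have := dcirc_triangle cOw cOx (cw i); have := dcirc_triangle cOx (hxs i) (cw i).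
  rewrite (dcirc_orth oO) // (dcircC (cw i) (hxs i)) (dcircC cOx (hxs i)).
  have := hsg i; rewrite -/(w i); lra.
have det : 1 / 2 <= det2 (w i1) (w i2).
  rewrite det2_cis.
  set t := ang n (sg i2) - ang n (sg i1).
  have tE : t = (pi / 2) * (((sg i2)%:R - (sg i1)%:R) / N%:R).
    have E (q a b : R) : 2 * q * a / (4 * N%:R) - 2 * q * b / (4 * N%:R) = (q / 2) * ((a - b) / N%:R).
      by field; rewrite gt_eqF.
    by rewrite /t /ang nR E.
  have s1 : (sg i1)%:R <= h%:R :> R by rewrite ler_nat ltnW.
  have s1' : 0 <= (sg i1)%:R :> R by [].
  have s2 : N%:R <= (sg i2)%:R :> R by rewrite ler_nat.
  have s2' : (sg i2)%:R <= N%:R + h%:R :> R by rewrite -natrD ler_nat ltnW.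
  have u1 : (1 / 2 : R) <= ((sg i2)%:R - (sg i1)%:R) / N%:R by rewrite ler_pdivlMr //; lra.
  have u2 : ((sg i2)%:R - (sg i1)%:R) / N%:R <= 3 / 2 :> R by rewrite ler_pdivrMr //; lra.
  set q : R := _ / N%:R in tE u1 u2.
  have pq1 := ler_wpM2l (ltW p0) u1; have pq2 := ler_wpM2l (ltW p0) u2.
  have [tp|tp] := leP t (pi / 2).
    have := @sin_concave_ge _ t; rewrite tp andbT => /(_ _) H.
    have {}H : t * 2 <= sin t * pi by apply: H; lra.
    by rewrite -(ler_pM2r p0); lra.
  have := @sin_concave_ge _ (pi - t) => /(_ _) H.
  have {}H : (pi - t) * 2 <= sin (pi - t) * pi by apply: H; lra.
  have sE : sin (pi - t) = sin t.
    by rewrite addrC sinDpi sinN opprK.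
  by rewrite sE in H; rewrite -(ler_pM2r p0); lra.
have Oall j : dcirc (O *m xs j) (xs j) <= 8 * ((4 * rho + 2 * ca) * rr).
  exact: (rigidity oO (cw i1) (cw i2) (hxs j) det (tauP _ i1S i1S') (tauP _ i2S i2S')).
have caR : 0 <= ca * rr by exact: mulr_ge0.
have all j : dcirc (xhat j) (Q1 *m xs j) <= align_const * rr.
  rewrite /align_const; have [jS|jS] := boolP (j \in S); last first.
    by rewrite hout //; have [_ ?] := h1 jS; have := rr_rho; lra.
  have jS' : j \notin S'.
    apply/negP => j'; have := fintype.subsetP dS j j'; by rewrite inE jS.
  rewrite hin //; have [cj ej] := h2 jS'.
  have c1 : circle (Qh *m x2' j) by apply: circle_orth.
  have cQ2 : circle (Q2 *m xs j) by apply: circle_orth.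
  have c2 : circle (Qh *m (Q2 *m xs j)) by apply: circle_orth.
  have c3 : circle (Q1 *m xs j) by apply: circle_orth.
  apply: le_trans (dcirc_triangle c1 c2 c3) _.
  rewrite (dcirc_orth oQh) // -Q1O (dcirc_orth oQ1) //; last exact: circle_orth.
  by have := Oall j; lra.
apply: le_trans (_ : dinf xhat (orth_act Q1 xs) <= _).
  apply: ge_inf; last by exists Q1.
  exists 0 => _ [Q _ <-]; rewrite /dinf /dinf_on.
  exact: bigmax_ge_id.
apply: bigmax_le => [|j _]; last exact: all.
by rewrite /align_const; have := rr_rho; lra.
Qed.

End Alignment.

(** * Spread of random samples *)

Section Hypergeometric.
Context {R : realType} (n N : nat).
Context (Nn : (N <= n)%N) (n0 : (0 < n)%N).
Implicit Types (s J B : {set 'I_n}).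

(** There are C(n - j, N - j) such sets, and each factor (N - i) / (n - i) of the ratio to C(n, N)
    is at most N / n. Stated without division, in the naturals. *)
Lemma card_supersets J :
  (#|[set s : {set 'I_n} | (#|s| == N) && (J \subset s)]%SET| * n ^ #|J| <= 'C(n, N) * N ^ #|J|)%N.
Proof.
set j := #|J|.
have [jN|Nj] := leqP j N; last first.
  rewrite (_ : [set s | _]%SET = finset.set0) ?cards0 ?mul0n //.
  apply/setP => s; rewrite !inE; apply/negP => /andP[/eqP sN /subset_leq_card].
  by rewrite sN leqNgt Nj.
have step : (#|[set s : {set 'I_n} | (#|s| == N) && (J \subset s)]%SET| <= 'C(n - j, N - j))%N.
  have cJ : #|~: J| = (n - j)%N by rewrite cardsCs finset.setCK card_ord.
  rewrite -cJ -cards_draws.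
  have inj : {in [set s : {set 'I_n} | (#|s| == N) && (J \subset s)]%SET &,
      injective (fun s => s :\: J)}.
    move=> s s'; rewrite !inE => /andP[_ Js] /andP[_ Js'] e.
    by rewrite -(finset.setID s J) -(finset.setID s' J) e !(finset.setIidPr _).
  rewrite -(card_in_imset inj); apply: subset_leq_card.
  apply/fintype.subsetP => x /imsetP[s]; rewrite inE => /andP[/eqP sN Js] ->.
  by rewrite inE finset.subsetDr cardsDS // sN eqxx.
suff : ('C(n - j, N - j) * n ^ j <= 'C(n, N) * N ^ j)%N.
  by apply: leq_trans; rewrite leq_mul2r step orbT.
elim: j jN {step} => [|j IH] jN; first by rewrite !subn0.
have {}IH := IH (ltnW jN).
have d : ((n - j) * 'C(n - j.+1, N - j.+1) = (N - j) * 'C(n - j, N - j))%N.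
  have := mul_bin_diag (n - j) (N - j.+1).
  by rewrite subnSK // -[(n - j).-1]subnS.
have nj : (0 < n - j)%N by rewrite subn_gt0; apply: leq_trans Nn.
rewrite -(leq_pmul2l nj) !expnS.
have h1 : ((N - j) * n <= (n - j) * N)%N.
  by rewrite !mulnBl [(N * n)%N]mulnC leq_sub2l // leq_mul2l Nn orbT.
have -> : ((n - j) * ('C(n - j.+1, N - j.+1) * (n * n ^ j)) =
  ((N - j) * n) * ('C(n - j, N - j) * n ^ j))%N.
  by rewrite mulnA d; ring.
have -> : ((n - j) * ('C(n, N) * (N * N ^ j)) = ((n - j) * N) * ('C(n, N) * N ^ j))%N by ring.
exact: leq_mul.
Qed.

Lemma prod_indicator (u : R) B s : (1 + u) ^+ #|s :&: B| =
  \prod_i ((if i \in s :&: B then u else 0) + 1).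
Proof.
rewrite (bigID (mem (s :&: B))) /= [X in _ * X]big1 ?mulr1.
  under eq_bigr => i hi do rewrite hi.
  by rewrite prodr_const addrC.
by move=> i /negPf ->; rewrite add0r.
Qed.

(* Sampling without replacement is dominated by independent sampling. *)
Lemma hypergeometric_mgf (u : R) B : 0 <= u ->
  \sum_(s : {set 'I_n} | #|s| == N) (1 + u) ^+ #|s :&: B| <=
  'C(n, N)%:R * (1 + u * (N%:R / n%:R)) ^+ #|B|.
Proof.
move=> u0.
have nR : (0 : R) < n%:R by rewrite ltr0n.
have expand (v : R) (D : {set 'I_n}) : \prod_i ((if i \in D then v else 0) + 1) =
    \sum_(J : {set 'I_n} | J \subset D) v ^+ #|J|.
  rewrite bigA_distr [LHS](bigID (fun J : {set 'I_n} => J \subset D)) /= [X in _ + X]big1 ?addr0.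
    apply: eq_bigr => J JD; rewrite (bigID (mem J)) /= [X in _ * X]big1 ?mulr1.
      rewrite -prodr_const; apply: eq_bigr => i iJ.
      by rewrite iJ (fintype.subsetP JD).
    by move=> i /negPf ->.
  move=> J /subsetPn[i iJ iD]; rewrite (bigD1 i) //= iJ (negPf iD).
  by rewrite mul0r.
have -> : (1 + u * (N%:R / n%:R)) ^+ #|B| =
   \sum_(J : {set 'I_n} | J \subset B) (u * (N%:R / n%:R)) ^+ #|J|.
  by rewrite -expand -[in LHS](finset.setTI B) prod_indicator finset.setTI.
under eq_bigr do rewrite prod_indicator expand.
rewrite (exchange_big_dep (fun J : {set 'I_n} => J \subset B)) /=; last first.
  by move=> s J _ /fintype.subset_trans; apply; exact: finset.subsetIr.
rewrite mulr_sumr; apply: ler_sum => J JB.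
rewrite (eq_bigl (fun s : {set 'I_n} => s \in [set s : {set 'I_n} | (#|s| == N) && (J \subset s)]%SET)); last first.
  by move=> s; rewrite inE finset.subsetI JB andbT.
rewrite sumr_const -[leLHS]mulr_natl exprMn [leLHS]mulrC [leRHS]mulrCA.
rewrite ler_wpM2l ?exprn_ge0 // expr_div_n mulrA ler_pdivlMr ?exprn_gt0 //.
by rewrite -!natrX -!natrM ler_nat; exact: card_supersets.
Qed.

Lemma expR_le_quadratic (x : R) : 0 <= x <= 1 / 2 -> expR x <= 1 + x + 2 * x ^+ 2.
Proof.
move=> /andP[x0 x1].
have h := expR_ge1Dx (- x).
have e := expRxMexpNx_1 x.
have p := expR_gt0 x.
have h2 : expR x * (1 - x) <= 1.
  by rewrite -[leRHS]e ler_wpM2l // ltW.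
rewrite -(ler_pM2r (_ : 0 < 1 - x)); last by lra.
apply: le_trans h2 _; rewrite expr2.
have := mulr_ge0 (mulr_ge0 x0 x0) (_ : 0 <= 1 - 2 * x); have : 0 <= 1 - 2 * x by lra.
by move=> a /(_ a); lra.
Qed.

(** The Chernoff bound: Markov's inequality for exp (lam #|s :&: B|), with exp lam <= 1 + lam + 2
    lam^2 inserted in the moment generating function. *)
Lemma hypergeometric_tail (lam t : R) B : 0 <= lam <= 1 / 2 ->
  #|[set s : {set 'I_n} | (#|s| == N) && (N%:R / n%:R * #|B|%:R + t <= #|s :&: B|%:R)]%SET|%:R
  <= 'C(n, N)%:R * expR (2 * #|B|%:R * lam ^+ 2 - lam * t).
Proof.
move=> hl; have /andP[l0 l1] := hl.
set q := N%:R / n%:R; set b := #|B|%:R.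
have q0 : 0 <= q by rewrite divr_ge0.
have q1 : q <= 1 by rewrite ler_pdivrMr ?ltr0n // mul1r ler_nat.
have u0 : 0 <= expR lam - 1 by have := expR_ge1Dx lam; lra.
have := hypergeometric_mgf B u0; rewrite addrC subrK -/q => mgf.
rewrite -(ler_pM2r (expR_gt0 (lam * (q * b + t)))).
apply: le_trans (_ : \sum_(s : {set 'I_n} | #|s| == N) expR lam ^+ #|s :&: B| <= _).
  rewrite mulr_natl -sumr_const.
  rewrite [leRHS](bigID (fun s : {set 'I_n} => q * b + t <= #|s :&: B|%:R)) /=.
  rewrite -[leLHS]addr0; apply: lerD; last first.
    by apply: sumr_ge0 => s _; rewrite exprn_ge0 // expR_ge0.
  rewrite [leLHS](eq_bigl (fun s : {set 'I_n} => (#|s| == N) &&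
    (q * b + t <= #|s :&: B|%:R))); last by move=> s; rewrite inE.
  apply: ler_sum => s /andP[_ hs]; rewrite -expRM_natl ler_expR mulrC.
  by rewrite ler_wpM2r.
apply: le_trans mgf _; rewrite -[leRHS]mulrA -expRD ler_wpM2l //.
have -> : expR (2 * b * lam ^+ 2 - lam * t + lam * (q * b + t)) =
   expR (2 * lam ^+ 2 + lam * q) ^+ #|B|.
  by rewrite -expRM_natl -/b; congr expR; ring.
rewrite lerXn2r ?nnegrE ?expR_ge0 // ?addr_ge0 ?mulr_ge0 //.
apply: le_trans (expR_ge1Dx _); rewrite lerD2l.
have := ler_wpM2r q0 (expR_le_quadratic hl).
have := ler_wpM2r (sqr_ge0 lam) q1; lra.
Qed.

End Hypergeometric.

Lemma rate_sqr (R : realType) (n : nat) : (0 < n)%N -> n%:R * rate n ^+ 2 = ln n%:R :> R.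
Proof.
move=> n0; have nR : n%:R != 0 :> R by rewrite pnatr_eq0 -lt0n.
have l0 : 0 <= ln n%:R :> R by rewrite ln_ge0 // ler1n.
by rewrite sqr_sqrtr ?divr_ge0 // mulrCA divff // mulr1.
Qed.

Section SpreadProbability.
Context {R : realType} (N : nat).
Local Notation n := (N * 4)%N.
Local Notation rr := (rate (R := R) n).
Context (sg : 'S_n) (N0 : (1 < N)%N) (rr1 : rr <= 1 / 2).

Let n0 : (0 < n)%N. Proof. by rewrite muln_gt0 (ltn_trans _ N0). Qed.
Let nR : (0 : R) < n%:R. Proof. by rewrite ltr0n. Qed.

(** With lam = rate and deviation 6 n rate, the exponent is at most 2 n rate^2 - 6 n rate^2 = - 4 ln
    n. *)
Lemma spread_tail (B : {set 'I_n}) :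
  #|[set s : {set 'I_n} | (#|s| == N) && (#|B|%:R / 4 + 6 * rr * n%:R <= #|s :&: B|%:R :> R)]%SET|%:R
  <= 'C(n, N)%:R * (n%:R ^+ 4)^-1 :> R.
Proof.
have r0 : 0 <= rr := rate_ge0 n.
have Nn : (N <= n)%N by rewrite leq_pmulr.
have NR : N%:R != 0 :> R by rewrite pnatr_eq0 -lt0n ltnW.
have q4 : N%:R / n%:R * #|B|%:R = #|B|%:R / 4 :> R.
  by rewrite natrM; field; rewrite NR.
have := @hypergeometric_tail R n N Nn n0 rr (6 * rr * n%:R) B; rewrite r0 rr1 q4 => /(_ isT) h.
apply: le_trans h _; rewrite ler_wpM2l //.
have bn : #|B|%:R <= n%:R :> R by rewrite ler_nat -[X in (_ <= X)%N]card_ord max_card.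
apply: le_trans (_ : expR (- (4 * ln n%:R)) <= _).
  rewrite ler_expR -(rate_sqr R n0); have := ler_wpM2r (sqr_ge0 rr) bn.
  by rewrite expr2; lra.
by rewrite expRN expRM_natl lnK ?posrE.
Qed.

(** A union over the n + 1 initial segments and their complements. A count that is too low on a
    segment is too high on its complement, so the upper tail alone is enough; 2 (n + 1) / n^4 is at
    most n^-2. *)
Lemma spread_fail_card :
  #|[set s : {set 'I_n} | (#|s| == N) && ~~ `[< evenly_spread sg s (6 * rr * n%:R) >]]%SET|%:R
  <= 'C(n, N)%:R / n%:R ^+ 2 :> R.
Proof.
pose Bm (m : 'I_n.+1) : {set 'I_n} := [set i | (sg i < m)%N]%SET.
pose T (B : {set 'I_n}) := [set s : {set 'I_n} | (#|s| == N) &&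
  (#|B|%:R / 4 + 6 * rr * n%:R <= #|s :&: B|%:R :> R)]%SET.
have sub : [set s : {set 'I_n} | (#|s| == N) && ~~ `[< evenly_spread sg s (6 * rr * n%:R) >]]%SET
    \subset (\bigcup_m T (Bm m)) :|: (\bigcup_m T (~: Bm m)).
  apply/fintype.subsetP => s; rewrite inE => /andP[sN /asboolPn hs].
  rewrite finset.inE; apply: contra_notT hs; rewrite negb_or => /andP[/finset.bigcupP h1 /finset.bigcupP h2].
  move=> m mn; pose m' := Ordinal (mn : (m < n.+1)%N).
  have cB : #|Bm m'| = m by exact: card_initial.
  have cC : #|~: Bm m'| = (n - m)%N by rewrite cardsCs finset.setCK cB card_ord.
  have ce : count_below sg s m = #|s :&: Bm m'|.
    by apply: eq_card => i; rewrite !inE.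
  have k1 : #|s :&: Bm m'|%:R < m%:R / 4 + 6 * rr * n%:R :> R.
    rewrite ltNge; apply/negP => h; apply: h1; exists m' => //.
    by rewrite inE sN cB.
  have k2 : #|s :&: ~: Bm m'|%:R < (n - m)%:R / 4 + 6 * rr * n%:R :> R.
    rewrite ltNge; apply/negP => h; apply: h2; exists m' => //.
    by rewrite inE sN cC.
  have sum : #|s :&: Bm m'|%:R + #|s :&: ~: Bm m'|%:R = N%:R :> R.
    have eN := cardsID (Bm m') s; rewrite (eqP sN) in eN.
    rewrite -natrD -[in RHS]eN; congr (_%:R); congr (_ + _)%N.
    by apply: eq_card => i; rewrite !inE andbC.
  rewrite ce; move: k2; rewrite natrB // natrM.
  by rewrite ler_norml; move: k1 sum; rewrite natrM; lra.
have h1 : (#|[set s : {set 'I_n} | (#|s| == N) && ~~ `[< evenly_spread sg s (6 * rr * n%:R) >]]%SET|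
    <= \sum_m #|T (Bm m)| + \sum_m #|T (~: Bm m)|)%N.
  apply: leq_trans (subset_leq_card sub) _.
  apply: leq_trans (leq_card_setU _ _) _.
  have bc (X : 'I_n.+1 -> {set {set 'I_n}}) : (#|(\bigcup_m X m)%SET| <= \sum_m #|X m|)%N.
    elim/big_ind2: _ => [|a A b B hA hB|//]; first by rewrite cards0.
    by apply: leq_trans (leq_card_setU _ _) _; exact: leq_add.
  by apply: leq_add; exact: bc.
apply: le_trans (_ : \sum_(m < n.+1) 'C(n, N)%:R * (n%:R ^+ 4)^-1 *+ 2 <= _ :> R).
  rewrite -(ler_nat R) natrD !natr_sum in h1; apply: le_trans h1 _.
  rewrite -big_split /=; apply: ler_sum => m _; rewrite mulr2n.
  by apply: lerD; exact: spread_tail.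
rewrite sumr_const card_ord -mulrnA -[leLHS]mulr_natr -mulrA ler_wpM2l //.
rewrite mulrC ler_pdivrMr ?exprn_gt0 // -[4%N]/(2 + 2)%N exprD mulKf ?expf_neq0 ?gt_eqF //.
rewrite -natrX ler_nat; move: N0; clear; nia.
Qed.

End SpreadProbability.

(** * Measurability and independence *)

Section MeasurabilityTools.
Context {R : realType}.

Lemma measurable_fun_preimage d (T : measurableType d) (f : T -> R) (B : set R) :
  measurable_fun setT f -> measurable B -> measurable [set w | B (f w)].
Proof. by move=> mf mB; rewrite -[X in measurable X]setTI; exact: mf. Qed.

Lemma measurable_gt_cst d (T : measurableType d) (f : T -> R) (a : R) :
  measurable_fun setT f -> measurable [set w | a < f w].
Proof.
move=> mf; have := measurable_fun_preimage mf (measurable_itv `]a, +oo[).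
by congr measurable; apply/seteqP; split => w /=; rewrite in_itv /= andbT.
Qed.

Lemma measurable_lincomb d (T : measurableType d) (I : finType) (Q : pred I)
    (c : I -> R) (f : I -> T -> R) : (forall i, Q i -> measurable_fun setT (f i)) ->
  measurable_fun setT (fun w => \sum_(i | Q i) c i * f i w).
Proof.
move=> mf.
have -> : (fun w => \sum_(i | Q i) c i * f i w) =
    (fun w => \sum_(i <- index_enum I) (if Q i then c i * f i w else 0)).
  by apply/funext => w; rewrite big_mkcond.
apply: measurable_sum => i; case: (boolP (Q i)) => hi; last exact: measurable_cst.
apply: (measurableT_comp (measurable_realfun.mulrl_measurable (c i))).
exact: mf.
Qed.

Lemma mx_measurable_fun d (T : measurableType d) m n (f : T -> 'M[R]_(m, n)) :
  (forall i j, measurable_fun setT (fun w => f w i j)) ->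
  forall B, mx_measurable B -> measurable [set w | B (f w)].
Proof.
move=> mf B mB.
pose G := [set D : set 'M[R]_(m, n) | exists i j (C : set R),
  measurable C /\ D = [set M : 'M[R]_(m, n) | C (M i j)]].
suff H : measurable_fun setT (f : T -> g_sigma_algebraType G).
  by have := H measurableT B mB; rewrite setTI.
apply: (@measurability _ _ T (g_sigma_algebraType G) setT f G) => // _ [_ [i [j [C [mC ->]]]] <-].
rewrite setTI; exact: (measurable_fun_preimage (mf i j) mC).
Qed.

Lemma mx_entry_measurable m n i j (C : set R) : measurable C ->
  mx_measurable [set M : 'M[R]_(m, n) | C (M i j)].
Proof. by move=> mC; apply: sub_sigma_algebra; exists i, j, C. Qed.

(** Matrices as a measurable type whose measurable sets are those of [mx_measurable], so that
    general facts on measurable functions apply to events about A. *)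
Definition mx_algebra m n := g_sigma_algebraType
  [set D : set 'M[R]_(m, n) | exists i j (C : set R),
     measurable C /\ D = [set M : 'M[R]_(m, n) | C (M i j)]].

Lemma mx_entry_measurable_fun m n i j :
  measurable_fun setT (fun M : mx_algebra m n => (M : 'M[R]_(m, n)) i j).
Proof. by move=> _ C mC; rewrite setTI; exact: mx_entry_measurable. Qed.

Section UnionBound.
Context d (T : measurableType d) (P : probability T R).
Local Open Scope ereal_scope.

Lemma measurable_exists (I : finType) (F : I -> set T) : (forall i, measurable (F i)) ->
  measurable [set w | exists i, F i w].
Proof.
move=> mF; have -> : [set w | exists i, F i w] = \bigcup_(i in [set: I]) F i.
  by apply/seteqP; split => [w [i h]|w [i _ h]]; exists i.
by apply: fin_bigcup_measurable => //; exact: finite_finset.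
Qed.

Lemma measurable_forall (I : finType) (F : I -> set T) : (forall i, measurable (F i)) ->
  measurable [set w | forall i, F i w].
Proof.
move=> mF; have -> : [set w | forall i, F i w] = ~` [set w | exists i, (~` F i) w].
  apply/seteqP; split => [w h [i]|w h i]; first by apply; exact: h.
  by apply: contrapT => hi; apply: h; exists i.
by apply: measurableC; apply: measurable_exists => i; exact: measurableC.
Qed.

Lemma union_bound (I : finType) (F : I -> set T) : (forall i, measurable (F i)) ->
  P [set w | exists i, F i w] <= \sum_i P (F i).
Proof.
move=> mF.
have -> : [set w | exists i, F i w] = \big[setU/set0]_(i <- index_enum I) F i.
  apply/seteqP; split => w.
    by case=> i h; rewrite -bigcup_seq; exists i => //=; rewrite mem_index_enum.
  by rewrite -bigcup_seq => -[i _ h]; exists i.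
elim: (index_enum I) => [|i s IH]; first by rewrite !big_nil measure0.
rewrite !big_cons; apply: le_trans (leeD2l _ IH).
by apply: measureU2 => //; apply: bigsetU_measurable.
Qed.

Lemma union_bound_cst (I : finType) (F : I -> set T) (c : R) :
  (forall i, measurable (F i)) -> (forall i, P (F i) <= c%:E) ->
  P [set w | exists i, F i w] <= (#|I|%:R * c)%:E.
Proof.
move=> mF hF; apply: le_trans (union_bound mF) _.
apply: le_trans (_ : \sum_(i : I) c%:E <= _); first exact: lee_sum.
by rewrite sumEFin sumr_const mulr_natl lee_fin.
Qed.

Lemma probability_sum_disjoint (I : finType) (F : I -> set T) :
  (forall i, measurable (F i)) -> (forall i j w, F i w -> F j w -> i = j) ->
  \sum_i P (F i) <= 1.
Proof.
move=> mF dF.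
suff -> : \sum_i P (F i) = P (\big[setU/set0]_(i <- index_enum I) F i).
  by apply: probability_le1; apply: bigsetU_measurable.
elim: (index_enum I) (index_enum_uniq I) => [_|i s IH /= /andP[si us]].
  by rewrite !big_nil measure0.
rewrite !big_cons IH // measureU //; first exact: bigsetU_measurable.
apply/seteqP; split => // w [/= wi]; rewrite -bigcup_seq => -[j /= js wj].
by move: si; rewrite (dF _ _ _ wi wj) js.
Qed.

End UnionBound.
End MeasurabilityTools.

Section BlockIndependence.
Context {R : realType} d (T : measurableType d) (P : probability T R).
Context (I : finType) (X : I -> T -> R) (D : {set I}).
Context (mX : forall i, i \in D -> measurable_fun setT (X i)).
Context (indX : mutually_independent P D X).
Local Open Scope ereal_scope.

Definition block_cylinders (J : {set I}) : set (set T) :=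
  [set C | exists B : I -> set R, (forall i, measurable (B i)) /\
     C = [set w | forall i, i \in J -> B i (X i w)]].

(** The sample space with the sigma-algebra generated by the variables of the block: measurability
    on this type expresses dependence on those variables only. *)
Definition block_algebra (J : {set I}) := g_sigma_algebraType (block_cylinders J).

Lemma block_measurable (J : {set I}) : J \subset D ->
  block_cylinders J `<=` @measurable _ T.
Proof.
move=> JD _ [B [mB ->]].
have -> : [set w | forall i, i \in J -> B i (X i w)] =
    [set w | forall i : I, (if i \in J then [set w | B i (X i w)] else setT) w].
  apply/seteqP; split => w h i; first by case: ifPn => // iJ; exact: h.
  by move=> iJ; have := h i; rewrite iJ.
apply: measurable_forall => i; case: ifPn => // iJ.
by apply: measurable_fun_preimage => //; apply: mX; exact: (fintype.subsetP JD).
Qed.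

Lemma block_entry (J : {set I}) i : i \in J ->
  measurable_fun setT (X i : block_algebra J -> R).
Proof.
move=> iJ _ C mC; rewrite setTI; apply: sub_sigma_algebra.
exists (fun j => if j == i then C else setT); split.
  by move=> j; case: ifP.
apply/seteqP; split => w /=; first by move=> h j _; case: eqP => [->|].
by move=> /(_ i iJ); rewrite eqxx.
Qed.

Lemma block_setI (J : {set I}) : setI_closed (block_cylinders J).
Proof.
move=> _ _ [B [mB ->]] [B' [mB' ->]]; exists (fun i => B i `&` B' i); split.
  by move=> i; exact: measurableI.
apply/seteqP; split => w /=; first by move=> [h h'] i iJ; split; [exact: h|exact: h'].
by move=> h; split => i iJ; have [] := h i iJ.
Qed.

Lemma block_setT (J : {set I}) : block_cylinders J setT.
Proof. by exists (fun => setT); split => //; apply/seteqP; split. Qed.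

Lemma block_sub_measurable (J : {set I}) C : J \subset D ->
  <<s block_cylinders J >> C -> measurable C.
Proof.
move=> JD; apply: smallest_sub; last exact: block_measurable.
split; [exact: measurable0|by move=> A mA; rewrite setTD; exact: measurableC|].
by move=> F mF; exact: bigcupT_measurable.
Qed.

(* Uniqueness of finite measures on a pi-system, for [A |-> P (A `&` Y)] and
   [A |-> P A * P Y]. *)
Lemma product_extension (G : set (set T)) (Y : set T) : measurable Y ->
  G `<=` @measurable _ T -> setI_closed G -> G setT ->
  (forall C, G C -> P (C `&` Y) = P C * P Y) ->
  forall C, <<s G >> C -> P (C `&` Y) = P C * P Y.
Proof.
move=> mY Gm GI GT hG C hC.
have fY : P Y \is a fin_num by exact: fin_num_measure.
have pY0 : (0 <= fine (P Y))%R by rewrite fine_ge0.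
pose m1 : {measure set T -> \bar R} := mrestr P mY.
pose m2 : {measure set T -> \bar R} := mscale (NngNum pY0) P.
have e2 A : m2 A = P A * P Y by rewrite /m2 /= /mscale /= fineK // muleC.
rewrite -[RHS]e2.
apply: (@g_sigma_algebra_measure_unique _ R T G Gm (fun => setT) (fun => GT) _ m1 m2 GI) => //.
- by apply/seteqP; split => // w _; exists 0%N.
- by move=> A GA; rewrite e2 -hG.
- move=> k; rewrite /m1 /= /mrestr setTI; apply: le_lt_trans (ltry 1).
  exact: probability_le1.
Qed.

(** The product formula holds for cylinders by hypothesis and is extended to the generated
    sigma-algebras one argument at a time. *)
Lemma block_independent (J1 J2 : {set I}) C1 C2 :
  J1 \subset D -> J2 \subset D -> (forall i, i \in J2 -> i \notin J1) ->
  <<s block_cylinders J1 >> C1 -> <<s block_cylinders J2 >> C2 ->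
  P (C1 `&` C2) = P C1 * P C2.
Proof.
move=> J1D J2D dJ h1 h2.
apply: (product_extension (block_sub_measurable J2D h2) (block_measurable J1D)
  (@block_setI J1) (block_setT J1)) h1 => A hA.
have mA := block_measurable J1D hA.
rewrite setIC muleC.
apply: (product_extension mA (block_measurable J2D) (@block_setI J2) (block_setT J2)) h2.
move=> _ [B2 [mB2 ->]]; case: hA => B1 [mB1 ->].
pose B i := if i \in J1 then B1 i else B2 i.
have mB i : measurable (B i) by rewrite /B; case: ifP.
have J2N i : i \in J2 -> i \in J1 = false.
  by move=> i2; apply/negbTE; exact: dJ.
have -> : [set w | forall i, i \in J2 -> B2 i (X i w)] `&`
    [set w | forall i, i \in J1 -> B1 i (X i w)] =
    [set w | forall i, i \in J1 :|: J2 -> B i (X i w)].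
  apply/seteqP; split => w /=.
    move=> [w2 w1] i; rewrite finset.inE /B; case: ifP => [i1 _|_ /= i2]; first exact: w1.
    exact: w2.
  move=> h; split => i hi; have := h i; rewrite finset.inE hi ?orbT /B.
    by rewrite J2N // => /(_ isT).
  by rewrite hi => /(_ isT).
rewrite (indX _ mB); last by rewrite finset.subUset J1D.
rewrite (indX J1D mB1) (indX J2D mB2) (bigID (mem J1)) /= muleC; congr (_ * _).
  apply: eq_big => [i|i].
    rewrite finset.inE; case: (boolP (i \in J2)) => [/dJ ->|i2]; first by rewrite orbT.
    by rewrite orbF andbN.
  by move=> /andP[_ /negPf i1]; rewrite /B i1.
apply: eq_big => [i|i]; last by move=> /andP[_ i1]; rewrite /B i1.
by rewrite finset.inE; case: (i \in J1); rewrite ?andbF.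
Qed.

End BlockIndependence.

(** * Noise bounds *)

Section Net.
Context {R : realType} (n : nat) (n0 : (0 < n)%N).
Local Notation K := (n ^ 2)%N.

(** The lattice of mesh n^-2 in the cube [-1, 1]^n, with at most n^(3 n) points for n >= 3. The
    logarithm 3 n ln n of this number is affordable for a noise bound of order n rate = sqrt (n ln
    n), so no finer covering argument is required. *)
Definition net_vec (p : {ffun 'I_n -> 'I_(2 * K).+1}) : 'cV[R]_n :=
  \col_i (((p i)%:R - K%:R) / K%:R).

Let KR : (0 : R) < K%:R. Proof. by rewrite ltr0n expn_gt0 n0. Qed.

Lemma entry_le_nrm (x : 'cV[R]_n) i : `|x i 0| <= nrm x.
Proof.
rewrite -ler_sqr ?nnegrE ?nrm_ge0 // nrm_sqr real_normK ?num_real // dotv_sqr.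
by rewrite (bigD1 i) //= lerDl sumr_ge0 // => j _; rewrite sqr_ge0.
Qed.

Lemma net_entry_le p i : `|net_vec p i 0| <= 1.
Proof.
rewrite mxE ler_norml ler_pdivlMr // ler_pdivrMr //.
have : (p i)%:R <= 2 * K%:R :> R by rewrite -natrM ler_nat -ltnS ltn_ord.
by have : (0 : R) <= (p i)%:R by []; lra.
Qed.

Lemma net_round (x : 'cV[R]_n) : nrm x <= 1 ->
  exists p, forall i, `|net_vec p i 0 - x i 0| <= K%:R^-1.
Proof.
move=> x1.
have bx i : 0 <= (x i 0 + 1) * K%:R <= 2 * K%:R.
  have := le_trans (entry_le_nrm x i) x1; rewrite ler_norml => /andP[a b].
  apply/andP; split; first by apply: mulr_ge0; [lra|exact: ltW].
  by rewrite ler_wpM2r ?(ltW KR) //; lra.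
have lt i : (Num.truncn ((x i 0 + 1) * K%:R)%R < (2 * K).+1)%N.
  have /andP[a b] := bx i; have /andP[c _] := truncn_itv a.
  by rewrite ltnS -(ler_nat R) natrM; apply: le_trans c b.
exists [ffun i => Ordinal (lt i)] => i; rewrite mxE ffunE /=.
have /andP[a b] := bx i; have /andP[c d] := truncn_itv a.
set m := Num.truncn _ in c d *.
have -> : (m%:R - K%:R) / K%:R - x i 0 = (m%:R - (x i 0 + 1) * K%:R) / K%:R.
  have E (k y : R) : k != 0 -> (m%:R - k) / k - y = (m%:R - (y + 1) * k) / k by move=> h; field.
  by rewrite E // gt_eqF.
rewrite normrM [X in _ * X]gtr0_norm ?invr_gt0 // ler_piMl ?invr_ge0 ?(ltW KR) //.
rewrite -natr1 in d; rewrite ler_norml; lra.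
Qed.

Lemma net_unit (i : 'I_n) (b : bool) :
  exists p, net_vec p = (if b then 1 else -1) *: delta_mx i 0.
Proof.
exists [ffun j => if j == i then (if b then ord_max else ord0) else inord K].
apply/matrixP => j k; rewrite ord1 !mxE ffunE eqxx andbT.
case: eqVneq => [_|_].
  case: b => /=.
    by rewrite natrM mulr1 mulr_natl mulr2n addrK divff ?gt_eqF.
  by rewrite mulr1 sub0r mulNr divff ?gt_eqF.
by rewrite inordK ?subrr ?mul0r ?mulr0 // ltnS leq_pmull.
Qed.

(* With mesh n^-2, rounding costs at most a multiple of the largest entry of W, which
   the net also controls because it contains the basis vectors up to sign. *)
Lemma net_opn (W : 'M[R]_n) (t : R) : 0 <= t ->
  (forall p q, dotv (net_vec q) (W *m net_vec p) <= 2 * t * (nrm (net_vec q) * nrm (net_vec p))) ->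
  opn W (12 * t).
Proof.
move=> t0 hW.
have nd (i : 'I_n) : nrm (delta_mx i 0 : 'cV[R]_n) = 1.
  rewrite /nrm /dotv (bigD1 i) //= big1 ?addr0 ?mxE ?eqxx ?mulr1 ?sqrtr1 //.
  by move=> j ji; rewrite mxE (negPf ji) mul0r.
have Wd (i j : 'I_n) : dotv (delta_mx i 0) (W *m delta_mx j 0) = W i j.
  rewrite /dotv (bigD1 i) //= big1 ?addr0.
    rewrite !mxE eqxx mul1r (bigD1 j) //= big1 ?addr0 ?mxE ?eqxx ?mulr1 //.
    by move=> k kj; rewrite mxE (negPf kj) mulr0.
  by move=> k ki; rewrite mxE (negPf ki) mul0r.
have ent i j : `|W i j| <= 2 * t.
  have [p hp] := net_unit j true; have [q hq] := net_unit i true.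
  have [q' hq'] := net_unit i false.
  have h1 := hW p q; have h2 := hW p q'.
  rewrite hp hq scale1r scale1r !nd Wd !mulr1 in h1.
  rewrite hp hq' scale1r nrmZ dotvZl !nd Wd normrN1 !mulr1 in h2.
  by rewrite ler_norml; lra.
have crude (a b : 'cV[R]_n) al be : 0 <= al -> 0 <= be ->
    (forall i, `|a i 0| <= al) -> (forall i, `|b i 0| <= be) ->
    `|dotv a (W *m b)| <= K%:R * (al * (2 * t) * be).
  move=> al0 be0 ha hb.
  apply: le_trans (ler_norm_sum _ _ _) _.
  apply: le_trans (_ : \sum_(i < n) n%:R * (al * (2 * t) * be) <= _); last first.
    by rewrite sumr_const card_ord -[leLHS]mulr_natl mulrA -natrM mulnn.
  apply: ler_sum => i _; rewrite mxE mulr_sumr.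
  apply: le_trans (ler_norm_sum _ _ _) _.
  apply: le_trans (_ : \sum_(j < n) al * (2 * t) * be <= _); last first.
    by rewrite sumr_const card_ord -[leLHS]mulr_natl.
  apply: ler_sum => j _; rewrite !normrM mulrA.
  by apply: ler_pM; rewrite ?mulr_ge0 //; apply: ler_pM.
have Kinv0 : 0 <= K%:R^-1 :> R by rewrite invr_ge0 ltW.
have near (x : 'cV[R]_n) p : nrm x = 1 -> (forall i, `|net_vec p i 0 - x i 0| <= K%:R^-1) ->
    nrm (net_vec p) <= 2.
  move=> x1 hp; rewrite -(subrK x (net_vec p)); apply: le_trans (nrmD _ _) _.
  rewrite x1; suff : nrm (net_vec p - x) <= 1 by lra.
  rewrite -ler_sqr ?nnegrE ?nrm_ge0 // expr1n nrm_sqr dotv_sqr.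
  apply: le_trans (_ : \sum_(i < n) n%:R^-1 <= _); last first.
    by rewrite sumr_const card_ord -[leLHS]mulr_natl divff // pnatr_eq0 -lt0n.
  apply: ler_sum => i _; rewrite -[leLHS]real_normK ?num_real //.
  apply: le_trans (_ : K%:R^-1 ^+ 2 <= _).
    by rewrite ler_sqr ?nnegrE //; have := hp i; rewrite !mxE.
  rewrite exprVn lef_pV2 ?posrE ?exprn_gt0 ?ltr0n ?expn_gt0 ?n0 //.
  rewrite -natrX ler_nat -expnM; exact: (@leq_pexp2l n 1 4).
move=> x.
have [x0|x0] := eqVneq (nrm x) 0.
  have -> : x = 0 by apply: dotv_eq0; rewrite -nrm_sqr x0 expr0n.
  by rewrite mulmx0 /nrm !dotv0l sqrtr0 mulr0.
have xp : 0 < nrm x by rewrite lt_neqAle eq_sym x0 nrm_ge0.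
have [y0|y0] := eqVneq (nrm (W *m x)) 0.
  by rewrite y0 !mulr_ge0 // ltW.
have yp : 0 < nrm (W *m x) by rewrite lt_neqAle eq_sym y0 nrm_ge0.
set a := nrm x in x0 xp *; set b := nrm (W *m x) in y0 yp *.
pose x' := a^-1 *: x; pose y' := b^-1 *: (W *m x).
have x'1 : nrm x' = 1 by rewrite nrmZ gtr0_norm ?invr_gt0 // mulVf.
have y'1 : nrm y' = 1 by rewrite nrmZ gtr0_norm ?invr_gt0 // mulVf.
have key : dotv y' (W *m x') = b / a.
  rewrite /y' /x' -scalemxAr dotvZl dotvZr -nrm_sqr -/b; field.
  by rewrite x0 y0.
rewrite -ler_pdivrMr // -key.
have [p hp] : exists p, forall i, `|net_vec p i 0 - x' i 0| <= K%:R^-1.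
  by apply: net_round; rewrite x'1.
have [q hq] : exists q, forall i, `|net_vec q i 0 - y' i 0| <= K%:R^-1.
  by apply: net_round; rewrite y'1.
(* 12 t = 8 t + 2 t + 2 t: both net vectors have norm at most 2, and each of the two roundings costs
   n^2 n^-2 2 t. *)
have -> : dotv y' (W *m x') = dotv (net_vec q) (W *m net_vec p)
    + dotv (y' - net_vec q) (W *m x') + dotv (net_vec q) (W *m (x' - net_vec p)).
  by rewrite mulmxBr dotvDr dotvNr dotvDl dotvNl; ring.
have e1 : `|dotv (y' - net_vec q) (W *m x')| <= K%:R * (K%:R^-1 * (2 * t) * 1).
  apply: crude => // i; first by have := hq i; rewrite distrC !mxE.
  by rewrite -x'1; exact: entry_le_nrm.
have e2 : `|dotv (net_vec q) (W *m (x' - net_vec p))| <= K%:R * (1 * (2 * t) * K%:R^-1).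
  apply: crude => // i; first exact: net_entry_le.
  by have := hp i; rewrite distrC !mxE.
have e3 := hW p q.
have nq := near _ _ y'1 hq; have np := near _ _ x'1 hp.
have e4 : nrm (net_vec q) * nrm (net_vec p) <= 2 * 2.
  by apply: ler_pM => //; exact: nrm_ge0.
have e5 := ler_wpM2l (mulr_ge0 (ler0n R 2) t0) e4.
have E (k : R) : k != 0 -> k * (k^-1 * (2 * t) * 1) = 2 * t by move=> h; field.
have c1 : K%:R * (K%:R^-1 * (2 * t) * 1) = 2 * t :> R by rewrite E ?gt_eqF.
have c2 : K%:R * (1 * (2 * t) * K%:R^-1) = 2 * t :> R by rewrite mul1r [2 * t * _]mulrC -[X in _ * X]mulr1 E ?gt_eqF.
move: e1 e2; rewrite c1 c2 !ler_norml; lra.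
Qed.

End Net.

Section NoiseForms.
Context {R : realType} (n : nat).

Lemma sum_upper (G : 'I_n -> 'I_n -> R) : (forall i, G i i = 0) ->
  \sum_i \sum_j G i j = \sum_(i < n) \sum_(j < n | (i < j)%N) (G i j + G j i).
Proof.
move=> G0.
have e (i : 'I_n) : \sum_j G i j = \sum_(j < n | (i < j)%N) G i j + \sum_(j < n | (j < i)%N) G i j.
  rewrite (bigID (fun j : 'I_n => (i < j)%N)) /=; congr (_ + _).
  rewrite (bigID (fun j : 'I_n => (j < i)%N)) /= [X in _ + X]big1 ?addr0.
    by apply: eq_bigl => j; case: (ltngtP i j).
  move=> j /andP[a b]; have -> : j = i; last exact: G0.
  by apply: val_inj => /=; move: a b; case: ltngtP.
rewrite (eq_bigr _ (fun i _ => e i)) big_split /=.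
rewrite [X in _ + X](exchange_big_dep xpredT) //=.
by rewrite -big_split; apply: eq_bigr => i _; rewrite big_split.
Qed.

Context (F : 'M[R]_n) (E : 'I_n * 'I_n -> R) (A : 'M[R]_n).
Context (symA : A^T = A) (symF : F^T = F).
Context (hAE : forall i j : 'I_n, (i < j)%N -> A i j = F i j + E (i, j)).
Local Notation W := (\matrix_(i, j) (if i == j then 0 else A i j - F i j)).

Lemma noise_upper (i j : 'I_n) : (i < j)%N -> A i j - F i j = E (i, j) /\ A j i - F j i = E (i, j).
Proof.
move=> ij; have h : A i j - F i j = E (i, j) by rewrite hAE // addrC addKr.
by split => //; rewrite -symA -[F]symF !mxE.
Qed.

Lemma noise_form (p q : 'cV[R]_n) : dotv q (W *m p) =
  \sum_(i < n) \sum_(j < n | (i < j)%N) (q i 0 * p j 0 + q j 0 * p i 0) * E (i, j).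
Proof.
transitivity (\sum_i \sum_j (if i == j then 0 else q i 0 * (A i j - F i j) * p j 0)).
  apply: eq_bigr => i _; rewrite mxE mulr_sumr; apply: eq_bigr => j _; rewrite mxE.
  by case: eqP => _; rewrite ?mul0r ?mulr0 // mulrA.
rewrite sum_upper => [|i]; last by rewrite eqxx.
apply: eq_bigr => i _; apply: eq_bigr => j ij.
have -> : (i == j) = false by apply/eqP => e; rewrite e ltnn in ij.
have -> : (j == i) = false by apply/eqP => e; rewrite e ltnn in ij.
by have [-> ->] := noise_upper ij; ring.
Qed.

Lemma noise_weight (p q : 'cV[R]_n) :
  Num.sqrt (\sum_(i < n) \sum_(j < n | (i < j)%N) (q i 0 * p j 0 + q j 0 * p i 0) ^+ 2)
   <= 2 * (nrm q * nrm p).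
Proof.
rewrite -ler_sqr ?nnegrE ?sqrtr_ge0 ?mulr_ge0 ?nrm_ge0 //.
rewrite sqr_sqrtr; last by rewrite !sumr_ge0 // => i _; rewrite sumr_ge0 // => j _; rewrite sqr_ge0.
apply: le_trans (_ : \sum_i \sum_j 2 * (q i 0 ^+ 2 * p j 0 ^+ 2 + q j 0 ^+ 2 * p i 0 ^+ 2) <= _).
  apply: ler_sum => i _; rewrite [leRHS](bigID (fun j : 'I_n => (i < j)%N)) /=.
  rewrite -[leLHS]addr0; apply: lerD.
    apply: ler_sum => j _; have := sqr_ge0 (q i 0 * p j 0 - q j 0 * p i 0).
    rewrite !expr2; lra.
  apply: sumr_ge0 => j _; rewrite mulr_ge0 // addr_ge0 // mulr_ge0 ?sqr_ge0 //.
have e : \sum_i \sum_j q i 0 ^+ 2 * p j 0 ^+ 2 = dotv q q * dotv p p.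
  by rewrite !dotv_sqr big_distrl; apply: eq_bigr => i _ /=; rewrite big_distrr.
have e' : \sum_i \sum_j q j 0 ^+ 2 * p i 0 ^+ 2 = dotv q q * dotv p p.
  by rewrite exchange_big.
under eq_bigr do rewrite -mulr_sumr big_split.
rewrite -mulr_sumr big_split /= e e' !exprMn !nrm_sqr.
by rewrite le_eqVlt; apply/orP; left; apply/eqP; ring.
Qed.

(* The noise of row i along s, rewritten in the entries above the diagonal. *)
Context (s : {set 'I_n}) (i : 'I_n) (b : 'I_n -> R) (is_out : i \notin s).

Definition row_coef : 'M[R]_n := \matrix_(a, c)
  ((if (a == i) && (c \in s) then b c else 0) + (if (c == i) && (a \in s) then b a else 0)).

Let pick_row (H : 'I_n -> R) :
  \sum_a \sum_c (if (a == i) && (c \in s) then H c else 0) = \sum_(j in s) H j.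
Proof.
rewrite (bigD1 i) //= [X in _ + X]big1 ?addr0.
  by rewrite eqxx [RHS]big_mkcond.
by move=> a /negPf ->; apply: big1.
Qed.

Lemma row_noise : \sum_(j in s) (A i j - F i j) * b j =
  \sum_(a < n) \sum_(c < n | (a < c)%N) row_coef a c * E (a, c).
Proof.
rewrite -pick_row.
transitivity (\sum_a \sum_c (if (a == i) && (c \in s) then (A a c - F a c) * b c else 0)).
  by apply: eq_bigr => a _; apply: eq_bigr => c _; case: eqP => // ->.
rewrite sum_upper => [|a]; last by case: eqP => // ->; rewrite (negPf is_out).
apply: eq_bigr => a _; apply: eq_bigr => c ac; rewrite mxE.
by have [-> ->] := noise_upper ac; case: ifP => _; case: ifP => _; ring.
Qed.

Lemma row_weight : \sum_(a < n) \sum_(c < n | (a < c)%N) row_coef a c ^+ 2 =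
  \sum_(j in s) b j ^+ 2.
Proof.
rewrite -pick_row sum_upper => [|a]; last by case: eqP => // ->; rewrite (negPf is_out).
apply: eq_bigr => a _; apply: eq_bigr => c ac; rewrite mxE.
case: (a =P i) => [ea|_] /=; case: (c =P i) => [ec|_] /=; rewrite ?ea ?ec ?(negPf is_out) /=;
  by do ?case: ifP => _; rewrite ?addr0 ?add0r ?expr0n.
Qed.

End NoiseForms.

Section NoiseEvents.
Context {R : realType} (n : nat) (n16 : (16 <= n)%N).
Context d (T : measurableType d) (P : probability T R).
Context (F : 'M[R]_n) (symF : F^T = F) (E : 'I_n * 'I_n -> T -> R) (hE : noise P E).
Context (A : T -> 'M[R]_n) (hA : observation F E A).
Local Notation rr := (rate (R := R) n).
Local Notation nv x := (net_vec x : 'cV[R]_n).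
Local Notation upper := [set p : 'I_n * 'I_n | (p.1 < p.2)%N]%SET.

Let n0 : (0 < n)%N. Proof. exact: leq_trans n16. Qed.
Let nR : (0 : R) < n%:R. Proof. by rewrite ltr0n. Qed.
Let lnn : (0 : R) <= ln n%:R. Proof. by rewrite ln_ge0 // ler1n. Qed.

Let mE p : p \in upper -> measurable_fun setT (E p).
Proof. by have [h _ _ _] := hE; exact: h. Qed.

Lemma measurable_noise_form (B : 'M[R]_n) :
  measurable_fun setT (fun w => \sum_(i < n) \sum_(j < n | (i < j)%N) B i j * E (i, j) w).
Proof.
apply: measurable_sum => i; apply: measurable_lincomb => j ij.
by apply: mE; rewrite finset.inE.
Qed.

Lemma expR_ln_powN (k : nat) : expR (- (k%:R * ln n%:R)) = (n%:R ^+ k)^-1 :> R.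
Proof. by rewrite expRN expRM_natl lnK // posrE. Qed.

(** At t = 4 n rate the tail for one pair of net vectors is n^(- 8 n), against at most n^(6 n)
    pairs. The constant is 48 = 12 * 4. *)
Lemma noise_opn_event : exists2 G : set T, measurable G &
  (P G <= ((n%:R ^+ 2)^-1)%:E)%E /\
  forall w, ~ G w -> opn (\matrix_(i, j) (if i == j then 0 else A w i j - F i j)) (48 * n%:R * rr).
Proof.
pose K := (n ^ 2)%N.
pose net := {ffun 'I_n -> 'I_(2 * K).+1}.
pose B (c : net * net) : 'M[R]_n := \matrix_(i, j)
  (nv c.2 i 0 * nv c.1 j 0 + nv c.2 j 0 * nv c.1 i 0).
pose t := 4 * n%:R * rr.
have t0 : 0 <= t by rewrite !mulr_ge0 ?rate_ge0 // ltW.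
pose V c := [set w | t * Num.sqrt (\sum_(i < n) \sum_(j < n | (i < j)%N) B c i j ^+ 2)
                 < \sum_(i < n) \sum_(j < n | (i < j)%N) B c i j * E (i, j) w].
have mV c : measurable (V c) by apply: measurable_gt_cst; exact: measurable_noise_form.
exists [set w | exists c, V c w]; first exact: measurable_exists.
split => [|w hw].
  have VP c : (P (V c) <= ((n%:R ^+ (8 * n))^-1)%:E)%E.
     have [_ _ _ sub] := hE; apply: le_trans (sub (B c) t t0) _.
    have -> : t ^+ 2 / 2 = (8 * n)%:R * ln n%:R.
      by rewrite -(rate_sqr R n0) natrM /t; field.
    by rewrite expR_ln_powN.
  apply: (le_trans (union_bound_cst mV VP)).
  rewrite lee_fin card_prod card_ffun !card_ord.
  have h1 : ((2 * K).+1 <= n ^ 3)%N.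
    rewrite /K (expnS n 2); apply: leq_trans (_ : 3 * n ^ 2 <= _)%N.
      by rewrite -[(3 * _)%N]/((2 + 1) * n ^ 2)%N mulnDl mul1n -addn1 leq_add2l expn_gt0 n0.
    by rewrite leq_mul2r (leq_trans _ n16) ?orbT.
  have h2 : ((2 * K).+1 ^ n * (2 * K).+1 ^ n <= n ^ (6 * n))%N.
    apply: leq_trans (_ : (n ^ 3) ^ n * (n ^ 3) ^ n <= _)%N.
      by apply: leq_mul; rewrite leq_exp2r.
    by rewrite -expnM -expnD; apply: leq_pexp2l => //; lia.
  rewrite ler_pdivrMr ?exprn_gt0 // mulrC ler_pdivlMr ?exprn_gt0 //.
  rewrite -!natrX -natrM ler_nat.
  apply: leq_trans (leq_mul h2 (leqnn _)) _; rewrite -expnD; apply: leq_pexp2l => //.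
  by move: n16; clear; lia.
have -> : 48 * n%:R * rr = 12 * t by rewrite /t; ring.
apply: (net_opn n0 t0) => p q.
rewrite (noise_form (E := fun p => E p w)) //; first last.
- by move=> i j ij; have [_ _ h] := hA w; apply: h.
- by have [] := hA w.
apply: le_trans (_ : t * (2 * (nrm (nv q) * nrm (nv p))) <= _); last by lra.
have nw := ler_wpM2l t0 (noise_weight (nv p) (nv q)).
apply: le_trans nw.
rewrite leNgt; apply/negP => h; apply: hw; exists (p, q).
rewrite /V /=; under eq_bigr do under eq_bigr do rewrite mxE.
by under [X in _ < X]eq_bigr do under eq_bigr do rewrite mxE.
Qed.

Lemma entry_block_measurable (J : {set 'I_n * 'I_n}) (a c : 'I_n) : a != c ->
  (a, c) \in J \/ (c, a) \in J -> J \subset upper ->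
  measurable_fun setT (fun w : block_algebra E J => A w a c).
Proof.
move=> ac hJ JU.
wlog acJ : a c ac hJ / (a, c) \in J.
  case: hJ => hJ; first by apply => //; left.
  rewrite eq_sym in ac => /(_ c a ac (or_introl hJ) hJ).
  congr measurable_fun; apply/funext => w; have [sA _ _] := hA w.
  by rewrite -{1}sA mxE.
have ltac : (a < c)%N by have := fintype.subsetP JU _ acJ; rewrite finset.inE.
have -> : (fun w => A w a c) = (fun w => F a c + E (a, c) w).
  by apply/funext => w; have [_ _ ->] := hA w.
apply: measurable_realfun.measurable_funD; first exact: measurable_cst.
exact: block_entry.
Qed.

Lemma observation_measurable (a c : 'I_n) : measurable_fun setT (fun w => A w a c).
Proof.
wlog ac : a c / (a <= c)%N.
  move=> H; case: (leqP a c) => [/H //|/ltnW /H].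
  congr measurable_fun; apply/funext => w; have [sA _ _] := hA w.
  by rewrite -{1}sA mxE.
move: ac; rewrite leq_eqVlt => /predU1P[/val_inj ->|ac].
  rewrite (_ : (fun w => A w c c) = cst 0); first exact: measurable_cst.
  by apply/funext => w; have [_ ->] := hA w.
have -> : (fun w => A w a c) = (fun w => F a c + E (a, c) w).
  by apply/funext => w; have [_ _ ->] := hA w.
apply: measurable_realfun.measurable_funD; first exact: measurable_cst.
by apply: mE; rewrite finset.inE.
Qed.

End NoiseEvents.

(** * Noise along a row outside the sample *)

Section RefinementNoise.
Context {R : realType} (n : nat) (n16 : (16 <= n)%N).
Context d (T : measurableType d) (P : probability T R).
Context (F : 'M[R]_n) (symF : F^T = F) (E : 'I_n * 'I_n -> T -> R) (hE : noise P E).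
Context (A : T -> 'M[R]_n) (hA : observation F E A).
Context (s : {set 'I_n}).
Local Notation N := #|s|.
Context (hn : n = (N * 4)%N).
Context (SL : forall s : {set 'I_n}, 'M[R]_#|s| -> 'I_n -> 'cV[R]_2).
Context (hSL : spectral_localizer N SL).
Local Notation rr := (rate (R := R) n).
Local Notation upper := [set p : 'I_n * 'I_n | (p.1 < p.2)%N]%SET.

Let n0 : (0 < n)%N. Proof. exact: leq_trans n16. Qed.
Let N0 : (0 < N)%N. Proof. by move: n0; rewrite {1}hn muln_gt0 andbT. Qed.
Let lnn : (0 : R) <= ln n%:R. Proof. by rewrite ln_ge0 // ler1n. Qed.
Let nR : n%:R = 4 * N%:R :> R. Proof. by have := congr1 (fun m => m%:R : R) hn; rewrite /= natrM mulrC. Qed.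

Definition grid_pt (a : 'I_N) : 'cV[R]_2 := cis (ang N a).

Lemma grid_pt_inj : injective grid_pt.
Proof.
move=> a b e; have [k] := cis_eq e.
have p0 : 2 * pi != 0 :> R by rewrite mulf_neq0 // gt_eqF ?pi_gt0.
have NR : N%:R != 0 :> R by rewrite pnatr_eq0 -lt0n.
have cancel2pi (q x y w : R) : q != 0 -> q * x / N%:R = q * y / N%:R + w * q -> x = y + w * N%:R.
  by move=> q0 h; apply: (mulfI q0); apply: (mulIf (invr_neq0 NR)); rewrite h; field.
move=> /(cancel2pi _ _ _ _ p0) /eqP.
rewrite !pmulrn -(intrM R) -(intrD R) eqr_int => /eqP h.
apply: val_inj => /=; move: h (ltn_ord a) (ltn_ord b).
move: (nat_of_ord a) (nat_of_ord b) => x y; move: N => m h xm ym.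
have [k0|[k0|k0]] : (k = 0 \/ 1 <= k \/ k <= -1)%R by lia.
- by move: h; rewrite k0; lia.
- have {}k0 : m%:Z <= k * m%:Z by rewrite ler_peMl.
  by move: h k0 xm; clear; lia.
- have {}k0 : m%:Z <= - k * m%:Z by rewrite ler_peMl // lerNr.
  by move: h k0 ym; clear; lia.
Qed.

Definition grid_config (p : {ffun 'I_N -> 'I_N}) (j : 'I_n) : 'cV[R]_2 :=
  if [pick l | enum_val l == j] is Some l then grid_pt (p l) else 0.

Lemma grid_configE p l : grid_config p (enum_val l) = grid_pt (p l).
Proof.
rewrite /grid_config; case: pickP => [l' /eqP /enum_val_inj -> //|/(_ l)].
by rewrite eqxx.
Qed.

Lemma grid_config_circle p j : j \in s -> circle (grid_config p j).
Proof.
by move=> js; rewrite -(enum_rankK_in js js) grid_configE; exact: circle_cis.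
Qed.

Definition localized_at (p : {ffun 'I_N -> 'I_N}) : set 'M[R]_N :=
  [set M | forall l k, SL M (enum_val l) k 0 = grid_pt (p l) k 0].

Definition row_excess (p : {ffun 'I_N -> 'I_N}) (i : 'I_n) (y z : 'I_N) : set 'M[R]_n :=
  [set M | 8 * N%:R * rr * dcirc (grid_pt y) (grid_pt z) <
     \sum_(j in s) (M i j - F i j) *
       (dcirc (grid_pt y) (grid_config p j) - dcirc (grid_pt z) (grid_config p j))].

(** The localized points range over finitely many grid configurations [p]. Splitting over [p] writes
    the failure as a finite union of events of the block A_ss intersected with events of the row i,
    in which the weights are deterministic. *)
Definition refinement_failure : set 'M[R]_n :=
  [set M | exists c : 'I_n * 'I_N * 'I_N, exists p : {ffun 'I_N -> 'I_N},
     c.1.1 \notin s /\ localized_at p (submx_of s M) /\ row_excess p c.1.1 c.1.2 c.2 M].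

Lemma localized_at_measurable p : mx_measurable (localized_at p).
Proof.
have [_ mSL] := hSL (erefl N).
pose F0 l k : set (@mx_algebra R N N) := [set M | SL M (enum_val l) k 0 = grid_pt (p l) k 0].
have h l k : measurable (F0 l k).
  exact: (mSL (enum_val l) k [set grid_pt (p l) k 0] (enum_valP l) (measurable_set1 _)).
exact: (measurable_forall (fun l => measurable_forall (h l))).
Qed.

Lemma submx_of_measurable d' (T' : measurableType d') (f : T' -> 'M[R]_n) B :
  (forall a c, measurable_fun setT (fun w => f w a c)) -> mx_measurable B ->
  measurable [set w | B (submx_of s (f w))].
Proof.
move=> mf; apply: (mx_measurable_fun (f := fun w => submx_of s (f w))) => l l'.
have -> : (fun w => submx_of s (f w) l l') = (fun w => f w (enum_val l) (enum_val l')).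
  by apply/funext => w; rewrite !mxE.
exact: mf.
Qed.

Lemma row_form_measurable d' (T' : measurableType d') (f : T' -> 'M[R]_n) p i y z :
  (forall c, c \in s -> measurable_fun setT (fun w => f w i c)) ->
  measurable [set w | row_excess p i y z (f w)].
Proof.
move=> mf; apply: measurable_gt_cst.
set c := fun j => dcirc (grid_pt y) (grid_config p j) - dcirc (grid_pt z) (grid_config p j).
have -> : (fun w => \sum_(j in s) (f w i j - F i j) * c j) =
    (fun w => \sum_(j in s) c j * (f w i j - F i j)).
  by apply/funext => w; apply: eq_bigr => j _; rewrite mulrC.
apply: measurable_lincomb => j js; apply: measurable_realfun.measurable_funB.
  exact: mf.
exact: measurable_cst.
Qed.

Lemma refinement_failure_measurable : mx_measurable refinement_failure.
Proof.
pose F0 c p : set (@mx_algebra R n n) := [set M | c.1.1 \notin s /\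
  localized_at p (submx_of s M) /\ row_excess p c.1.1 c.1.2 c.2 M].
suff h c p : measurable (F0 c p) by exact: (measurable_exists (fun c => measurable_exists (h c))).
rewrite /F0; have me a b := @mx_entry_measurable_fun R n n a b.
case: (boolP (c.1.1 \notin s)) => cs; last first.
  rewrite [X in measurable X](_ : _ = set0); first exact: (@measurable0 _ (@mx_algebra R n n)).
  by apply/seteqP; split => // M [].
rewrite [X in measurable X](_ : _ = [set M | localized_at p (submx_of s M)] `&` row_excess p c.1.1 c.1.2 c.2).
  apply: (@measurableI _ (@mx_algebra R n n)).
    exact: (submx_of_measurable me (localized_at_measurable p)).
  exact: (@row_form_measurable _ (@mx_algebra R n n) (fun M => M) p _ _ _ (fun b _ => me _ b)).
by apply/seteqP; split => M [? h]; [|split].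
Qed.

Lemma localized_at_disjoint p p' M : localized_at p M -> localized_at p' M -> p = p'.
Proof.
move=> h h'; apply/ffunP => l; apply: grid_pt_inj.
by apply: vec2P; rewrite -h -h'.
Qed.
(** The weights have squared norm at most N d(y, z)^2. At t = 4 sqrt (ln n) the tail is n^-8, and t
    sqrt N = 8 N rate because ln n = n rate^2 = 4 N rate^2. *)
Lemma row_excess_prob p i y z : i \notin s ->
  (P [set w | row_excess p i y z (A w)] <= ((n%:R ^+ 8)^-1)%:E)%E.
Proof.
move=> iS.
pose b j := dcirc (grid_pt y) (grid_config p j) - dcirc (grid_pt z) (grid_config p j).
pose B := row_coef s i b; pose t : R := 4 * Num.sqrt (ln n%:R).
have t0 : 0 <= t by rewrite mulr_ge0 // sqrtr_ge0.
have [_ _ _ sub] := hE; have tail := sub B t t0.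
have te : - (t ^+ 2 / 2) = - (8%:R * ln n%:R).
  by rewrite /t exprMn sqr_sqrtr //; congr (- _); field.
rewrite te expR_ln_powN // in tail; apply: le_trans tail; apply: le_measure; rewrite ?inE.
- by apply: row_form_measurable => c _; exact: (observation_measurable hE hA).
- by apply: measurable_gt_cst; exact: (measurable_noise_form hE).
move=> w; rewrite /row_excess /=.
have [sA _ hAE] := hA w.
rewrite (row_noise (E := fun q => E q w) sA symF hAE b iS); apply: le_lt_trans.
rewrite row_weight //.
set D := dcirc (grid_pt y) (grid_pt z).
have cg a : circle (grid_pt a) by exact: circle_cis.
have D0 : 0 <= D by exact: dcirc_ge0.
have r0 : 0 <= rr by exact: rate_ge0.
rewrite -ler_sqr ?nnegrE ?mulr_ge0 ?sqrtr_ge0 //.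
rewrite exprMn sqr_sqrtr; last by apply: sumr_ge0 => j _; exact: sqr_ge0.
have hb : \sum_(j in s) b j ^+ 2 <= N%:R * D ^+ 2.
  apply: le_trans (_ : \sum_(j in s) D ^+ 2 <= _); last by rewrite sumr_const -[leLHS]mulr_natl.
  apply: ler_sum => j js; have cj := grid_config_circle p js.
  rewrite -[leLHS]real_normK ?num_real // ler_sqr ?nnegrE // /b ler_norml.
  have h1 := dcirc_triangle (cg y) (cg z) cj.
  have h2 := dcirc_triangle (cg z) (cg y) cj.
  move: h2; rewrite (dcircC (cg z) (cg y)) -/D => h2.
  by rewrite -/D in h1; lra.
apply: le_trans (ler_wpM2l (sqr_ge0 _) hb) _.
rewrite /t exprMn sqr_sqrtr // -(rate_sqr R n0) nR.
by rewrite le_eqVlt; apply/orP; left; apply/eqP; ring.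
Qed.

(** The first event reads the pairs inside s, the second the pairs that join i to s; these are
    disjoint because i is outside s. Pairs are listed above the diagonal, whence the two cases in
    [J2]. *)
Lemma localized_row_independent p i y z : i \notin s ->
  (P [set w | localized_at p (submx_of s (A w)) /\ row_excess p i y z (A w)] =
   P [set w | localized_at p (submx_of s (A w))] * P [set w | row_excess p i y z (A w)])%E.
Proof.
move=> iS.
pose J1 := [set q : 'I_n * 'I_n | (q.1 < q.2)%N && ((q.1 \in s) && (q.2 \in s))]%SET.
pose J2 := [set q : 'I_n * 'I_n | (q.1 < q.2)%N &&
  (((q.1 == i) && (q.2 \in s)) || ((q.2 == i) && (q.1 \in s)))]%SET.
have s1 : J1 \subset upper by apply/fintype.subsetP => q; rewrite !finset.inE => /andP[].
have s2 : J2 \subset upper by apply/fintype.subsetP => q; rewrite !finset.inE => /andP[].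
have [mE _ ind _] := hE.
apply: (block_independent mE ind s1 s2).
- move=> q; rewrite !finset.inE => /andP[-> /=].
  by case/orP => /andP[/eqP -> _]; rewrite (negPf iS) ?andbF.
- have me l l' : measurable_fun setT (fun w : block_algebra E J1 => submx_of s (A w) l l').
    have -> : (fun w => submx_of s (A w) l l') = (fun w => A w (enum_val l) (enum_val l')).
      by apply/funext => w; rewrite !mxE.
    have [->|ll] := eqVneq l l'.
      rewrite (_ : (fun w => _) = cst 0); first exact: measurable_cst.
      by apply/funext => w; have [_ ->] := hA w.
    apply: (entry_block_measurable hA) => //; first by rewrite (inj_eq enum_val_inj).
    have lt : enum_val l != enum_val l' by rewrite (inj_eq enum_val_inj).
    rewrite !finset.inE /= !enum_valP !andbT.
    by case: ltngtP lt => // [||/val_inj ->]; [left|right|rewrite eqxx].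
  exact: (mx_measurable_fun me (localized_at_measurable p)).
- apply: (row_form_measurable (T' := block_algebra E J2)) => c cs.
  apply: (entry_block_measurable hA) => //; first by apply: contraNneq iS => ->.
  have ic : i != c by apply: contraNneq iS => ->.
  rewrite !finset.inE /= !eqxx cs /= orbT !andbT.
  by case: ltngtP ic => // [||/val_inj ->]; [left|right|rewrite eqxx].
Qed.

(* No factor is lost on the number of configurations p: the events [localized_at p] are
   disjoint and independent of row i. *)
Lemma refinement_failure_prob :
  (P [set w | refinement_failure (A w)] <= ((n%:R ^+ 2)^-1)%:E)%E.
Proof.
have mA a c := observation_measurable hE hA a c.
have mL p : measurable [set w | localized_at p (submx_of s (A w))].
  exact: (submx_of_measurable mA (localized_at_measurable p)).
have mR p i y z : measurable [set w | row_excess p i y z (A w)].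
  by apply: row_form_measurable => c _; exact: mA.
pose H c p := [set w | c.1.1 \notin s /\ localized_at p (submx_of s (A w)) /\ row_excess p c.1.1 c.1.2 c.2 (A w)].
have HE c p : c.1.1 \notin s -> H c p = [set w | localized_at p (submx_of s (A w))]
    `&` [set w | row_excess p c.1.1 c.1.2 c.2 (A w)].
  by move=> cs; apply/seteqP; split => w; [case|].
have H0 c p : c.1.1 \in s -> H c p = set0.
  by move=> cs; apply/seteqP; split => // w [/negP].
have mH c p : measurable (H c p).
  case: (boolP (c.1.1 \in s)) => cs; first by rewrite H0.
  by rewrite HE //; exact: measurableI.
have mH' c : measurable [set w | exists p, H c p w] by exact: measurable_exists (mH c).
have PH c : (P [set w | exists p, H c p w] <= ((n%:R ^+ 8)^-1)%:E)%E.
  case: (boolP (c.1.1 \in s)) => cs.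
    rewrite [X in P X](_ : _ = set0) ?measure0 ?lee_fin ?invr_ge0 ?exprn_ge0 //.
    by apply/seteqP; split => // w [p]; rewrite H0.
  apply: le_trans (union_bound P (mH c)) _.
  apply: le_trans (_ : \sum_p P [set w | localized_at p (submx_of s (A w))] * ((n%:R ^+ 8)^-1)%:E <= _)%E.
    apply: lee_sum => p _; rewrite HE // localized_row_independent //.
    by apply: lee_wpmul2l => //; exact: row_excess_prob.
  rewrite -ge0_sume_distrl //.
  rewrite -[leRHS]mul1e; apply: lee_wpmul2r; first by rewrite lee_fin invr_ge0 exprn_ge0.
  apply: (probability_sum_disjoint P mL) => p p' w; exact: localized_at_disjoint.
apply: le_trans (union_bound_cst mH' PH) _.
have nR0 : (0 : R) < n%:R by rewrite ltr0n.
rewrite lee_fin !card_prod !card_ord ler_pdivrMr ?exprn_gt0 // mulrC ler_pdivlMr ?exprn_gt0 //.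
rewrite -!natrX -natrM ler_nat.
have Nn : (N <= n)%N by rewrite [leqRHS]hn leq_pmulr.
apply: leq_trans (_ : n * n * n * n ^ 2 <= _)%N; first by rewrite !leq_mul.
by rewrite mulnn -expnSr -expnD leq_pexp2l.
Qed.

Lemma refinement_noise_ok w i y z : ~ refinement_failure (A w) -> i \notin s ->
  Cgrid N y -> Cgrid N z ->
  - (8 * N%:R * rr * dcirc y z) <=
  \sum_(j in s) (A w i j - F i j) *
    (dcirc z (SL (submx_of s (A w)) j) - dcirc y (SL (submx_of s (A w)) j)).
Proof.
move=> hw iS [a ya] [c zc].
have [sA _ _] := hA w.
have [hloc _] := hSL (erefl N).
have [|X [v [sig [k [_ _ _ _ xtE]]]]] := hloc (submx_of s (A w)).
  by apply/matrixP => l l'; rewrite !mxE -{1}sA mxE.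
have lt l : ((k.+1 + ((sig^-1)%g l).+1) %% N < N)%N by rewrite ltn_pmod.
pose p := [ffun l => Ordinal (lt l)].
have hp l : SL (submx_of s (A w)) (enum_val l) = grid_pt (p l).
  rewrite -{1}(permKV sig l) xtE /grid_pt ffunE /=.
  exact: esym (@cis_ang_mod R N (k.+1 + ((sig^-1)%g l).+1) N0).
rewrite leNgt; apply/negP => h; apply: hw.
exists (i, a, c), p; split => //; split; first by move=> l kk; rewrite hp.
rewrite /row_excess /= -ltrN2; move: h; rewrite ya zc; congr (_ < _).
  rewrite -sumrN; apply: eq_bigr => j js.
  have -> : SL (submx_of s (A w)) j = grid_config p j.
    by rewrite -(enum_rankK_in js js) hp grid_configE.
  by rewrite /grid_pt /ang; ring.
Qed.

End RefinementNoise.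

(** * Assembly *)

Section Sampling.
Context {R : realType} (n N : nat) (n4 : n = (N * 4)%N).
Context d (T : measurableType d) (P : probability T R).
Context (A : T -> 'M[R]_n) (S S' : T -> {set 'I_n}) (hS : uniform_sampling P N A S S').
Context (mA : forall a c, measurable_fun setT (fun w => A w a c)).
Local Open Scope ereal_scope.

Let mB (B : set 'M[R]_n) : mx_measurable B -> measurable [set w | B (A w)].
Proof. exact: mx_measurable_fun. Qed.

Let mS s : measurable [set w | S w = s].
Proof. by have [_ /(_ s)[]] := hS. Qed.

Let mS' s : measurable [set w | S' w = s].
Proof. by have [_ /(_ s)[]] := hS. Qed.

Lemma sample_event_measurable (B : {set 'I_n} -> set 'M[R]_n) (Z : T -> {set 'I_n}) :
  (forall s, measurable [set w | Z w = s]) -> (forall w, #|Z w| = N) ->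
  (forall s : {set 'I_n}, #|s| = N -> mx_measurable (B s)) -> measurable [set w | B (Z w) (A w)].
Proof.
move=> mZ cZ hB.
have -> : [set w | B (Z w) (A w)] =
    [set w | exists s : {set 'I_n}, (if #|s| == N then [set w | B s (A w)] `&` [set w | Z w = s] else set0) w].
  apply/seteqP; split => w; first by move=> h; exists (Z w); rewrite cZ eqxx.
  by case=> s; case: ifP => // _ [h /= e]; rewrite /= e.
apply: measurable_exists => s; case: eqP => cs; last exact: measurable0.
  apply: measurableI => //.
exact: mB (hB s cs).
Qed.

Lemma first_sample (B : {set 'I_n} -> set 'M[R]_n) :
  (forall s : {set 'I_n}, #|s| = N -> mx_measurable (B s)) ->
  P [set w | B (S w) (A w)] <=
    \sum_(s : {set 'I_n} | #|s| == N) P [set w | B s (A w)] * ('C(n, N)%:R^-1)%:E.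
Proof.
move=> hB; have [cS _ h1 _] := hS.
pose G (s : {set 'I_n}) := if #|s| == N then [set w | B s (A w)] `&` [set w | S w = s] else set0.
have -> : [set w | B (S w) (A w)] = [set w | exists s, G s w].
  apply/seteqP; split => w.
    by move=> h; exists (S w); rewrite /G; have [-> _ _] := cS w; rewrite eqxx.
  by case=> s; rewrite /G; case: ifP => // _ [h /= e]; rewrite /= e.
have mG s : measurable (G s).
  rewrite /G; case: eqP => cs; last exact: measurable0.
  by apply: measurableI => //; exact: mB (hB s cs).
apply: le_trans (union_bound P mG) _.
rewrite [leRHS]big_mkcond /=; apply: lee_sum => s _.
rewrite /G; case: eqP => cs; last by rewrite measure0.
by rewrite -(h1 _ _ (hB s cs) cs).
Qed.

Lemma card_disjoint_samples (s' : {set 'I_n}) : #|s'| = N ->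
  #|[set s : {set 'I_n} | (#|s| == N) && (s' \subset ~: s)]%SET| = 'C(n - N, N).
Proof.
move=> cs; have <- : #|~: s'| = (n - N)%N.
  by rewrite -[in RHS]cs -[X in (X - _)%N]card_ord -(cardsC s') addKn.
rewrite -cards_draws; apply: eq_card => s; rewrite !finset.inE andbC.
by congr (_ && _); rewrite finset.subsetC.
Qed.

(** Summing over the first sample: the number C(n - N, N) of sets s disjoint from a given s' cancels
    the conditional weight. So S' alone obeys the same bound as S. *)
Lemma second_sample (B : {set 'I_n} -> set 'M[R]_n) :
  (forall s : {set 'I_n}, #|s| = N -> mx_measurable (B s)) ->
  P [set w | B (S' w) (A w)] <=
    \sum_(s : {set 'I_n} | #|s| == N) P [set w | B s (A w)] * ('C(n, N)%:R^-1)%:E.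
Proof.
move=> hB; have [cS _ h1 h2] := hS.
pose ok (c : {set 'I_n} * {set 'I_n}) := [&& #|c.1| == N, #|c.2| == N & c.2 \subset ~: c.1].
pose G c := if ok c then [set w | [/\ B c.2 (A w), S w = c.1 & S' w = c.2]] else set0.
have -> : [set w | B (S' w) (A w)] = [set w | exists c, G c w].
  apply/seteqP; split => w.
    move=> h; exists (S w, S' w); rewrite /G /ok /=.
    by have [-> -> ->] := cS w; rewrite eqxx.
  by case=> c; rewrite /G; case: ifP => // _ [h _ e]; rewrite /= e.
have mG c : measurable (G c).
  rewrite /G; case: ifP => [/and3P[_ /eqP c2 _]|_]; last exact: measurable0.
  rewrite (_ : [set w | _] = [set w | B c.2 (A w)] `&` ([set w | S w = c.1] `&` [set w | S' w = c.2])).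
    by apply: measurableI; [exact: mB (hB _ c2)|exact: measurableI].
  by apply/seteqP; split => w; [case|case=> ? []].
apply: le_trans (union_bound P mG) _.
have PG c : P (G c) = if ok c then P [set w | B c.2 (A w)] * ('C(n, N)%:R^-1)%:E * ('C(n - N, N)%:R^-1)%:E else 0.
  rewrite /G; case: ifP => [/and3P[/eqP c1 /eqP c2 c3]|_]; last exact: measure0.
  by rewrite (h2 _ _ _ (hB _ c2) c1 c2 c3) (h1 _ _ (hB _ c2) c1).
rewrite (eq_bigr _ (fun c _ => PG c)) -big_mkcond /=.
rewrite (eq_bigl (fun c : {set 'I_n} * {set 'I_n} => (c.1 \in predT) && ((#|c.2| == N) && ((#|c.1| == N) && (c.2 \subset ~: c.1))))).
  rewrite -(pair_big_dep xpredT (fun s s' : {set 'I_n} => (#|s'| == N) && ((#|s| == N) && (s' \subset ~: s)))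
    (fun _ (s' : {set 'I_n}) => P [set w | B s' (A w)] * ('C(n, N)%:R^-1)%:E * ('C(n - N, N)%:R^-1)%:E)) /=.
  rewrite (exchange_big_dep (fun s' : {set 'I_n} => #|s'| == N)) /=; last by move=> s s' _ /andP[].
  apply: lee_sum => s' /eqP cs'.
  under eq_bigl do rewrite cs' eqxx /=.
  set x := P _ * _.
  have C0 : ('C(n - N, N)%:R : R) != 0%R.
    rewrite pnatr_eq0 -lt0n bin_gt0 n4; lia.
  have xf : x \is a fin_num.
    by rewrite /x; apply: fin_numM => //; apply: fin_num_measure; exact: mB (hB _ cs').
  rewrite -(fineK xf) -EFinM sumEFin lee_fin sumr_const.
  rewrite (_ : #|_| = 'C(n - N, N)); first by rewrite -[leLHS]mulr_natr -mulrA mulVf ?mulr1.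
  by rewrite -(card_disjoint_samples cs'); apply: eq_card => s; rewrite !finset.inE.
by move=> c; rewrite /ok /=; case: (_ == N); rewrite ?andbF.
Qed.

Lemma sample_union (Z : T -> {set 'I_n}) (B : {set 'I_n} -> set 'M[R]_n) (c : R) :
  P [set w | B (Z w) (A w)] <=
    \sum_(s : {set 'I_n} | #|s| == N) P [set w | B s (A w)] * ('C(n, N)%:R^-1)%:E ->
  (forall s : {set 'I_n}, #|s| = N -> P [set w | B s (A w)] <= c%:E) ->
  P [set w | B (Z w) (A w)] <= c%:E.
Proof.
move=> h hc; apply: le_trans h _.
have C0 : ('C(n, N)%:R : R) != 0%R by rewrite pnatr_eq0 -lt0n bin_gt0 n4; lia.
apply: le_trans (_ : \sum_(s : {set 'I_n} | #|s| == N) (c * 'C(n, N)%:R^-1)%:E <= _).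
  apply: lee_sum => s /eqP cs; rewrite EFinM; apply: lee_wpmul2r; last exact: hc.
  by rewrite lee_fin invr_ge0.
rewrite sumEFin lee_fin sumr_const -[leLHS]mulr_natr -mulrA.
rewrite (_ : #|_| = 'C(n, N)); first by rewrite mulVf ?mulr1.
rewrite -[in RHS](card_ord n) -card_draws; apply: eq_card => s; by rewrite finset.inE.
Qed.

Lemma sample_fails (Z : T -> {set 'I_n}) (bad : pred {set 'I_n}) (c : R) :
  P [set w | bad (Z w)] <=
    \sum_(s : {set 'I_n} | #|s| == N) P [set w : T | bad s] * ('C(n, N)%:R^-1)%:E ->
  (#|[set s : {set 'I_n} | (#|s| == N) && bad s]%SET|%:R <= 'C(n, N)%:R * c)%R ->
  P [set w | bad (Z w)] <= c%:E.
Proof.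
move=> h hc; apply: le_trans h _.
have C0 : (0 < 'C(n, N)%:R :> R)%R by rewrite ltr0n bin_gt0 n4; lia.
apply: le_trans (_ : \sum_(s : {set 'I_n} | (#|s| == N) && bad s) ('C(n, N)%:R^-1)%:E <= _).
  rewrite [leRHS]big_mkcondr; apply: lee_sum => s _; case: ifP => _.
    by rewrite (_ : [set _ : T | true] = setT) ?probability_setT ?mul1e //; apply/seteqP; split.
  by rewrite (_ : [set _ : T | false] = set0) ?measure0 ?mul0e //; apply/seteqP; split.
rewrite sumEFin lee_fin sumr_const -[leLHS]mulr_natr mulrC ler_pdivrMr // mulrC.
apply: le_trans hc; rewrite ler_nat; apply: eq_leq; apply: eq_card => s.
by rewrite finset.inE.
Qed.

End Sampling.

(** The infimum runs over finitely many configurations and is attained. Grid positions 1, ..., n are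
    reduced modulo n to 0, ..., n - 1. *)
Lemma dist_PiGrid_perm {R : realType} (n : nat) (xs : 'I_n -> 'cV[R]_2) (c : R) :
  (0 < n)%N -> dist_PiGrid xs <= c ->
  exists sg : 'S_n, forall i, dcirc (xs i) (cis (ang n (sg i))) <= c.
Proof.
move=> n0 hc.
pose pt (s : 'S_n) j : 'cV[R]_2 := cis (2 * pi * (s j).+1%:R / n%:R).
have [s _ hs] := arg_minP (fun s => dinf xs (pt s)) (erefl (xpredT (1%g : 'S_n))).
have hle : dinf xs (pt s) <= c.
  apply: le_trans hc; apply: lb_le_inf.
    by exists (dinf xs (pt 1%g)), (pt 1%g) => //; exists 1%g.
  by move=> _ [y [s' hy] <-]; rewrite (_ : y = pt s') ?hs //; apply/funext => j; rewrite hy.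
have lt i : ((s i).+1 %% n < n)%N by rewrite ltn_pmod.
have inj : injective (fun i => Ordinal (lt i)).
  move=> i i' /(congr1 val) /= /eqP.
  by rewrite -(addn1 (s i)) -(addn1 (s i')) eqn_modDr !modn_small // => /eqP /val_inj /perm_inj.
exists (perm inj) => i; rewrite permE /= cis_ang_mod //.
by apply: le_trans hle; rewrite /dinf /dinf_on; apply: (le_bigmax_cond _ (fun i => dcirc (xs i) (pt s i))).
Qed.

(** * Measurability of the distance up to orthogonal maps *)

Section DistOrth.
Context {R : realType} (n : nat).
Implicit Types (x y : 'I_n -> 'cV[R]_2) (c : R).

Lemma dinf_le x y c : 0 <= c -> (forall i, dcirc (x i) (y i) <= c) -> dinf x y <= c.
Proof. by move=> c0 h; apply: bigmax_le. Qed.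

Lemma dinf_ge x y i : dcirc (x i) (y i) <= dinf x y.
Proof. by apply: (le_bigmax_cond _ (fun i => dcirc (x i) (y i))). Qed.

Lemma dist_orth_le_dinf x y Q : orthogonal2 Q -> dist_orth x y <= dinf x (orth_act Q y).
Proof.
move=> oQ; apply: ge_inf; last by exists Q.
by exists 0 => _ [Q' _ <-]; exact: bigmax_ge_id.
Qed.

Lemma dist_orth_le_pi x y : (forall i, circle (x i)) -> (forall i, circle (y i)) ->
  dist_orth x y <= pi.
Proof.
move=> cx cy; apply: le_trans (dist_orth_le_dinf _ _ orthogonal2_1) _.
apply: dinf_le => [|i]; first exact: pi_ge0.
by apply: dcirc_le_pi => //; rewrite /orth_act mul1mx.
Qed.

(* Replaces the infimum over the orthogonal group by countably many conditions. *)
Lemma dist_orth_leP x y c : (forall i, circle (x i)) -> (forall i, circle (y i)) -> 0 <= c ->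
  dist_orth x y <= c <-> forall m : nat, exists (b : bool) (a : 'I_m.+1), forall i,
    dcirc (x i) (rot_mx (ang m.+1 a) b *m y i) <= c + 8 / m.+1%:R.
Proof.
move=> cx cy c0; split => [h m|h]; last first.
  apply/ler_addgt0Pr => e e0.
  have [m hm] : exists m : nat, 8 / m.+1%:R <= e.
    exists (Num.truncn (8 / e)); rewrite ler_pdivrMr // mulrC -ler_pdivrMr //.
    by rewrite ltW // truncnS_gt.
  have [b [a ha]] := h m.
  apply: le_trans (dist_orth_le_dinf _ _ (rot_mx_orth (ang m.+1 a) b)) _.
  apply: dinf_le => [|i]; first by rewrite addr_ge0 // ltW.
  by apply: le_trans (ha i) _; rewrite lerD2l.
have p0 := pi_gt0 R; have p2 := pihalf_lt2 R.
have mR : (0 : R) < m.+1%:R by [].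
(* The slack 8 / (m + 1) is split into 2 pi / (m + 1) for rounding the angle and a positive
   remainder, as pi < 4, for approaching the infimum. *)
pose e : R := (8 - 2 * pi) / m.+1%:R.
have e0 : 0 < e by rewrite divr_gt0 //; lra.
have hinf : has_inf [set dinf x (orth_act Q y) | Q in orthogonal2].
  split; first by exists (dinf x (orth_act 1%:M y)), 1%:M => //; exact: orthogonal2_1.
  by exists 0 => _ [Q' _ <-]; exact: bigmax_ge_id.
have [_ [Q oQ <-] hQ] := inf_adherent e0 hinf.
have [al [b [/andP[al0 al1] Qcis]]] := orthogonal2_cis oQ.
pose u := al * m.+1%:R / (2 * pi).
have u0 : 0 <= u by rewrite /u !mulr_ge0 // invr_ge0 mulr_ge0 // ltW.
have /andP[ua ub] := truncn_itv u0.
have lt : (Num.truncn u < m.+1)%N.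
  rewrite -(ltr_nat R); apply: le_lt_trans ua _.
  by rewrite /u ltr_pdivrMr ?mulr_gt0 // mulrC ltr_pM2l.
exists b, (Ordinal lt) => i.
have cQ : circle (Q *m y i) by apply: circle_orth.
have cr : circle (rot_mx (ang m.+1 (Ordinal lt)) b *m y i).
  by apply: circle_orth => //; exact: rot_mx_orth.
apply: le_trans (dcirc_triangle (cx i) cQ cr) _.
have h1 : dcirc (x i) (Q *m y i) <= c + e.
  apply: le_trans (dinf_ge x (orth_act Q y) i) _; apply: le_trans (ltW hQ) _.
  by rewrite lerD2r.
have h2 : dcirc (Q *m y i) (rot_mx (ang m.+1 (Ordinal lt)) b *m y i) <= 2 * pi / m.+1%:R.
  have [t [_ ->]] := circle_cisP (cy i); rewrite Qcis rot_mx_cis.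
  apply: le_trans (dcirc_cis_le _ _) _; rewrite opprD addrACA subrr addr0 /=.
  have -> : al = 2 * pi / m.+1%:R * u.
    have E (q : R) : 0 < q -> al = q / m.+1%:R * (al * m.+1%:R / q).
      by move=> q0; field; rewrite !gt_eqF.
    by rewrite /u -E // mulr_gt0.
  rewrite /ang -[X in _ - X]mulrAC -mulrBr normrM gtr0_norm ?divr_gt0 ?mulr_gt0 //.
  rewrite -[leRHS]mulr1 ler_wpM2l ?divr_ge0 ?mulr_ge0 ?(ltW p0) //.
  rewrite -natr1 in ub; rewrite ler_norml; lra.
have -> : c + 8 / m.+1%:R = c + e + 2 * pi / m.+1%:R.
  by rewrite /e mulrBl; ring.
exact: lerD.
Qed.

(** For e < pi, a distance to a fixed point is at most e exactly when the scalar product is at least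
    cos e, a condition linear in the coordinates of [xhat]. For e >= pi it always holds. *)
Lemma dist_orth_measurable d (T : measurableType d) (xhat : T -> 'I_n -> 'cV[R]_2) y c :
  (forall w i, circle (xhat w i)) -> (forall i, circle (y i)) -> 0 <= c ->
  (forall j (k : 'I_2), measurable_fun setT (fun w => xhat w j k 0)) ->
  measurable [set w | dist_orth (xhat w) y <= c].
Proof.
move=> cx cy c0 mx.
have -> : [set w | dist_orth (xhat w) y <= c] =
    \bigcap_m [set w | exists b : bool, exists a : 'I_m.+1, forall i,
       dcirc (xhat w i) (rot_mx (ang m.+1 a) b *m y i) <= c + 8 / m.+1%:R].
  apply/seteqP; split => w /=.
    by move=> /(dist_orth_leP (cx w) cy c0) h m _; exact: h.
  by move=> h; apply/(dist_orth_leP (cx w) cy c0) => m; exact: h.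
apply: bigcapT_measurable => m.
apply: measurable_exists => b; apply: measurable_exists => a; apply: measurable_forall => i.
set q := rot_mx _ _ *m y i; set e := c + _.
have cq : circle q by apply: circle_orth => //; exact: rot_mx_orth.
have e0 : 0 <= e by rewrite addr_ge0.
have [pe|ep] := leP pi e.
  rewrite [X in measurable X](_ : _ = setT) //; apply/seteqP; split => // w _ /=.
  exact: le_trans (dcirc_le_pi (cx w i) cq) pe.
rewrite [X in measurable X](_ : _ = [set w | `[cos e, +oo[%classic (dot2 (xhat w i) q)]).
  apply: measurable_fun_preimage => //.
  have -> : (fun w => dot2 (xhat w i) q) = (fun w => \sum_(k < 2) q k 0 * xhat w i k 0).
    by apply/funext => w; rewrite sum2E /dot2 ![q _ _ * _]mulrC.
  by apply: measurable_lincomb => k _; exact: mx.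
apply/seteqP; split => w /=; rewrite in_itv /= andbT -cos_dcirc //.
  by move=> h; rewrite leNgt ltr_cos -?leNgt // in_itv /=; rewrite ?e0 ?(ltW ep) ?dcirc_ge0 ?dcirc_le_pi.
by rewrite leNgt ltr_cos -?leNgt // in_itv /=; rewrite ?e0 ?(ltW ep) ?dcirc_ge0 ?dcirc_le_pi.
Qed.

End DistOrth.

Section Constants.
Context {R : realType} (cl cL ce ca cb : R).
Context (cl0 : 0 < cl) (cL0 : 0 <= cL) (ce0 : 0 <= ce) (ca0 : 0 <= ca) (cb0 : 0 < cb).

(** 48 is the constant of the operator norm bound on the noise, 8 that of the noise along a row. *)
Definition close_const : R := final_refine_const cl cL ce ca cb 48 8.

(* Above this rate the bound exceeds pi, and the theorem is trivial. *)
Definition rate_threshold : R :=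
  Num.min (1 / 1000) (Num.min
    (cb / (2 * (4 * lip_const cL ce + 2 * full_const cL ce ca + 2 * ce + 1)))
    (1 / (2 * (plane_const cL ce ca cb 48 + 1)))).

Let lip0 : 0 <= lip_const cL ce.
Proof. by rewrite /lip_const !addr_ge0 ?mulr_ge0. Qed.

Let full0 : 0 <= full_const cL ce ca.
Proof. by rewrite /full_const addr_ge0 ?mulr_ge0. Qed.

Let plane0 : 0 <= plane_const cL ce ca cb 48.
Proof.
have s0 : 0 <= sample_const cL ce ca 48.
  by rewrite /sample_const !addr_ge0 ?mulr_ge0 ?addr_ge0.
by rewrite /plane_const divr_ge0 ?(ltW cb0) // addr_ge0 ?mulr_ge0.
Qed.

Lemma close_const_ge0 : 0 <= close_const.
Proof.
have cli : 0 <= cl^-1 by rewrite invr_ge0 ltW.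
have loc0 : 0 <= locate_const cL ce ca cb 48 by rewrite /locate_const; move: plane_const plane0 ca0 => p p0 a0; lra.
rewrite /close_const /final_refine_const /refine_const addr_ge0 //.
by apply: mulr_ge0; rewrite ?mulr_ge0 ?addr_ge0 ?mulr_ge0.
Qed.

Lemma align_const_ge0 : 0 <= align_const ca close_const.
Proof. by rewrite /align_const; have := close_const_ge0; have := ca0; lra. Qed.

Let X0 : 0 < 4 * lip_const cL ce + 2 * full_const cL ce ca + 2 * ce + 1.
Proof. by rewrite ltr_wpDl // !addr_ge0 ?mulr_ge0. Qed.

Let Y0 : 0 < plane_const cL ce ca cb 48 + 1.
Proof. by rewrite ltr_wpDl. Qed.

Lemma rate_threshold_gt0 : 0 < rate_threshold.
Proof.
have k2 : (0 : R) < 2 by [].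
rewrite /rate_threshold lt_min; apply/andP; split; first by lra.
by rewrite lt_min (divr_gt0 cb0 (mulr_gt0 k2 X0)) (divr_gt0 ltr01 (mulr_gt0 k2 Y0)).
Qed.

Lemma below_threshold (r : R) : 0 <= r <= rate_threshold ->
  [/\ r <= 1 / 1000, (2 * ce + 2 * full_const cL ce ca) * r < cb,
    (4 * lip_const cL ce + 2 * full_const cL ce ca) * r <= cb / 2
  & plane_const cL ce ca cb 48 * r <= 1 / 2].
Proof.
rewrite /rate_threshold !le_min => /and4P[r0 r1].
rewrite ler_pdivlMr ?(mulr_gt0 _ X0) // ler_pdivlMr ?(mulr_gt0 _ Y0) // => r2 r3.
have lr := mulr_ge0 lip0 r0; have fr := mulr_ge0 full0 r0; have cr := mulr_ge0 ce0 r0.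
have cb0' := cb0; split => //; lra.
Qed.

End Constants.

Section Deterministic.
Context {R : realType} (n : nat) (cl cL ce ca cb : R) (f : 'cV[R]_2 -> 'cV[R]_2 -> R).
Context (hf : biLipschitz n cl cL ce f) (hgeo : geometric_fun f).
Context (cl0 : 0 < cl) (cL0 : 0 <= cL) (ce0 : 0 <= ce) (ca0 : 0 <= ca) (cb0 : 0 < cb).
Local Notation rr := (rate (R := R) n).
Context (rr1 : rr <= rate_threshold cL ce ca cb) (n16 : (16 <= n)%N).

Lemma ln_ge1 : 1 <= ln n%:R :> R.
Proof.
have e2 : expR (1 / 2) <= 2 :> R.
  by have := @expR_le_quadratic R (1 / 2); rewrite expr2 => /(_ _) H; apply: le_trans (H _) _; lra.
have nR : (16 : R) <= n%:R by rewrite (ler_nat R 16).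
rewrite -[leLHS]expRK ler_ln ?posrE ?expR_gt0 //; last by lra.
have -> : (1 : R) = 1 / 2 + 1 / 2 by lra.
have e0 := expR_gt0 (1 / 2 : R).
rewrite expRD; have := ler_pM (ltW e0) (ltW e0) e2 e2; lra.
Qed.

(** Since n rate^2 = ln n >= 1, a rate below 1 / 1000 forces n rate >= 1 and n >= 32. The latter
    provides N >= 8, which n >= 16 alone does not. *)
Lemma large_sample : 1 <= n%:R * rr /\ (32 <= n)%N.
Proof.
have [r1 _ _ _] := below_threshold cL0 ce0 ca0 cb0 (introT andP (conj (rate_ge0 n) rr1)).
have r0 : 0 <= rr := rate_ge0 n.
have h : n%:R * rr ^+ 2 = ln n%:R by rewrite rate_sqr // (leq_trans _ n16).
have := ln_ge1; rewrite -h expr2 mulrA => h1.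
have nr : 1 <= n%:R * rr.
  apply: le_trans h1 _; rewrite ler_piMr ?mulr_ge0 //; lra.
split => //; rewrite -(ler_nat R 32).
have k : rr * 32 <= 1 by move: r1; move: rr => u; lra.
have {}k := ler_wpM2l (ler0n R n) k.
by move: k nr; rewrite mulrA mulr1; move: (n%:R * rr) => u; lra.
Qed.

Context (xs : 'I_n -> 'cV[R]_2) (hxs : forall i, circle (xs i)).
Context (sg : 'S_n) (hsg : forall i, dcirc (xs i) (cis (ang n (sg i))) <= ca * rr).
Context (lam : seq R) (hlam : sorted_eigenvalues (signal_mx f xs) lam).
Context (hgap : cb * n%:R <= Num.min (lam`_0 - lam`_1) (lam`_2 - lam`_3)).

Definition good_sample (A : 'M[R]_n) (s : {set 'I_n}) (xt : 'I_n -> 'cV[R]_2) : Prop :=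
  [/\ evenly_spread sg s (6 * rr * n%:R), spectral_localization (submx_of s A) xt
    & forall i y z, i \notin s -> Cgrid #|s| y -> Cgrid #|s| z ->
        - (8 * #|s|%:R * rr * dcirc y z) <=
        \sum_(j in s) (A i j - signal_mx f xs i j) * (dcirc z (xt j) - dcirc y (xt j))].

Lemma localize_and_refine_close (N : nat) (A : 'M[R]_n) (S S' : {set 'I_n})
    (xt xt' xhat : 'I_n -> 'cV[R]_2) :
  n = (N * 4)%N -> #|S| = N -> #|S'| = N -> S' \subset ~: S ->
  A^T = A -> (forall i, A i i = 0) ->
  opn (off_diag_noise f xs A) (48 * n%:R * rr) ->
  good_sample A S xt -> good_sample A S' xt' ->
  localize_and_refine N A S S' xt xt' xhat ->
  dist_orth xhat xs <= align_const ca (close_const cl cL ce ca cb) * rr.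
Proof.
move=> hn cS cS' dS symA diagA hW gS gS' [x2 [x2' [Qh [ref ref' [oQh hQh] hout hin]]]].
have [r1 s1 s2 s3] := below_threshold cL0 ce0 ca0 cb0 (introT andP (conj (rate_ge0 n) rr1)).
have [nr n32] := large_sample.
have N8 : (8 <= N)%N by move: hn n32; clear; lia.
have w0 : (0 : R) <= 48 by [].
have b0 : (0 : R) <= 8 by [].
have one (s : {set 'I_n}) xt0 x0 : #|s| = N -> good_sample A s xt0 -> refinement N A s xt0 x0 ->
    exists2 Q : 'M[R]_2, orthogonal2 Q & forall i, i \notin s ->
      circle (x0 i) /\ dcirc (x0 i) (Q *m xs i) <= close_const cl cL ce ca cb * rr.
  move=> cs [spr loc noi] hx; rewrite -cs in hn N8 hx.
  exact: (sample_refined hf hgeo cl0 cL0 ce0 ca0 cb0 w0 hxs hsg hlam hgap symA diagA hW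
    hn N8 nr spr s1 s2 s3 b0 loc noi hx).
have [Q1 oQ1 h1] := one _ _ _ cS gS ref.
have [Q2 oQ2 h2] := one _ _ _ cS' gS' ref'.
have [spr _ _] := gS; have [spr' _ _] := gS'.
rewrite -cS in hn N8.
exact: (alignment_close ca0 (close_const_ge0 cl0 cL0 ce0 ca0 cb0) (rate_ge0 n) r1 hn N8 dS hxs hsg
  spr spr' oQ1 oQ2 oQh h1 h2 hQh hout hin).
Qed.

End Deterministic.

Lemma localize_and_refine_circle {R : realType} (n N : nat) (A : 'M[R]_n) (S S' : {set 'I_n})
    (xt xt' xhat : 'I_n -> 'cV[R]_2) : S' \subset ~: S ->
  localize_and_refine N A S S' xt xt' xhat -> forall j, circle (xhat j).
Proof.
move=> dS [x2 [x2' [Q [ref ref' [oQ _] hout hin]]]] j.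
have [jS|jS] := boolP (j \in S); last first.
  by rewrite hout //; have [[a ->] _] := ref j jS; exact: circle_cis.
rewrite hin //; apply: circle_orth => //.
have jS' : j \notin S' by apply/negP => /(fintype.subsetP dS); rewrite finset.inE jS.
by have [[a ->] _] := ref' j jS'; exact: circle_cis.
Qed.

Section FinalProbability.
Context {R : realType} (N : nat).
Local Notation n := (N * 4)%N.
Context (n16 : (16 <= n)%N).
Context d (T : measurableType d) (P : probability T R).
Context (F : 'M[R]_n) (symF : F^T = F) (E : 'I_n * 'I_n -> T -> R) (hE : noise P E).
Context (A : T -> 'M[R]_n) (hA : observation F E A).
Context (S S' : T -> {set 'I_n}) (hS : uniform_sampling P N A S S').
Context (SL SL' : forall s : {set 'I_n}, 'M[R]_#|s| -> 'I_n -> 'cV[R]_2).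
Context (hSL : spectral_localizer N SL) (hSL' : spectral_localizer N SL').
Context (sg : 'S_n) (rr1 : rate n <= 1 / 2 :> R).

Let N1 : (1 < N)%N. Proof. by move: n16; clear; lia. Qed.
Let mA a c : measurable_fun setT (fun w => A w a c).
Proof. exact: (observation_measurable hE hA). Qed.

Definition spread_set (s : {set 'I_n}) : bool := `[< evenly_spread sg s (6 * rate n * n%:R : R) >].

Definition sample_failure (L : forall s : {set 'I_n}, 'M[R]_#|s| -> 'I_n -> 'cV[R]_2)
    (Z : T -> {set 'I_n}) : set T :=
  [set w | refinement_failure F (Z w) L (A w)] `|` [set w | ~~ spread_set (Z w)].

Lemma sample_failure_prob (L : forall s : {set 'I_n}, 'M[R]_#|s| -> 'I_n -> 'cV[R]_2)
    (Z : T -> {set 'I_n}) :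
  spectral_localizer N L -> (forall s, measurable [set w | Z w = s]) -> (forall w, #|Z w| = N) ->
  (forall B : {set 'I_n} -> set 'M[R]_n, (forall s : {set 'I_n}, #|s| = N -> mx_measurable (B s)) ->
    (P [set w | B (Z w) (A w)] <=
    \sum_(s : {set 'I_n} | #|s| == N) P [set w | B s (A w)] * ('C(n, N)%:R^-1)%:E)%E) ->
  measurable (sample_failure L Z) /\ (P (sample_failure L Z) <= (2 / n%:R ^+ 2)%:E)%E.
Proof.
move=> hL mZ cZ hZ.
have mR (s : {set 'I_n}) : #|s| = N -> mx_measurable (refinement_failure F s L).
  by move=> cs; apply: refinement_failure_measurable; rewrite cs.
have mD (s : {set 'I_n}) : mx_measurable [set M : 'M[R]_n | ~~ spread_set s].
  case: (~~ _).
    by rewrite (_ : [set _ | _] = setT); [exact: (@measurableT _ (@mx_algebra R n n))|apply/seteqP; split].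
  by rewrite (_ : [set _ | _] = set0); [exact: (@measurable0 _ (@mx_algebra R n n))|apply/seteqP; split].
have m1 : measurable [set w | refinement_failure F (Z w) L (A w)].
  exact: (sample_event_measurable mA mZ cZ mR).
have m2 : measurable [set w | ~~ spread_set (Z w)].
  exact: (sample_event_measurable mA (B := fun s => [set M | ~~ spread_set s]) mZ cZ (fun s _ => mD s)).
split; first exact: measurableU.
have p1 : (P [set w | refinement_failure F (Z w) L (A w)] <= ((n%:R ^+ 2)^-1)%:E)%E.
  apply: (sample_union erefl (hZ _ mR)) => s cs.
  have hn : n = (#|s| * 4)%N by rewrite cs.
  by apply: (refinement_failure_prob n16 symF hE hA hn); rewrite cs.
have p2 : (P [set w | ~~ spread_set (Z w)] <= ((n%:R ^+ 2)^-1)%:E)%E.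
  apply: (@sample_fails _ _ _ erefl _ _ P Z (fun s => ~~ spread_set s)).
    exact: (hZ (fun s => [set M | ~~ spread_set s]) (fun s _ => mD s)).
  exact: (spread_fail_card sg N1 rr1).
apply: le_trans (measureU2 _ m1 m2) _; apply: le_trans (leeD p1 p2) _.
by rewrite -EFinD lee_fin mulr2n mulrDl mul1r.
Qed.

(** One n^-2 for the operator norm and two for each sample: five in all, within the allowed nine. *)
Lemma good_event_prob : exists2 U : set T, measurable U &
  (P U <= (9 / n%:R ^+ 2)%:E)%E /\ forall w, ~ U w ->
    opn (\matrix_(i, j) (if i == j then 0 else A w i j - F i j)) (48 * n%:R * rate n) /\
    ~ sample_failure SL S w /\ ~ sample_failure SL' S' w.
Proof.
have [cS mS _ _] := hS.
have [G mG [pG hG]] := noise_opn_event n16 symF hE hA.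
have [m1 p1] := sample_failure_prob hSL (fun s => (mS s).1) (fun w => let: And3 h _ _ := cS w in h)
  (first_sample hS mA).
have [m2 p2] := sample_failure_prob hSL' (fun s => (mS s).2) (fun w => let: And3 _ h _ := cS w in h)
  (second_sample erefl hS mA).
exists (G `|` (sample_failure SL S `|` sample_failure SL' S')).
  by apply: measurableU => //; exact: measurableU.
split; last by move=> w /not_orP[/hG h /not_orP[h1 h2]].
apply: le_trans (measureU2 _ mG (measurableU _ _ m1 m2)) _.
apply: le_trans (leeD pG (le_trans (measureU2 _ m1 m2) (leeD p1 p2))) _.
rewrite -!EFinD lee_fin; have : 0 <= (n%:R ^+ 2)^-1 :> R by rewrite invr_ge0 exprn_ge0.
by move: (_^-1) => u; lra.
Qed.

End FinalProbability.

Theorem theorem4p1 (R : realType) (ca cb ce cl cL : R)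
    (hca : 0 < ca) (hcb : 0 < cb) (hce : 0 < ce) (hcl : 0 < cl) (hcL : cl <= cL) :
  exists C : R, 0 < C /\
    forall (n : nat) (hn : (16 <= n)%N) (hn4 : (4 %| n)%N)
      (xstar : 'I_n -> 'cV[R]_2) (hx : forall i, circle (xstar i))
      (f : 'cV[R]_2 -> 'cV[R]_2 -> R)
      (hf : biLipschitz n cl cL ce f) (hgeo : geometric_fun f)
      (lam : seq R) (hlam : sorted_eigenvalues (signal_mx f xstar) lam)
      (d : measure_display) (T : measurableType d) (P : probability T R)
      (E : 'I_n * 'I_n -> T -> R) (hE : noise P E)
      (A : T -> 'M[R]_n) (hA : observation (signal_mx f xstar) E A)
      (hPi : dist_PiGrid xstar <= ca * Num.sqrt (ln n%:R / n%:R))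
      (hgap : cb * n%:R <= Num.min (lam`_0 - lam`_1) (lam`_2 - lam`_3))
      (S S' : T -> {set 'I_n}) (hS : uniform_sampling P (n %/ 4) A S S')
      (SL SL' : forall s : {set 'I_n}, 'M[R]_#|s| -> 'I_n -> 'cV[R]_2)
      (hSL : spectral_localizer (n %/ 4) SL)
      (hSL' : spectral_localizer (n %/ 4) SL')
      (xhat : T -> 'I_n -> 'cV[R]_2)
      (hmeas : forall j (k : 'I_2), measurable_fun setT (fun w => xhat w j k 0))
      (hxhat : forall w,
         localize_and_refine (n %/ 4) (A w) (S w) (S' w)
           (SL (S w) (submx_of (S w) (A w)))
           (SL' (S' w) (submx_of (S' w) (A w)))
           (xhat w)),
      ((1 - 9 / n%:R ^+ 2)%:E <=
       P [set w | (dist_orth (xhat w) xstar <= C * Num.sqrt (ln n%:R / n%:R))%R])%E.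
Proof.
have cL0 : 0 < cL := lt_le_trans hcl hcL.
have [ca0 ce0] := (ltW hca, ltW hce).
pose a : R := align_const ca (close_const cl cL ce ca cb).
pose th : R := rate_threshold cL ce ca cb.
have a0 : 0 <= a by exact: (align_const_ge0 hcl (ltW cL0) ce0 ca0 hcb).
have th0 : 0 < th by exact: (rate_threshold_gt0 (ltW cL0) ce0 ca0 hcb).
have C0 : 0 < a + 4 / th by rewrite ltr_wpDl // divr_gt0.
(* The term [a] serves rates up to [th]; for larger ones (4 / th) rate exceeds 4 >= pi, which bounds
   every distance. *)
exists (a + 4 / th); split => // n hn hn4; have [N nN] := dvdnP hn4; subst n.
rewrite mulnK // => xs hx f hf hgeo lam hlam d T P E hE A hA hPi hgap S S' hS SL SL' hSL hSL' xhat hmeas hxhat.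
rewrite -/(rate (N * 4)) in hPi *.
have r0 : 0 <= rate (N * 4) :> R := rate_ge0 _.
have [cS _ _ _] := hS.
have cx w j : circle (xhat w j).
  have [_ _ dS] := cS w; exact: (localize_and_refine_circle dS (hxhat w)).
have nge0 : 0 <= 9 / (N * 4)%:R ^+ 2 :> R by rewrite divr_ge0 // exprn_ge0.
have [hr|hr] := leP (rate (N * 4)) th; last first.
  rewrite (_ : [set w | _] = setT).
    by rewrite probability_setT lee_fin; lra.
  apply/seteqP; split => // w _ /=.
  apply: le_trans (dist_orth_le_pi (cx w) hx) _.
  apply: le_trans (_ : 4 / th * rate (N * 4) <= _); last by rewrite ler_wpM2r // lerDr.
  rewrite mulrAC ler_pdivlMr //.
  have p4 : pi <= 4 :> R by have := pihalf_lt2 R; lra.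
  exact: ler_pM (pi_ge0 R) (ltW th0) p4 (ltW hr).
have [r1 _ _ _] := below_threshold (ltW cL0) ce0 ca0 hcb (introT andP (conj r0 hr)).
have r2 : rate (N * 4) <= 1 / 2 :> R by lra.
have n0 : (0 < N * 4)%N by apply: leq_trans hn.
have [sg hsg] := dist_PiGrid_perm n0 hPi.
have symF := signal_mx_sym hf hx.
have [U mU [pU hU]] := good_event_prob hn symF hE hA hS hSL hSL' sg r2.
have mZ := dist_orth_measurable cx hx (mulr_ge0 (ltW C0) r0) hmeas.
apply: le_trans (_ : P (~` U) <= _)%E.
  rewrite probability_setC // EFinB; apply: leeB => //.
apply: le_measure; rewrite ?inE //; first exact: measurableC.
move=> w /hU [hW [/not_orP[f1 d1] /not_orP[f2 d2]]] /=.
have [cs cs' dS] := cS w; have [sA dA _] := hA w.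
have gs (s : {set 'I_(N * 4)}) (L : forall s : {set 'I_(N * 4)}, 'M[R]_#|s| -> 'I_(N * 4) -> 'cV[R]_2) :
    spectral_localizer N L -> #|s| = N ->
    ~ refinement_failure (signal_mx f xs) s L (A w) -> ~ ~~ @spread_set R N sg s ->
    good_sample f xs sg (A w) s (L s (submx_of s (A w))).
  move=> hL cs0 hf0 hs0; have hn0 : (N * 4)%N = (#|s| * 4)%N by rewrite cs0.
  have hL0 : spectral_localizer #|s| L by rewrite cs0.
  split; first by case: (boolP (@spread_set R N sg s)) => [/asboolP //|h]; case: (hs0 h).
    have [h _] := hL0 _ erefl; apply: h.
    by apply/matrixP => l l'; rewrite !mxE -{1}sA mxE.
  by move=> i y z; exact: (refinement_noise_ok hn hA hn0 hL0 hf0).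
apply: le_trans (localize_and_refine_close hf hgeo hcl (ltW cL0) ce0 ca0 hcb hr hn hx hsg hlam hgap
  erefl cs cs' dS sA dA hW (gs _ _ hSL cs f1 d1) (gs _ _ hSL' cs' f2 d2) (hxhat w)) _.
by rewrite ler_wpM2r // lerDl divr_ge0 // ltW.
Qed.
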